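(* Let $c:\mathbb{R}^n\to\mathbb{R}^m$ be $\mathcal{C}^2$, let $g:\mathbb{R}^m\to\mathbb{R}\cup\{+\infty\}$ be proper and lower semicontinuous, and let $F=g\circ c$. Let $x^\star$ be a strong minimizer of $F$, i.e. there exist $\eta>0,\epsilon>0$ such that $F(x)\ge F(x^\star)+\eta\|x-x^\star\|^2$ for all $x\in\mathcal{B}(x^\star,\epsilon)$. Assume that $x^\star$ is qualified (see context) relative to $(g,c)$ and a manifold $\mathcal{M}^{g\star}\subset\mathbb{R}^m$, and let $\mathcal{M}^\star=c^{-1}(\mathcal{M}^{g\star})$ (near $x^\star$) be the corresponding optimal manifold. Assume that the smooth extension $\tilde F$ of $F$ relative to $\mathcal{M}^\star$ and the corresponding manifold-defining map $h$ are $\mathcal{C}^2$ with Lipschitz second derivatives, and that the Jacobian of the constraints $h$ is full rank near $x^\star$. If $x_0$ and $F(x_0)$ are close enough to $x^\star$ and $F(x^\star)$, $\gamma_0$ is large enough, and the assumptions (nonconvex stability) and (no Maratos effect) stated in the context hold, then there exists $C>0$ such that the iterates $(x_k,\mathcal{M}_k)$ generated by the structure-exploiting algorithm described in the context satisfy $$\mathcal{M}_k=\mathcal{M}^\star\quad\text{and}\quad\|x_{k+1}-x^\star\|\le C\|x_k-x^\star\|^2\quad\text{for all }k\text{ large enough.}$$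
   Context: $\partial g$ denotes the general (limiting) subdifferential; $g$ is (Clarke) regular at $y$ if it coincides there with the regular (Fréchet) subdifferential, in the sense of Rockafellar–Wets. For $\gamma>0$, $\mathbf{prox}_{\gamma g}(y)=\operatorname{argmin}_{u}\{g(u)+\frac1{2\gamma}\|u-y\|^2\}$. $\mathrm{proj}$ denotes orthogonal projection and $\mathrm{ri}$ relative interior. Manifolds. $\mathcal{M}$ is a $\mathcal{C}^2$-submanifold of $\mathbb{R}^N$ around $\bar z\in\mathcal{M}$ if there is a $\mathcal{C}^2$ manifold-defining map $h:\mathbb{R}^N\to\mathbb{R}^{N-p}$ with surjective derivative at $\bar z$ such that, for $z$ near $\bar z$, $z\in\mathcal{M}\Leftrightarrow h(z)=0$. $T_z\mathcal{M}=\ker \mathrm{D}h(z)$, $N_z\mathcal{M}=\operatorname{Im}\mathrm{D}h(z)^*$. Manifolds are understood locally. Prox-regularity. $g$ is prox-regular at $\bar y$ for $\bar v\in\partial g(\bar y)$ if $g$ is finite and locally lower semicontinuous at $\bar y$ and there are $r>0,\epsilon>0$ such that $g(y')\ge g(y)+\langle v,y'-y\rangle-\frac r2\|y'-y\|^2$ whenever $v\in\partial g(y)$, $\|y-\bar y\|<\epsilon$, $\|y'-\bar y\|<\epsilon$, $\|v-\bar v\|<\epsilon$, $g(y)<g(\bar y)+\epsilon$; it is prox-regular at $\bar y$ if this holds for every $\bar v\in\partial g(\bar y)$. $g$ is prox-bounded if $g+\frac R2\|\cdot\|^2$ is bounded below for some $R\ge0$. Partial smoothness. $g$ is ($\mathcal{C}^2$-)partly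 smooth at $\bar y$ relative to a set $\mathcal{M}^g\ni\bar y$ if $\mathcal{M}^g$ is a $\mathcal{C}^2$ manifold around $\bar y$ and: $g|_{\mathcal{M}^g}$ is $\mathcal{C}^2$ near $\bar y$; $g$ is Clarke regular at all $y\in\mathcal{M}^g$ near $\bar y$, with $\partial g(y)\ne\emptyset$; the affine span of $\partial g(\bar y)$ is a translate of $N_{\bar y}\mathcal{M}^g$; the set-valued map $\partial g$ restricted to $\mathcal{M}^g$ is continuous at $\bar y$. For $p\in\mathcal{M}^g$ near $\bar y$, $\operatorname{grad}g(p)=\mathrm{proj}_{T_p\mathcal{M}^g}(\partial g(p))$ (the Riemannian gradient, a single vector). A structure manifold of $g$ at $\bar y$ is a manifold relative to which $g$ is partly smooth at $\bar y$, $g$ being prox-regular there. Normal ascent property at $\bar y$: $0\in\mathrm{ri}\,\mathrm{proj}_{N_{\bar y}\mathcal{M}^g}\partial g(\bar y)$. Curve property at $\bar y$ (for $g$ partly smooth at $\bar y$ relative to $\mathcal{M}^g$): there exist a neighborhood $\mathcal{N}_{\bar y}$ of $\bar y$ and $T>0$ such that any smooth map $e:\mathcal{N}_{\bar y}\times[0,T]\to\mathcal{M}^g$ with $e(y,0)=\mathrm{proj}_{\mathcal{M}^g}(y)$ and $\frac{\mathrm d}{\mathrm dt}e(y,t)|_{t=0}=-\operatorname{grad}g(\mathrm{proj}_{\mathcal{M}^g}(y))$ satisfies $\|\mathrm{proj}_{N_{e(y,t)}\mathcal{M}^g}(e(y,t)-y)\|\le\|y-\mathrm{proj}_{\mathcal{M}^g}(y)\|+\tilde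 L t^2$ for all $y\in\mathcal{N}_{\bar y}$, $t\in[0,T]$, where $\tilde L>0$ is a constant. Qualified point. $\bar x\in\mathbb{R}^n$ is qualified relative to $(g,c)$ and $\mathcal{M}^g$ if: (1) $g$ is prox-bounded and prox-regular at $c(\bar x)$; (2) $g$ is partly smooth at $c(\bar x)$ relative to $\mathcal{M}^g$; (3) $c$ is transversal to $\mathcal{M}^g$ at $\bar x$, i.e. $N_{c(\bar x)}\mathcal{M}^g\cap\ker(\mathrm{D}c(\bar x)^* )=\{0\}$ (then $c^{-1}(\mathcal{M}^g)$ is a submanifold near $\bar x$); (4) $g$ satisfies the normal ascent and curve properties at $c(\bar x)$. Extension and defining map. To a structure manifold $\mathcal{M}^g\subset\mathbb{R}^m$ of $g$ are associated a local manifold-defining map $h^g$ and a smooth extension $\tilde g$ to $\mathbb{R}^m$ of $g|_{\mathcal{M}^g}$. Then $h=h^g\circ c$, with values in $\mathbb{R}^p$, locally defines $\mathcal{M}=c^{-1}(\mathcal{M}^g)$, and $\tilde F=\tilde g\circ c$ is the smooth extension of $F$ relative to $\mathcal{M}$. In the theorem, $\tilde F$ and $h$ are those associated with $\mathcal{M}^{g\star}$, used by the algorithm when the manifold it detects is $\mathcal{M}^{g\star}$. SQP step. Given $(\tilde F,h)$ and $x$, let $\lambda(x)=\operatorname{argmin}_{\lambda\in\mathbb{R}^p}\|\nabla\tilde F(x)+\sum_{i=1}^p\lambda_i\nabla h_i(x)\|^2$, let $L(x,\lambda)=\tilde F(x)+\langle\lambda,h(x)\rangle$, and let $$d^{\mathrm{SQP}}(x)=\operatorname{argmin}_{d\in\mathbb{R}^n}\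 \langle\nabla\tilde F(x),d\rangle+\tfrac12\langle\nabla^2_{xx}L(x,\lambda(x))d,d\rangle\quad\text{s.t. } h(x)+\mathrm{D}h(x)d=0,$$ where $\nabla^2_{xx}L$ is the Hessian of the Lagrangian $L$ with respect to its first argument. Algorithm. Start from $x_0$ near a minimizer and $\gamma_0$ large enough; the stepsizes are halved at each iteration, $\gamma_k=\gamma_{k-1}/2$. At iteration $k$: compute $\mathbf{prox}_{\gamma_k g}(c(x_k))$ and let $\mathcal{M}^g_k$ be the structure manifold of $g$ to which this point belongs; set $\mathcal{M}_k=c^{-1}(\mathcal{M}^g_k)$ with associated $h_k,\tilde F_k$; compute the SQP step $d_k=d^{\mathrm{SQP}}(x_k)$ for $(\tilde F_k,h_k)$; if $F(x_k+d_k)\le F(x_k)$ set $x_{k+1}=x_k+d_k$, otherwise set $x_{k+1}=x_k$. (Nonconvex stability.) The iterates of the algorithm remain in the connected component of the sublevel set $\{x:F(x)\le F(x_0)\}$ that contains $x^\star$. (No Maratos effect.) The iterates of the algorithm are such that a step $d$ that makes $x+d$ quadratically closer to $x^\star$ yields descent: $F(x+d)\le F(x)$. *)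

(* Defs.v *)
From HB Require Import structures.
From mathcomp Require Import all_boot all_order all_algebra.
From mathcomp Require Import all_classical all_reals all_analysis.
Set Implicit Arguments.
Unset Strict Implicit.
Unset Printing Implicit Defensive.
Import Order.TTheory GRing.Theory Num.Theory.
Import numFieldNormedType.Exports.
Local Open Scope classical_set_scope.
Local Open Scope ring_scope.

(* The library norm on ['rV[R]_n] is the sup norm, and
   ['d f x v = v *m 'J f x] for maps between row-vector spaces, so that
   [w *m ('J f x)^T] is the adjoint of the derivative applied to [w]. *)

Definition dotp {R : realType} {n : nat} (u v : 'rV[R]_n) : R :=
  \sum_(i < n) u 0 i * v 0 i.

Definition enorm {R : realType} {n : nat} (u : 'rV[R]_n) : R :=
  Num.sqrt (dotp u u).

Definition argmin {T : Type} {d : Order.disp_t} {O : porderType d}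
    (A : set T) (f : T -> O) : set T :=
  [set a | A a /\ forall b, A b -> (f a <= f b)%O].

(** ** Smoothness *)

(* Only used on finite-dimensional [V], where continuity of the derivative for
   the operator norm is the same as continuity in every direction [v]. *)
Fixpoint Ck_on {R : realType} {V W : normedModType R} (k : nat) (U : set V)
    (f : V -> W) : Prop :=
  if k is k'.+1 then
    (forall x, U x -> differentiable f x) /\
    (forall v, Ck_on k' U (fun x => 'd f x v))
  else forall x, U x -> {for x, continuous f}.

Definition Ck_near {R : realType} {V W : normedModType R} (k : nat) (x : V)
    (f : V -> W) : Prop :=
  exists U : set V, [/\ open U, U x & Ck_on k U f].

Definition C2_lipschitz_near {R : realType} {V W : normedModType R} (x : V)
    (f : V -> W) : Prop :=
  exists (U : set V) (L : R), [/\ open U, U x, Ck_on 2 U f &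
    forall y z, U y -> U z -> forall u v,
      `| 'd (fun w => 'd f w u) y v - 'd (fun w => 'd f w u) z v |
        <= L * `|y - z| * `|u| * `|v|].

Definition gradient {R : realType} {n : nat} (f : 'rV[R]_n -> R^o)
    (x : 'rV[R]_n) : 'rV[R]_n :=
  \row_i 'd f x (delta_mx 0 i).

Definition hessian {R : realType} {n : nat} (f : 'rV[R]_n -> R^o)
    (x : 'rV[R]_n) : 'M[R]_n :=
  'J (gradient f) x.

(** ** Nearest points, affine span, relative interior *)

(* On a linear subspace the nearest point is the orthogonal projection. *)
Definition nearest {R : realType} {n : nat} (A : set 'rV[R]_n) (y : 'rV[R]_n) :
    set 'rV[R]_n :=
  argmin A (fun p => enorm (y - p)).

Definition nearest_image {R : realType} {n : nat} (A B : set 'rV[R]_n) :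
    set 'rV[R]_n :=
  \bigcup_(v in B) nearest A v.

Definition affine_span {R : realType} {n : nat} (A : set 'rV[R]_n) :
    set 'rV[R]_n :=
  [set x | exists (k : nat) (a : 'I_k -> 'rV[R]_n) (w : 'I_k -> R),
     [/\ forall i, A (a i), \sum_i w i = 1 & x = \sum_i w i *: a i]].

Definition relative_interior {R : realType} {n : nat} (A : set 'rV[R]_n) :
    set 'rV[R]_n :=
  [set x | A x /\ exists2 e : R, 0 < e &
     forall y, affine_span A y -> enorm (y - x) < e -> A y].

(** ** Submanifolds *)

Definition defining_map {R : realType} {N q : nat} (M : set 'rV[R]_N)
    (z : 'rV[R]_N) (h : 'rV[R]_N -> 'rV[R]_q) : Prop :=
  [/\ M z, Ck_near 2 z h, row_full ('J h z) &
      \forall y \near z, M y <-> h y = 0].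

Definition C2_manifold_at {R : realType} {N : nat} (M : set 'rV[R]_N)
    (z : 'rV[R]_N) : Prop :=
  exists (q : nat) (h : 'rV[R]_N -> 'rV[R]_q), defining_map M z h.

(* The tangent and normal spaces do not depend on the defining map; they are
   empty at the points around which [M] is not a manifold. *)
Definition tangent_space {R : realType} {N : nat} (M : set 'rV[R]_N)
    (z : 'rV[R]_N) : set 'rV[R]_N :=
  [set v | exists (q : nat) (h : 'rV[R]_N -> 'rV[R]_q),
     defining_map M z h /\ v *m 'J h z = 0].

Definition normal_space {R : realType} {N : nat} (M : set 'rV[R]_N)
    (z : 'rV[R]_N) : set 'rV[R]_N :=
  [set v | exists (q : nat) (h : 'rV[R]_N -> 'rV[R]_q),
     defining_map M z h /\ exists w : 'rV[R]_q, v = w *m ('J h z)^T].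

Definition transversal_at {R : realType} {n m : nat}
    (c : 'rV[R]_n -> 'rV[R]_m) (M : set 'rV[R]_m) (x : 'rV[R]_n) : Prop :=
  normal_space M (c x) `&` [set w | w *m ('J c x)^T = 0] = [set 0].

(** ** Variational analysis of extended-real-valued functions *)

Definition proper_function {R : realType} {m : nat} (g : 'rV[R]_m -> \bar R) :
    Prop :=
  (forall y, g y != -oo%E) /\ (exists y, (g y < +oo)%E).

Definition reg_subdiff {R : realType} {m : nat} (g : 'rV[R]_m -> \bar R)
    (y : 'rV[R]_m) : set 'rV[R]_m :=
  [set v | g y \is a fin_num /\ forall e : R, 0 < e -> \forall z \near y,
     (g y + (dotp v (z - y) - e * enorm (z - y))%:E <= g z)%E].

Definition subdiff {R : realType} {m : nat} (g : 'rV[R]_m -> \bar R)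
    (y : 'rV[R]_m) : set 'rV[R]_m :=
  [set v | g y \is a fin_num /\
     exists (ys vs : nat -> 'rV[R]_m),
       [/\ ys @ \oo --> y, (fun k => g (ys k)) @ \oo --> g y, vs @ \oo --> v &
           forall k, reg_subdiff g (ys k) (vs k)]].

Definition clarke_regular {R : realType} {m : nat} (g : 'rV[R]_m -> \bar R)
    (y : 'rV[R]_m) : Prop :=
  subdiff g y = reg_subdiff g y.

Definition prox {R : realType} {m : nat} (gamma : R)
    (g : 'rV[R]_m -> \bar R) (y : 'rV[R]_m) : set 'rV[R]_m :=
  argmin setT (fun u => (g u + (enorm (u - y) ^+ 2 / (2 * gamma))%:E)%E).

Definition prox_bounded {R : realType} {m : nat} (g : 'rV[R]_m -> \bar R) :
    Prop :=
  exists r b : R, 0 <= r /\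
    forall y, (b%:E <= g y + (r / 2 * enorm y ^+ 2)%:E)%E.

(* Rockafellar--Wets, Definition 1.33 *)
Definition locally_lsc {R : realType} {m : nat} (g : 'rV[R]_m -> \bar R)
    (y : 'rV[R]_m) : Prop :=
  exists2 e : R, 0 < e & forall a : R, (a%:E <= g y + e%:E)%E ->
    closed [set z | enorm (z - y) <= e /\ (g z <= a%:E)%E].

Definition prox_regular_for {R : realType} {m : nat}
    (g : 'rV[R]_m -> \bar R) (ybar vbar : 'rV[R]_m) : Prop :=
  [/\ g ybar \is a fin_num, locally_lsc g ybar &
      exists r e : R, [/\ 0 < r, 0 < e &
        forall y y' v, subdiff g y v ->
          enorm (y - ybar) < e -> enorm (y' - ybar) < e ->
          enorm (v - vbar) < e -> (g y < g ybar + e%:E)%E ->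
          (g y + (dotp v (y' - y) - r / 2 * enorm (y' - y) ^+ 2)%:E
             <= g y')%E]].

Definition prox_regular {R : realType} {m : nat} (g : 'rV[R]_m -> \bar R)
    (ybar : 'rV[R]_m) : Prop :=
  forall vbar, subdiff g ybar vbar -> prox_regular_for g ybar vbar.

(* Continuity of [S] restricted to [M] is outer plus inner semicontinuity
   (Painleve--Kuratowski). *)
Definition setmap_continuous_at {R : realType} {m : nat}
    (S : 'rV[R]_m -> set 'rV[R]_m) (M : set 'rV[R]_m) (ybar : 'rV[R]_m) :
    Prop :=
  (forall (ys vs : nat -> 'rV[R]_m) (v : 'rV[R]_m),
     (forall k, M (ys k)) -> (forall k, S (ys k) (vs k)) ->
     ys @ \oo --> ybar -> vs @ \oo --> v -> S ybar v) /\
  (forall v, S ybar v -> forall e : R, 0 < e ->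
     \forall y \near ybar, M y -> exists2 w, S y w & enorm (w - v) < e).

(* [gt] is a C2 function on the ambient space which agrees with [g] on [M]
   near [y]. *)
Definition smooth_extension {R : realType} {m : nat}
    (g : 'rV[R]_m -> \bar R) (M : set 'rV[R]_m) (y : 'rV[R]_m)
    (gt : 'rV[R]_m -> R^o) : Prop :=
  Ck_near 2 y gt /\ \forall z \near y, M z -> g z = (gt z)%:E.

Record partly_smooth {R : realType} {m : nat} (g : 'rV[R]_m -> \bar R)
    (M : set 'rV[R]_m) (ybar : 'rV[R]_m) : Prop := PartlySmooth {
  ps_manifold : C2_manifold_at M ybar;
  ps_restriction : exists gt, smooth_extension g M ybar gt;
  ps_regular : \forall y \near ybar,
    M y -> clarke_regular g y /\ subdiff g y !=set0;
  ps_sharp : exists a,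
    affine_span (subdiff g ybar) = [set a + w | w in normal_space M ybar];
  ps_continuous : setmap_continuous_at (subdiff g) M ybar }.

Definition structure_manifold {R : realType} {m : nat}
    (g : 'rV[R]_m -> \bar R) (M : set 'rV[R]_m) (y : 'rV[R]_m) : Prop :=
  partly_smooth g M y /\ prox_regular g y.

Definition normal_ascent {R : realType} {m : nat} (g : 'rV[R]_m -> \bar R)
    (M : set 'rV[R]_m) (ybar : 'rV[R]_m) : Prop :=
  relative_interior (nearest_image (normal_space M ybar) (subdiff g ybar)) 0.

(* [P y] is the projection of [y] on [M], and [G y] the Riemannian gradient of
   [g] at [P y]; both are asked to be well defined on [Nb].
   "Smooth" maps [Nb * [0, T] -> M] are the restrictions of maps of class C1 on
   an open superset: for a C2 manifold, [P] and [G] are in general no better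
   than C1, so that a higher class would leave no map [e] to consider.
   The constant [L] depends on [e]. *)
Definition curve_property {R : realType} {m : nat} (g : 'rV[R]_m -> \bar R)
    (M : set 'rV[R]_m) (ybar : 'rV[R]_m) : Prop :=
  exists (Nb : set 'rV[R]_m) (T : R) (P G : 'rV[R]_m -> 'rV[R]_m),
  [/\ nbhs ybar Nb, 0 < T,
      forall y, Nb y -> nearest M y = [set P y] /\
        nearest_image (tangent_space M (P y)) (subdiff g (P y)) = [set G y] &
      forall e : 'rV[R]_m * R^o -> 'rV[R]_m,
        (exists U, [/\ open U, Ck_on 1 U e &
           forall y t, Nb y -> 0 <= t <= T -> U (y, t)]) ->
        (forall y t, Nb y -> 0 <= t <= T -> M (e (y, t))) ->
        (forall y, Nb y -> e (y, 0) = P y) ->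
        (forall y, Nb y ->
           is_derive (0 : R^o) 1 (fun t : R^o => e (y, t)) (- G y)) ->
        exists2 L : R, 0 < L & forall y t, Nb y -> 0 <= t <= T ->
          forall w, nearest (normal_space M (e (y, t))) (e (y, t) - y) w ->
            enorm w <= enorm (y - P y) + L * t ^+ 2].

Record qualified {R : realType} {n m : nat} (g : 'rV[R]_m -> \bar R)
    (c : 'rV[R]_n -> 'rV[R]_m) (M : set 'rV[R]_m) (x : 'rV[R]_n) : Prop :=
  Qualified {
  qual_prox_bounded : prox_bounded g;
  qual_prox_regular : prox_regular g (c x);
  qual_partly_smooth : partly_smooth g M (c x);
  qual_transversal : transversal_at c M x;
  qual_normal_ascent : normal_ascent g M (c x);
  qual_curve : curve_property g M (c x) }.

Definition strong_minimizer {R : realType} {n : nat}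
    (F : 'rV[R]_n -> \bar R) (xs : 'rV[R]_n) : Prop :=
  exists eta eps : R, [/\ 0 < eta, 0 < eps &
    forall x, enorm (x - xs) < eps ->
      (F xs + (eta * enorm (x - xs) ^+ 2)%:E <= F x)%E].

(** ** SQP step *)

Definition multiplier {R : realType} {n p : nat} (F : 'rV[R]_n -> R^o)
    (h : 'rV[R]_n -> 'rV[R]_p) (x : 'rV[R]_n) : set 'rV[R]_p :=
  argmin setT (fun l : 'rV[R]_p => enorm (gradient F x +
    \sum_(i < p) l 0 i *: gradient (fun z => h z 0 i) x) ^+ 2).

Definition lagrangian {R : realType} {n p : nat} (F : 'rV[R]_n -> R^o)
    (h : 'rV[R]_n -> 'rV[R]_p) (l : 'rV[R]_p) (x : 'rV[R]_n) : R^o :=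
  F x + dotp l (h x).

Definition sqp_step {R : realType} {n p : nat} (F : 'rV[R]_n -> R^o)
    (h : 'rV[R]_n -> 'rV[R]_p) (x : 'rV[R]_n) : set 'rV[R]_n :=
  [set d | exists2 l, multiplier F h x l &
     argmin [set d : 'rV[R]_n | h x + d *m 'J h x = 0]
       (fun d => dotp (gradient F x) d +
                 2^-1 * dotp (d *m hessian (lagrangian F h l) x) d) d].

(** ** The algorithm *)

(* A manifold of the space [R^m] with the defining map and the extension of [g]
   that the algorithm associates with it. *)
Record structure (R : realType) (m : nat) : Type := Structure {
  mfd : set 'rV[R]_m;
  codim : nat;
  defmap : 'rV[R]_m -> 'rV[R]_codim;
  ext : 'rV[R]_m -> R^o }.

Definition associated_data {R : realType} {m : nat}
    (g : 'rV[R]_m -> \bar R) (s : structure R m) (y : 'rV[R]_m) : Prop :=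
  defining_map (mfd s) y (@defmap _ _ s) /\
  smooth_extension g (mfd s) y (@ext _ _ s).

Definition structure_at {R : realType} {m : nat} (g : 'rV[R]_m -> \bar R)
    (s : structure R m) (y : 'rV[R]_m) : Prop :=
  structure_manifold g (mfd s) y /\ associated_data g s y.

(* [Cat] is the collection of structure manifolds known to the algorithm. A
   manifold is only determined locally by [g], so "the" structure manifold at
   [y] makes sense relative to a collection with this property. *)
Definition catalogue {R : realType} {m : nat} (g : 'rV[R]_m -> \bar R)
    (Cat : set (structure R m)) : Prop :=
  forall s t y, Cat s -> Cat t ->
    structure_at g s y -> structure_at g t y -> s = t.

Definition algorithm_run {R : realType} {n m : nat}
    (g : 'rV[R]_m -> \bar R) (c : 'rV[R]_n -> 'rV[R]_m)
    (Cat : set (structure R m)) (gamma : nat -> R) (x : nat -> 'rV[R]_n)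
    (s : nat -> structure R m) (d : nat -> 'rV[R]_n) : Prop :=
  forall k : nat,
  [/\ gamma k.+1 = gamma k / 2,
      Cat (s k),
      exists2 y, prox (gamma k) g (c (x k)) y & structure_at g (s k) y,
      sqp_step (@ext _ _ (s k) \o c) (@defmap _ _ (s k) \o c) (x k) (d k) &
      x k.+1 = if (g (c (x k + d k)%R) <= g (c (x k)))%E
               then x k + d k else x k].

Definition nonconvex_stability {R : realType} {n : nat}
    (F : 'rV[R]_n -> \bar R) (xs : 'rV[R]_n) (x : nat -> 'rV[R]_n) : Prop :=
  forall k, connected_component [set z | (F z <= F (x 0%N))%E] xs (x k).

(* Being quadratically closer is an asymptotic notion: it comes with a constant
   [K], and is required to yield descent at iterates that are close to [xs],
   namely within a distance [rho K]. *)
Definition no_maratos {R : realType} {n : nat} (F : 'rV[R]_n -> \bar R)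
    (xs : 'rV[R]_n) (rho : R -> R) (x d : nat -> 'rV[R]_n) : Prop :=
  forall K : R, 0 < K -> forall k, enorm (x k - xs) < rho K ->
    enorm (x k + d k - xs) <= K * enorm (x k - xs) ^+ 2 ->
    (F (x k + d k)%R <= F (x k))%E.

(* Main.v *)
(** The partly smooth function [g] has, at [c xstar], a subgradient [v] tangent to
    its manifold (the Riemannian gradient) which, by normal ascent, is interior to
    the subdifferential in the normal directions.  Comparing the value of the
    proximal objective at the proximal point [y] of [c x] with its value at a
    point of the manifold near [c xstar - gamma v] gives
    [(c x - y) / gamma --> v] as soon as [gamma] is small and
    [|c x - c xstar| <= eps gamma].  Prox-regularity, at [v] and at normal
    perturbations of [v], then forces [y] onto the manifold (Hare--Lewis
    identification), and the same argument shows that any other structure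
    manifold at [y] has the same germ, so that the catalogue returns [sstar].

    Strong minimality makes the Hessian of the Lagrangian coercive on the tangent
    space, whence the SQP step is quadratically convergent.  Stability confines
    all the iterates to a small ball; once the halved stepsize enters
    [[Gamma/2, Gamma]] the condition [|c x - c xstar| <= eps gamma] holds, and it
    persists since every accepted SQP step at least halves the distance to
    [xstar]. *)

(* No implicit function theorem is used: a manifold enters through a map strictly differentiable at
   one point with surjective derivative, and an error bound for its zeros supplies approximate
   tangent curves and approximately normal projections. The obstacle in detection is that the
   catalogue returns an equality of structures: [sstar] itself must be shown to be a structure at
   the proximal point, whereas partial smoothness is not an open condition along the manifold. It is
   borrowed from the structure found there by the algorithm, after both germs have been shown equal.
   Above the threshold [G] nothing is known of the detected manifold, so the radius of confinement
   is chosen after [G] and independently of the initial stepsize: wherever the iterates are in that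
   ball when the stepsize falls below [G], their distance is already small relative to it. In the
   SQP part the multiplier is only first-order accurate; quadratic convergence survives because its
   error is always paired with a variation of the Jacobian, which is itself of first order. *)
From HB Require Import structures.
Require Import Defs.
From mathcomp Require Import all_boot all_order all_algebra.
From mathcomp Require Import all_classical all_reals all_analysis.
From mathcomp Require Import ring lra.
Import Order.TTheory GRing.Theory Num.Theory.
Import numFieldNormedType.Exports.
Local Open Scope classical_set_scope.
Local Open Scope ring_scope.

Set Implicit Arguments.
Unset Strict Implicit.
Unset Printing Implicit Defensive.

(** * The Euclidean norm *)

Section Euclidean.
Context {R : realType}.
Implicit Types (n : nat).

Lemma dotpC n (u v : 'rV[R]_n) : dotp u v = dotp v u.
Proof. by apply: eq_bigr => i _; rewrite mulrC. Qed.

Lemma dotpDl n (u v w : 'rV[R]_n) : dotp (u + v) w = dotp u w + dotp v w.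
Proof. by rewrite -big_split; apply: eq_bigr => i _; rewrite !mxE mulrDl. Qed.

Lemma dotpZl n a (u v : 'rV[R]_n) : dotp (a *: u) v = a * dotp u v.
Proof. by rewrite mulr_sumr; apply: eq_bigr => i _; rewrite !mxE mulrA. Qed.

Lemma dotpNl n (u v : 'rV[R]_n) : dotp (- u) v = - dotp u v.
Proof. by rewrite -scaleN1r dotpZl mulN1r. Qed.

Lemma dotpBl n (u v w : 'rV[R]_n) : dotp (u - v) w = dotp u w - dotp v w.
Proof. by rewrite dotpDl dotpNl. Qed.

Lemma dotpDr n (u v w : 'rV[R]_n) : dotp u (v + w) = dotp u v + dotp u w.
Proof. by rewrite dotpC dotpDl !(dotpC u). Qed.

Lemma dotpZr n a (u v : 'rV[R]_n) : dotp u (a *: v) = a * dotp u v.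
Proof. by rewrite dotpC dotpZl dotpC. Qed.

Lemma dotpNr n (u v : 'rV[R]_n) : dotp u (- v) = - dotp u v.
Proof. by rewrite dotpC dotpNl dotpC. Qed.

Lemma dotpBr n (u v w : 'rV[R]_n) : dotp u (v - w) = dotp u v - dotp u w.
Proof. by rewrite dotpDr dotpNr. Qed.

Lemma dot0p n (u : 'rV[R]_n) : dotp 0 u = 0.
Proof. by rewrite -(scale0r 0) dotpZl mul0r. Qed.

Lemma dotp0 n (u : 'rV[R]_n) : dotp u 0 = 0.
Proof. by rewrite dotpC dot0p. Qed.

Lemma dotp_sumr n (I : finType) (u : 'rV[R]_n) (v : I -> 'rV[R]_n) :
  dotp u (\sum_i v i) = \sum_i dotp u (v i).
Proof. by apply: (big_morph (dotp u)) => [x y|]; rewrite ?dotpDr ?dotp0. Qed.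

Lemma dotp_suml n (I : finType) (u : 'rV[R]_n) (v : I -> 'rV[R]_n) :
  dotp (\sum_i v i) u = \sum_i dotp (v i) u.
Proof. by rewrite dotpC dotp_sumr; apply: eq_bigr => i _; rewrite dotpC. Qed.

Lemma dotp_ge0 n (u : 'rV[R]_n) : 0 <= dotp u u.
Proof. by apply: sumr_ge0 => i _; rewrite -expr2 sqr_ge0. Qed.

Lemma dotp_delta n (u : 'rV[R]_n) i : dotp u (delta_mx 0 i) = u 0 i.
Proof.
rewrite /dotp (bigD1 i) //= big1 => [|j ji]; first by rewrite mxE !eqxx mulr1 addr0.
by rewrite mxE (negPf ji) andbF mulr0.
Qed.

Lemma enorm_ge0 n (u : 'rV[R]_n) : 0 <= enorm u.
Proof. exact: sqrtr_ge0. Qed.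
Hint Resolve enorm_ge0 : core.

Lemma sqr_enorm n (u : 'rV[R]_n) : enorm u ^+ 2 = dotp u u.
Proof. by rewrite sqr_sqrtr ?dotp_ge0. Qed.

Lemma enorm0 n : enorm (0 : 'rV[R]_n) = 0.
Proof. by rewrite /enorm dotp0 sqrtr0. Qed.

Lemma enorm_eq0 n (u : 'rV[R]_n) : enorm u = 0 -> u = 0.
Proof.
move=> u0; have /eqP : dotp u u = 0 by rewrite -sqr_enorm u0 expr0n.
rewrite psumr_eq0 => [/allP ui|i _]; last by rewrite -expr2 sqr_ge0.
apply/rowP => i; have := ui i (mem_index_enum _).
by rewrite mulf_eq0 orbb mxE => /eqP.
Qed.

Lemma enorm_gt0 n (u : 'rV[R]_n) : u != 0 -> 0 < enorm u.
Proof. by rewrite lt0r enorm_ge0 andbT; apply: contraNneq => /enorm_eq0 ->. Qed.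

Lemma enormZ n a (u : 'rV[R]_n) : enorm (a *: u) = `|a| * enorm u.
Proof. by rewrite /enorm dotpZl dotpZr mulrA sqrtrM -?expr2 ?sqr_ge0// sqrtr_sqr. Qed.

Lemma enormN n (u : 'rV[R]_n) : enorm (- u) = enorm u.
Proof. by rewrite -scaleN1r enormZ normrN1 mul1r. Qed.

Lemma enormBC n (u v : 'rV[R]_n) : enorm (u - v) = enorm (v - u).
Proof. by rewrite -enormN opprB. Qed.

(** Cauchy--Schwarz, by expanding the square norm of [enorm v *: u - enorm u *: v]. *)
Lemma dotp_le n (u v : 'rV[R]_n) : dotp u v <= enorm u * enorm v.
Proof.
have [->|u0] := eqVneq u 0; first by rewrite dot0p enorm0 mul0r.
have [->|v0] := eqVneq v 0; first by rewrite dotp0 enorm0 mulr0.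
have := enorm_gt0 u0; have := enorm_gt0 v0.
have := dotp_ge0 (enorm v *: u - enorm u *: v).
rewrite !(dotpBl, dotpBr, dotpZl, dotpZr) -!sqr_enorm (dotpC v u).
set a := enorm u; set b := enorm v; set x := dotp u v => h b0 a0.
have ab0 : 0 < a * b by rewrite mulr_gt0.
rewrite -(ler_pM2l ab0) -subr_ge0.
by move: h; nra.
Qed.

Lemma norm_dotp n (u v : 'rV[R]_n) : `|dotp u v| <= enorm u * enorm v.
Proof. by rewrite ler_norml lerNl -dotpNl -(enormN u) dotp_le enormN dotp_le. Qed.

Lemma enormD n (u v : 'rV[R]_n) : enorm (u + v) <= enorm u + enorm v.
Proof.
rewrite -ler_sqr ?nnegrE ?addr_ge0// sqr_enorm sqrrD.
rewrite !(dotpDl, dotpDr) -!sqr_enorm (dotpC v).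
by have := dotp_le u v; lra.
Qed.

Lemma sqr_enormB n (u v : 'rV[R]_n) :
  enorm (u - v) ^+ 2 = enorm u ^+ 2 - 2 * dotp u v + enorm v ^+ 2.
Proof. by rewrite !sqr_enorm !(dotpBl, dotpBr) (dotpC v); ring. Qed.

Lemma enormB n (u v : 'rV[R]_n) : enorm (u - v) <= enorm u + enorm v.
Proof. by rewrite -(enormN v) enormD. Qed.

Lemma enorm_dist n (v u w : 'rV[R]_n) : enorm (u - w) <= enorm (u - v) + enorm (v - w).
Proof. by rewrite -[u - w](subrKA v) enormD. Qed.

Lemma enorm_lb n (u v : 'rV[R]_n) : enorm u - enorm v <= enorm (u - v).
Proof. by rewrite lerBlDr -{1}(subrK v u) enormD. Qed.

Lemma norm_le_enorm n (u : 'rV[R]_n) : `|u| <= enorm u.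
Proof.
rewrite [leLHS]/Num.norm /= mx_normrE; apply/bigmax_leP; split=> // -[i j] _ /=.
rewrite ord1 -(sqrtr_sqr (u 0 j)) ler_sqrt ?dotp_ge0//.
by rewrite /dotp (bigD1 j) //= expr2 lerDl sumr_ge0// => k _; rewrite -expr2 sqr_ge0.
Qed.

Lemma norm_coord_le n (u : 'rV[R]_n) i : `|u 0 i| <= `|u|.
Proof.
rewrite [leRHS]/Num.norm /= mx_normrE.
by apply: (le_bigmax_cond _ (fun ij : 'I_1 * 'I_n => `|u ij.1 ij.2|) (j := (0, i))).
Qed.

Lemma norm_le_coord n (u : 'rV[R]_n) e : 0 <= e -> (forall i, `|u 0 i| <= e) -> `|u| <= e.
Proof.
move=> e0 ue; rewrite [leLHS]/Num.norm /= mx_normrE; apply/bigmax_leP; split=> // -[i j] _ /=.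
by rewrite ord1.
Qed.

Lemma enorm_le_norm n (u : 'rV[R]_n) : enorm u <= n%:R * `|u|.
Proof.
rewrite -ler_sqr ?nnegrE ?mulr_ge0// sqr_enorm exprMn.
apply: (@le_trans _ _ (n%:R * `|u| ^+ 2)).
  have -> : n%:R * `|u| ^+ 2 = \sum_(i < n) `|u| ^+ 2 by rewrite sumr_const card_ord mulr_natl.
  apply: ler_sum => i _; rewrite -expr2 -(real_normK (num_real (u 0 i))).
  by apply: lerXn2r; rewrite ?nnegrE// norm_coord_le.
rewrite ler_wpM2r ?sqr_ge0// -natrX ler_nat; case: n {u} => // n.
by rewrite expnS leq_pmulr.
Qed.

(** Neighbourhoods come from the sup norm; through this equivalence they are handled below as
    Euclidean balls. *)
Lemma nearE n (x : 'rV[R]_n) (P : set 'rV[R]_n) :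
  (\forall y \near x, P y) <-> exists2 e : R, 0 < e & forall y, enorm (y - x) < e -> P y.
Proof.
split=> [/nbhs_ballP[e /= e0 xP]|[e e0 xP]].
  exists e => // y yx; apply: xP; rewrite -ball_normE /ball_/=.
  by rewrite distrC (le_lt_trans (norm_le_enorm _)).
(* [n.+1] keeps the divisor positive in dimension 0 as well. *)
apply/nbhs_ballP; exists (e / n.+1%:R) => /= [|y]; first by rewrite divr_gt0.
rewrite -ball_normE /ball_/= distrC ltr_pdivlMr// => yx; apply: xP.
apply: le_lt_trans (enorm_le_norm _) _; apply: le_lt_trans yx.
by rewrite mulrC ler_wpM2l// ler_nat.
Qed.

Lemma nearP n (x : 'rV[R]_n) (P : set 'rV[R]_n) :
  (\forall y \near x, P y) -> exists2 e : R, 0 < e & forall y, enorm (y - x) < e -> P y.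
Proof. by move/nearE. Qed.

Lemma near_enorm n (x : 'rV[R]_n) e : 0 < e -> \forall y \near x, enorm (y - x) < e.
Proof. by move=> e0; apply/nearE; exists e. Qed.

Lemma near_near n (x : 'rV[R]_n) (P : set 'rV[R]_n) :
  (\forall y \near x, P y) -> \forall y \near x, \forall z \near y, P z.
Proof.
move/nearE=> [e e0 xP]; apply/nearE; exists e => // y yx.
apply/nearE; exists (e - enorm (y - x)); first by rewrite subr_gt0.
move=> z zy; apply: xP; apply: le_lt_trans (enorm_dist y _ _) _; lra.
Qed.

Lemma continuous_normE n (W : normedModType R) (f : 'rV[R]_n -> W) (x : 'rV[R]_n) :
  {for x, continuous f} <-> forall e : R, 0 < e -> \forall y \near x, `|f y - f x| < e.
Proof.
have h := @cvgrPdist_lt R W _ (nbhs x) _ f (f x).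
split=> [fx e e0|fx].
  by have /h /(_ _ e0) : f @ nbhs x --> f x by []; apply: filterS => y; rewrite distrC.
by apply/h => e e0; have := fx _ e0; apply: filterS => y; rewrite distrC.
Qed.

Lemma enorm_continuous n : continuous (@enorm R n).
Proof.
move=> x; apply/(@continuous_normE n R^o (@enorm R n)) => e e0.
apply: (filterS _ (near_enorm x e0)) => y yx; rewrite ltr_norml; apply/andP; split.
  by rewrite ltrNl opprB (le_lt_trans (enorm_lb _ _))// enormBC.
by rewrite (le_lt_trans (enorm_lb _ _)).
Qed.

Lemma compact_ball n (x : 'rV[R]_n) r : compact [set y | enorm (y - x) <= r].
Proof.
apply: bounded_closed_compact.
  exists (r + enorm x); split; first by rewrite num_real.
  move=> M rM y /= yx; apply: (le_trans (norm_le_enorm _)); apply: le_trans (ltW rM).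
  by rewrite -lerBlDr (le_trans (enorm_lb _ _)).
have -> : [set y : 'rV[R]_n | enorm (y - x) <= r] =
  (fun y : 'rV[R]_n => enorm (y - x)) @^-1` [set t | t <= r] by [].
apply: closed_comp => [y _|]; last exact: closed_le.
apply: continuous_comp; last exact: enorm_continuous.
by apply: continuousB; [exact: cvg_id|exact: cst_continuous].
Qed.

(* Bolzano--Weierstrass, stated with a cluster point rather than a subsequence *)
Lemma cluster_point n (u : nat -> 'rV[R]_n) r : (forall k, enorm (u k) <= r) ->
  exists l, forall (e : R) N, 0 < e -> exists2 k, (N <= k)%N & enorm (u k - l) < e.
Proof.
move=> ur; have := @compact_ball n 0 r (u @ \oo) _ _.
case=> [|l [_ ul]]; first by exists 0%N => // k _; rewrite /= subr0 ur.
exists l => e N e0; have := ul [set u k | k in [set k | (N <= k)%N]] [set y | enorm (y - l) < e].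
case=> [||y [[k Nk <-] kl]]; last by exists k.
- by exists N => // k Nk; exists k.
- exact: near_enorm.
Unshelve. all: by end_near. Qed.

End Euclidean.
#[global] Hint Extern 0 (is_true (0 <= enorm _)) => exact: enorm_ge0 : core.

(** * Differential calculus *)

Section Differential.
Context {R : realType}.
Implicit Types (n q : nat).

Lemma Ck_on21 n (W : normedModType R) (U : set 'rV[R]_n) (f : 'rV[R]_n -> W) :
  Ck_on 2 U f -> Ck_on 1 U f.
Proof.
move=> [fU dfU]; split=> // v x Ux.
by apply: differentiable_continuous; exact: (dfU v).1.
Qed.

Lemma diff_sum_delta n (W : normedModType R) (f : 'rV[R]_n -> W) (x v : 'rV[R]_n) :
  'd f x v = \sum_i v 0 i *: 'd f x (delta_mx 0 i).
Proof.
rewrite {1}[v]row_sum_delta linear_sum.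
by apply: eq_bigr => i _; rewrite linearZ.
Qed.

Lemma diffB_sum_delta n (W : normedModType R) (f : 'rV[R]_n -> W) (x y v : 'rV[R]_n) :
  'd f x v - 'd f y v =
  \sum_i v 0 i *: ('d f x (delta_mx 0 i) - 'd f y (delta_mx 0 i)).
Proof.
under eq_bigr do rewrite scalerBr.
by rewrite sumrB; congr (_ - _); exact: diff_sum_delta.
Qed.

Lemma dotp_gradient n (f : 'rV[R]_n -> R^o) (x v : 'rV[R]_n) : dotp (gradient f x) v = 'd f x v.
Proof. by rewrite diff_sum_delta; apply: eq_bigr => i _; rewrite mxE mulrC. Qed.

Lemma mul_jacobian n q (f : 'rV[R]_n -> 'rV[R]_q) (x v : 'rV[R]_n) : v *m 'J f x = 'd f x v.
Proof. by rewrite /jacobian mul_rV_lin1. Qed.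

Lemma dotp_mulmx_tr n q (A : 'M[R]_(n, q)) w v : dotp (w *m A^T) v = dotp w (v *m A).
Proof.
rewrite /dotp; under eq_bigr do rewrite !mxE mulr_suml.
rewrite exchange_big; apply: eq_bigr => i _; rewrite !mxE mulr_sumr.
by apply: eq_bigr => j _; rewrite !mxE mulrA mulrAC [w 0 i * _ * _]mulrC mulrA mulrAC.
Qed.

Lemma dotp_mulJT n q (f : 'rV[R]_n -> 'rV[R]_q) (x : 'rV[R]_n) (w : 'rV[R]_q) (v : 'rV[R]_n) :
  dotp (w *m ('J f x)^T) v = dotp w ('d f x v).
Proof. by rewrite dotp_mulmx_tr mul_jacobian. Qed.

Lemma norm_sum_coord n (W : normedModType R) (v : 'rV[R]_n) (w : 'I_n -> W) c :
  (forall i, `|w i| <= c) -> `|\sum_i v 0 i *: w i| <= n%:R * c * enorm v.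
Proof.
move=> wc; apply: le_trans (ler_norm_sum _ _ _) _.
have -> : n%:R * c * enorm v = \sum_(i < n) enorm v * c.
  by rewrite sumr_const card_ord -mulr_natl; ring.
apply: ler_sum => i _; rewrite normrZ ler_pM//.
exact: le_trans (norm_coord_le _ _) (norm_le_enorm _).
Qed.

Lemma diff_bounded n (W : normedModType R) (f : 'rV[R]_n -> W) (x : 'rV[R]_n) :
  exists2 K : R, 0 < K & forall v : 'rV[R]_n, `|'d f x v| <= K * enorm v.
Proof.
pose c := \sum_i `|'d f x (delta_mx 0 i)|.
have c0 : 0 <= c by apply: sumr_ge0.
exists (n%:R * c + 1) => [|v]; first by rewrite ltr_wpDl// mulr_ge0.
rewrite diff_sum_delta; apply: le_trans (norm_sum_coord (c := c) _ _) _ => [i|].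
  by rewrite /c (bigD1 i)//= lerDl sumr_ge0.
by rewrite ler_wpM2r// lerDl.
Qed.

(** [Ck_on] gives continuity along each fixed direction only; over the finitely many basis vectors
    it is uniform, hence continuity in operator norm. *)
Lemma diff_continuous_op n (W : normedModType R) (U : set 'rV[R]_n) (f : 'rV[R]_n -> W) (x : 'rV[R]_n) :
  Ck_on 1 U f -> U x -> forall e : R, 0 < e ->
  \forall y \near x, forall v : 'rV[R]_n, `|'d f y v - 'd f x v| <= e * enorm v.
Proof.
move=> [_ dfU] Ux e e0.
have : \forall y \near x, forall i, `|'d f y (delta_mx 0 i) - 'd f x (delta_mx 0 i)| <= e / n.+1%:R.
  apply: (filter_forall (nbhs_filter x)) => i.
  have /continuous_normE := dfU (delta_mx 0 i) x Ux.
  by move=> /(_ (e / n.+1%:R)); rewrite divr_gt0// => /(_ isT); apply: filterS => y /ltW.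
apply: filterS => y yi v.
rewrite diffB_sum_delta.
apply: le_trans (norm_sum_coord _ yi) _.
rewrite ler_wpM2r// mulrC mulrAC ler_pdivrMr// ler_wpM2l ?(ltW e0)//.
by rewrite ler_nat.
Qed.

Lemma diff_coord n q (f : 'rV[R]_n -> 'rV[R]_q) (x : 'rV[R]_n) i : differentiable f x ->
  differentiable (fun y => f y 0 i : R^o) x /\
  forall v : 'rV[R]_n, 'd (fun y => f y 0 i : R^o) x v = 'd f x v 0 i.
Proof.
move=> fx.
have lin : linear (fun N : 'rV[R]_q => N 0 i : R^o).
  by move=> a u v; rewrite !mxE.
pose L := GRing.isLinear.Build _ _ _ _ _ lin.
pose C : {linear 'rV[R]_q -> R^o} := HB.pack (fun N : 'rV[R]_q => N 0 i : R^o) L.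
have cC : continuous C by exact: coord_continuous.
have dC : differentiable C (f x) by exact: linear_differentiable.
split; first exact: (differentiable_comp fx dC).
move=> v; have -> : 'd (fun y => f y 0 i : R^o) x v = 'd C (f x) ('d f x v).
  exact: (congr1 (@^~ v) (diff_comp fx dC)).
by rewrite (diff_lin _ cC).
Qed.

Lemma diff_line n (W : normedModType R) (f : 'rV[R]_n -> W) (b v : 'rV[R]_n) (t : R) :
  differentiable f (b + t *: v) ->
  is_derive t 1 (fun s : R^o => f (b + s *: v)) ('d f (b + t *: v) v).
Proof.
move=> ft.
pose p := fun s : R^o => b + s *: v.
have lt : is_diff (t : R^o) p ( *:%R ^~ v).
  have := is_diffD (is_diff_cst b (t : R^o)) (is_diff_scalel t v).
  by rewrite add0r.
have dp : differentiable p (t : R^o) by exact: ex_diff.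
have fp : differentiable f (p t) by [].
have dfp := differentiable_comp dp fp.
apply: DeriveDef; first exact: diff_derivable.
have -> : (fun s : R^o => f (b + s *: v)) = f \o p by [].
by rewrite deriveE// diff_comp//= diff_val scale1r.
Qed.

(** * Mean value theorems and first-order Taylor estimates *)

Lemma mean_value n (f : 'rV[R]_n -> R^o) (a b : 'rV[R]_n) :
  (forall t : R, 0 <= t <= 1 -> differentiable f (b + t *: (a - b))) ->
  exists2 t : R, 0 <= t <= 1 & f a - f b = 'd f (b + t *: (a - b)) (a - b).
Proof.
move=> df.
have dg (t : R) : 0 <= t <= 1 ->
    is_derive t 1 (fun s : R => f (b + s *: (a - b)) : R) ('d f (b + t *: (a - b)) (a - b)).
  by move=> t01; apply: diff_line; exact: df.
have [t||t t01] := @MVT_segment R (fun t => f (b + t *: (a - b)))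
   (fun t => 'd f (b + t *: (a - b)) (a - b)) 0 1 ler01.
- by rewrite in_itv /= => /andP[t0 t1]; apply: dg; rewrite !ltW.
- apply: continuous_in_subspaceT => s; rewrite inE /= in_itv /= => s01.
  apply: differentiable_continuous; apply/derivable1_diffP.
  by have /@ex_derive := dg _ s01.
rewrite scale1r scale0r addr0 (addrC b) subrK subr0 mulr1 => E.
by exists t => //; move: t01; rewrite in_itv.
Qed.

(** Mean value theorem for the single function [s |-> f (a + s v) - f (b + s v)], so that both
    derivatives are taken at the same [t]. *)
Lemma mean_value_diff n (f : 'rV[R]_n -> R^o) (a b v : 'rV[R]_n) :
  (forall t : R, 0 <= t <= 1 -> differentiable f (a + t *: v) /\ differentiable f (b + t *: v)) ->
  exists2 t : R, 0 <= t <= 1 &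
    f (a + v) - f (b + v) - (f a - f b) = 'd f (a + t *: v) v - 'd f (b + t *: v) v.
Proof.
move=> df; pose g (s : R) : R := f (a + s *: v) - f (b + s *: v).
have dg (t : R) : 0 <= t <= 1 -> is_derive t 1 g ('d f (a + t *: v) v - 'd f (b + t *: v) v).
  by move=> /df[da db]; exact: (is_deriveB (diff_line da) (diff_line db)).
have [t||t t01] := @MVT_segment R g (fun t => 'd f (a + t *: v) v - 'd f (b + t *: v) v) 0 1 ler01.
- by rewrite in_itv /= => /andP[t0 t1]; apply: dg; rewrite !ltW.
- apply: continuous_in_subspaceT => s; rewrite inE /= in_itv /= => s01.
  apply: differentiable_continuous; apply/derivable1_diffP.
  by have /@ex_derive := dg _ s01.
by rewrite /g !scale1r !scale0r !addr0 subr0 mulr1 => E; exists t; rewrite ?in_itv in t01 *.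
Qed.

(* The two target spaces for which the mean value inequality is needed,
   row vectors and scalars, are handled uniformly through this predicate. *)
Definition mean_value_inequality (W : normedModType R) := forall n (f : 'rV[R]_n -> W) (a b : 'rV[R]_n) l c,
  (forall t : R, 0 <= t <= 1 -> differentiable f (b + t *: (a - b)) /\
     `|'d f (b + t *: (a - b)) (a - b) - l| <= c) ->
  `|f a - f b - l| <= c.

Lemma mean_value_ineq_real : mean_value_inequality (R^o : normedModType R).
Proof.
move=> n f a b l c h.
by have [t /h[]//|t /h[_ le_c] ->] := @mean_value n f a b.
Qed.

(** The scalar case on each coordinate, with possibly different intermediate points; the sup norm
    recombines the coordinates without loss. *)
Lemma mean_value_ineq_row q : mean_value_inequality ('rV[R]_q : normedModType R).
Proof.
move=> n f a b l c h.
have c0 : 0 <= c by have [|_] := h 0; [rewrite lexx ler01|exact: le_trans].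
apply: norm_le_coord => // i.
have := @mean_value_ineq_real n (fun y => f y 0 i) a b (l 0 i) c.
rewrite !mxE; apply=> t /h[dft le_c]; have [cf dcf] := diff_coord i dft; split=> //.
rewrite dcf; apply: le_trans le_c; apply: le_trans (norm_coord_le _ i).
by rewrite !mxE.
Qed.

Lemma seg_ball n (x a b : 'rV[R]_n) t e : 0 <= t <= 1 ->
  enorm (a - x) < e -> enorm (b - x) < e -> enorm (b + t *: (a - b) - x) < e.
Proof.
move=> /andP[t0 t1] ax bx.
have -> : b + t *: (a - b) - x = (1 - t) *: (b - x) + t *: (a - x).
  by apply/rowP => i; rewrite !mxE; ring.
apply: le_lt_trans (enormD _ _) _; rewrite !enormZ !ger0_norm ?subr_ge0//.
have [->|tn0] := eqVneq t 0; first by rewrite mul0r subr0 mul1r addr0.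
have : t * enorm (a - x) < t * e by rewrite ltr_pM2l// lt0r tn0.
have : (1 - t) * enorm (b - x) <= (1 - t) * e by rewrite ler_wpM2l ?subr_ge0// ltW.
lra.
Qed.

Lemma seg_dist n (a b : 'rV[R]_n) t : 0 <= t <= 1 ->
  enorm (b + t *: (a - b) - b) <= enorm (a - b).
Proof.
move=> /andP[t0 t1]; rewrite addrAC subrr add0r enormZ ger0_norm//.
by rewrite ler_piMl.
Qed.

Lemma strict_diff n (W : normedModType R) (U : set 'rV[R]_n) (f : 'rV[R]_n -> W) (x : 'rV[R]_n) :
  mean_value_inequality W -> open U -> U x -> Ck_on 1 U f -> forall e : R, 0 < e ->
  exists2 d : R, 0 < d & forall a b : 'rV[R]_n, enorm (a - x) < d -> enorm (b - x) < d ->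
    `|f a - f b - 'd f x (a - b)| <= e * enorm (a - b).
Proof.
move=> mvW oU Ux fC e e0.
have /nearP[d1 d10 h1] := diff_continuous_op fC Ux e0.
have /nearP[d2 d20 h2] : \forall y \near x, U y by exact: open_nbhs_nbhs.
exists (Num.min d1 d2) => [|a b]; first by rewrite lt_min d10.
rewrite !lt_min => /andP[a1 a2] /andP[b1 b2]; apply: mvW => t t01; split.
  by apply: fC.1; apply: h2; exact: seg_ball.
by apply: h1; exact: seg_ball.
Qed.

(** Each derivative along a basis vector is C1, hence strictly differentiable with tolerance 1 and
    so Lipschitz; summing over the basis gives the operator bound. *)
Lemma diff_lipschitz n (W : normedModType R) (U : set 'rV[R]_n) (f : 'rV[R]_n -> W) (x : 'rV[R]_n) :
  mean_value_inequality W -> open U -> U x -> Ck_on 2 U f ->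
  exists L d : R, [/\ 0 < L, 0 < d & forall a b : 'rV[R]_n, enorm (a - x) < d -> enorm (b - x) < d ->
    forall v : 'rV[R]_n, `|'d f a v - 'd f b v| <= L * enorm (a - b) * enorm v].
Proof.
move=> mvW oU Ux [_ dfC].
pose phi i := fun w => 'd f w (delta_mx 0 i).
have h i : exists Kd : R * R, [/\ 0 < Kd.1, 0 < Kd.2 &
    forall a b : 'rV[R]_n, enorm (a - x) < Kd.2 -> enorm (b - x) < Kd.2 ->
    `|phi i a - phi i b| <= Kd.1 * enorm (a - b)].
  have [K K0 hK] := diff_bounded (phi i) x.
  have [d d0 hd] := strict_diff mvW oU Ux (dfC (delta_mx 0 i)) ltr01.
  exists (1 + K, d); split=> //=; first by rewrite addr_gt0.
  move=> a b ax bx; rewrite -(subrK ('d (phi i) x (a - b)) (phi i a - phi i b)).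
  by rewrite (le_trans (ler_normD _ _))// mulrDl lerD// hd.
have [Kd {}h] := choice h.
pose K := \sum_i (Kd i).1.
have Ki i : (Kd i).1 <= K.
  rewrite /K (bigD1 i)//= lerDl sumr_ge0// => j _; have [/ltW//] := h j.
have K0 : 0 <= K by apply: sumr_ge0 => j _; have [/ltW//] := h j.
have /nearP[d d0 hd] : \forall y \near x, forall i, enorm (y - x) < (Kd i).2.
  by apply: (filter_forall (nbhs_filter x)) => i; apply: near_enorm; have [] := h i.
exists (n%:R * K + 1), d; split=> // [|a b ax bx v]; first by rewrite ltr_wpDl// mulr_ge0.
rewrite diffB_sum_delta.
apply: le_trans (norm_sum_coord (c := K * enorm (a - b)) _ _) _ => [i|].
  have [_ _ hi] := h i; apply: le_trans (hi _ _ (hd _ ax i) (hd _ bx i)) _.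
  by rewrite ler_wpM2r.
by rewrite ler_wpM2r// mulrA ler_wpM2r ?lerDl ?ler01.
Qed.

Lemma taylor1 n (W : normedModType R) (f : 'rV[R]_n -> W) (a b : 'rV[R]_n) L :
  mean_value_inequality W -> 0 <= L ->
  (forall t : R, 0 <= t <= 1 -> differentiable f (b + t *: (a - b)) /\
    `|'d f (b + t *: (a - b)) (a - b) - 'd f b (a - b)| <=
      L * enorm (b + t *: (a - b) - b) * enorm (a - b)) ->
  `|f a - f b - 'd f b (a - b)| <= L * enorm (a - b) ^+ 2.
Proof.
move=> mvW L0 h; apply: mvW => t t01; have [? le] := h t t01; split=> //.
by apply: le_trans le _; rewrite expr2 mulrA ler_wpM2r// ler_wpM2l// seg_dist.
Qed.

(** * Symmetry of second derivatives *)

Lemma eq_of_sqr_approx (A B : R) :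
  (forall e : R, 0 < e -> exists s P : R, [/\ 0 < s, `|P - s ^+ 2 * A| <= e * s ^+ 2 &
    `|P - s ^+ 2 * B| <= e * s ^+ 2]) -> A = B.
Proof.
move=> h; apply/eqP; rewrite -subr_eq0 -normr_le0; apply/ler_addgt0Pl => e e0; rewrite addr0.
have [|s [P [s0 h1 h2]]] := h (e / 2); first by rewrite divr_gt0.
have s20 : 0 < s ^+ 2 by rewrite exprn_gt0.
rewrite -(ler_pM2l s20) -{1}(gtr0_norm s20) -normrM.
by move: h1 h2; rewrite !ler_norml => /andP[h1 h2] /andP[h3 h4]; apply/andP; split; lra.
Qed.

(** Schwarz's theorem: the second difference of [f] on the parallelogram spanned by [s u] and [s v]
    is symmetric in [u] and [v], and equals [s^2] times either mixed derivative up to o(s^2). *)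
Lemma second_diff_sym n (U : set 'rV[R]_n) (f : 'rV[R]_n -> R^o) (x u v : 'rV[R]_n) :
  open U -> U x -> Ck_on 2 U f ->
  'd (fun w => 'd f w u) x v = 'd (fun w => 'd f w v) x u.
Proof.
move=> oU Ux fC.
have half (a b : 'rV[R]_n) e : 0 < e -> exists2 d : R, 0 < d & forall s : R, 0 < s < d ->
    `|f (x + s *: a + s *: b) - f (x + s *: a) - f (x + s *: b) + f x
      - s ^+ 2 * 'd (fun w => 'd f w a) x b| <= e * s ^+ 2.
  move=> e0; have [_ dfC] := fC.
  have E0 : 0 < e / (enorm b + 1) by rewrite divr_gt0// ltr_wpDl.
  have [d d0 hd] := strict_diff mean_value_ineq_real oU Ux (dfC a) E0.
  have /nearP[r r0 hr] : \forall y \near x, U y by exact: open_nbhs_nbhs.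
  have N0 : 0 < enorm a + enorm b + 1 by rewrite ltr_wpDl// addr_ge0.
  exists (Num.min d r / (enorm a + enorm b + 1)).
    by rewrite divr_gt0// lt_min d0.
  move=> s /andP[s0]; rewrite ltr_pdivlMr// lt_min => /andP[sd sr].
  (* The corners of the parallelogram and all intermediate points stay in the required ball. *)
  have near_x t k : 0 <= t <= 1 -> 0 <= k <= 1 -> forall c, s * (enorm a + enorm b + 1) < c ->
      enorm (x + t *: (s *: a) + k *: (s *: b) - x) < c.
    move=> /andP[t0 t1] /andP[k0 k1] c; apply: le_lt_trans.
    have -> : x + t *: (s *: a) + k *: (s *: b) - x = t *: (s *: a) + k *: (s *: b).
      by apply/rowP => i; rewrite !mxE; ring.
    apply: le_trans (enormD _ _) _; rewrite !enormZ !(ger0_norm t0, ger0_norm k0, gtr0_norm s0).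
    have : t * (s * enorm a) <= s * enorm a by rewrite ler_piMl// mulr_ge0// ltW.
    have : k * (s * enorm b) <= s * enorm b by rewrite ler_piMl// mulr_ge0// ltW.
    nra.
  have I0 : 0 <= (0 : R) <= 1 by rewrite ?lexx ?ler01.
  have I1 : 0 <= (1 : R) <= 1 by rewrite ?lexx ?ler01.
  have [t t01|t t01 E] := @mean_value_diff n f (x + s *: b) x (s *: a).
    split; apply: fC.1; apply: hr.
      by have := near_x t 1 t01 I1 _ sr; rewrite scale1r (addrAC x (s *: b)).
    by have := near_x t 0 t01 I0 _ sr; rewrite scale0r addr0.
  have -> : f (x + s *: a + s *: b) - f (x + s *: a) - f (x + s *: b) + f x =
      f (x + s *: b + s *: a) - f (x + s *: a) - (f (x + s *: b) - f x).
    by rewrite (addrAC x); ring.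
  rewrite E (addrAC x).
  set y := x + t *: (s *: a).
  have yd : enorm (y - x) < d by have := near_x t 0 t01 I0 _ sd; rewrite scale0r addr0.
  have ybd : enorm (y + s *: b - x) < d by have := near_x t 1 t01 I1 _ sd; rewrite scale1r.
  pose psi := fun w => 'd f w a; pose D : R := 'd psi x b.
  pose A1 : R := 'd f (y + s *: b) a; pose A2 : R := 'd f y a.
  have H : `|A1 - A2 - s * D| <= e / (enorm b + 1) * (s * enorm b).
    have e1 : y + s *: b - y = s *: b by rewrite addrAC subrr add0r.
    have e2 : s * D = 'd psi x (y + s *: b - y) by rewrite e1; exact: (esym (linearZ _ _)).
    have e3 : s * enorm b = enorm (y + s *: b - y) by rewrite e1 enormZ gtr0_norm.
    by rewrite e2 e3; exact: hd.
  have al (a1 a2 d' : R) : s * a1 - s * a2 - s ^+ 2 * d' = s * (a1 - a2 - s * d') by ring.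
  have -> : 'd f (y + s *: b) (s *: a) - 'd f y (s *: a) - s ^+ 2 * 'd (fun w => 'd f w a) x b =
      s * (A1 - A2 - s * D).
    apply: etrans _ (al _ _ _); congr (_ - _ - _); exact: linearZ.
  rewrite normrM gtr0_norm// expr2 mulrCA ler_pM2l//.
  apply: le_trans H _; rewrite mulrAC ler_pdivrMr ?ltr_wpDl//.
  by rewrite -!mulrA ler_pM2l// ler_pM2l// lerDl.
apply: eq_of_sqr_approx => e e0.
have [d1 d10 h1] := half u v _ e0; have [d2 d20 h2] := half v u _ e0.
have m0 : 0 < Num.min d1 d2 by rewrite lt_min d10.
pose s := Num.min d1 d2 / 2.
have s0 : 0 < s by rewrite divr_gt0.
have /andP[s1 s2] : (s < d1) && (s < d2) by rewrite -lt_min /s; lra.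
exists s, (f (x + s *: u + s *: v) - f (x + s *: u) - f (x + s *: v) + f x); split=> //.
  by apply: h1; rewrite s0.
have := h2 s; rewrite s0 s2 => /(_ isT).
by rewrite (addrAC x) (addrAC (f (x + s *: u + s *: v))).
Qed.

End Differential.

(** * Manifolds given by equations *)

Section Charts.
Context {R : realType}.
Implicit Types (n q : nat).

Lemma mulmx_bounded n q (A : 'M[R]_(n, q)) :
  exists2 K : R, 0 < K & forall v : 'rV[R]_n, enorm (v *m A) <= K * enorm v.
Proof.
pose c := \sum_i `|row i A|; have c0 : 0 <= c by apply: sumr_ge0.
exists (q%:R * (n%:R * c) + 1) => [|v]; first by rewrite ltr_wpDl// !mulr_ge0.
apply: le_trans (enorm_le_norm _) _.
apply: (@le_trans _ _ (q%:R * (n%:R * c * enorm v))).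
  rewrite ler_wpM2l// mulmx_sum_row; apply: norm_sum_coord => i.
  by rewrite /c (bigD1 i)//= lerDl sumr_ge0.
by rewrite mulrA ler_wpM2r// lerDl.
Qed.

(** A left inverse [B] of [A] makes [C = B *m A'] differ from the identity by at most 1/2, hence
    invertible; [w *m invmx C *m B] then solves the equation, with a constant independent of
    [A']. *)
Lemma stable_right_inverse n q (A : 'M[R]_(n, q)) : row_full A ->
  exists K e : R, [/\ 0 < K, 0 < e & forall A' : 'M[R]_(n, q),
    (forall v : 'rV[R]_n, enorm (v *m A' - v *m A) <= e * enorm v) ->
    forall w : 'rV[R]_q, exists2 u : 'rV[R]_n, u *m A' = w & enorm u <= K * enorm w].
Proof.
move=> /row_fullP[B BA]; have [K K0 hK] := mulmx_bounded B.
exists (2 * K), (2 * K)^-1; split; rewrite ?invr_gt0 ?mulr_gt0// => A' hA' w.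
pose C := B *m A'.
have hC (x : 'rV_q) : enorm (x *m C - x) <= 2^-1 * enorm x.
  have -> : x *m C - x = x *m B *m A' - x *m B *m A by rewrite /C !mulmxA -[x *m B *m A]mulmxA BA mulmx1.
  apply: le_trans (hA' _) _; apply: le_trans (ler_wpM2l _ (hK x)) _.
    by rewrite invr_ge0 mulr_ge0// ltW.
  by have -> : (2 * K)^-1 * (K * enorm x) = 2^-1 * enorm x by field; rewrite gt_eqF.
have lC (x : 'rV_q) : enorm x <= 2 * enorm (x *m C).
  have := hC x; have := enorm_lb x (x *m C); rewrite enormBC => h1 h2.
  by have := le_trans h1 h2; lra.
have uC : C \in unitmx.
  rewrite -row_free_unit -kermx_eq0; apply/eqP/row_matrixP => i; rewrite row0.
  apply: enorm_eq0; apply/eqP; rewrite eq_le enorm_ge0 andbT.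
  by have := lC (row i (kermx C)); rewrite -row_mul mulmx_ker row0 enorm0 mulr0.
exists (w *m invmx C *m B); first by rewrite -mulmxA -/C mulmxKV.
apply: le_trans (hK _) _; rewrite [leRHS]mulrAC [leRHS]mulrC ler_wpM2l ?(ltW K0)//.
by have := lC (w *m invmx C); rewrite mulmxKV.
Qed.

(** The geometry of a zero set at [z] needs only this condition at [z] itself; the matrix is a
    parameter so that Jacobians need not be carried along. *)
Definition strictly_differentiable n q (h : 'rV[R]_n -> 'rV[R]_q) (z : 'rV[R]_n)
    (A : 'M[R]_(n, q)) :=
  forall e : R, 0 < e -> exists2 d : R, 0 < d & forall a b : 'rV[R]_n,
    enorm (a - z) < d -> enorm (b - z) < d ->
    enorm (h a - h b - (a - b) *m A) <= e * enorm (a - b).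

Lemma strictly_differentiable_J n q (h : 'rV[R]_n -> 'rV[R]_q) (z : 'rV[R]_n) :
  Ck_near 2 z h -> strictly_differentiable h z ('J h z).
Proof.
move=> [U [oU Uz hC]] e e0.
have E0 : 0 < e / q.+1%:R by rewrite divr_gt0.
have [d d0 hd] := strict_diff (@mean_value_ineq_row _ q) oU Uz (Ck_on21 hC) E0.
exists d => // a b az bz; rewrite mul_jacobian.
apply: le_trans (enorm_le_norm _) _.
apply: le_trans (ler_wpM2l _ (hd a b az bz)) _ => //.
rewrite mulrA ler_wpM2r// mulrCA ler_piMr ?(ltW e0)// ler_pdivrMr// mul1r.
by rewrite ler_nat.
Qed.

Lemma near_jacobian n q (h : 'rV[R]_n -> 'rV[R]_q) (z : 'rV[R]_n) : Ck_near 2 z h ->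
  forall e : R, 0 < e -> \forall y \near z, forall v : 'rV[R]_n,
    enorm (v *m 'J h y - v *m 'J h z) <= e * enorm v.
Proof.
move=> [U [oU Uz hC]] e e0.
have E0 : 0 < e / q.+1%:R by rewrite divr_gt0.
apply: filterS (diff_continuous_op (Ck_on21 hC) Uz E0) => y hy v.
have -> : v *m 'J h y - v *m 'J h z = 'd h y v - 'd h z v.
  by congr (_ - _); exact: mul_jacobian.
apply: le_trans (enorm_le_norm _) _.
apply: le_trans (ler_wpM2l _ (hy v)) _ => //.
rewrite mulrA ler_wpM2r// mulrCA ler_piMr ?(ltW e0)// ler_pdivrMr// mul1r.
by rewrite ler_nat.
Qed.

Lemma strictly_differentiable_lip n q (h : 'rV[R]_n -> 'rV[R]_q) z A :
  strictly_differentiable h z A -> exists L d : R, [/\ 0 < L, 0 < d &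
    forall a b : 'rV[R]_n, enorm (a - z) < d -> enorm (b - z) < d ->
      enorm (h a - h b) <= L * enorm (a - b)].
Proof.
move=> /(_ 1 ltr01)[d d0 hd]; have [K K0 hK] := mulmx_bounded A.
exists (1 + K), d; split=> // [|a b az bz]; first by rewrite addr_gt0.
rewrite -(subrK ((a - b) *m A) (h a - h b)); apply: le_trans (enormD _ _) _.
by rewrite mulrDl lerD// hd.
Qed.

(* The nearest zero is found by minimizing [|h u| + a |u - y|]: at a minimizer
   with [h u != 0] a Newton step would decrease this function. *)
Lemma error_bound n q (h : 'rV[R]_n -> 'rV[R]_q) z A :
  strictly_differentiable h z A -> row_full A -> h z = 0 ->
  exists2 K : R, 0 < K & \forall y \near z, exists x : 'rV[R]_n, [/\ h x = 0,
    enorm (x - y) <= K * enorm (h y) & enorm (x - z) <= K * enorm (y - z)].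
Proof.
move=> sd rA hz; have [L [d1 [L0 d10 hL]]] := strictly_differentiable_lip sd.
have [K [e1 [K0 e10 hK]]] := stable_right_inverse rA.
have {}hK w : exists2 u, u *m A = w & enorm u <= K * enorm w.
  by apply: hK => v; rewrite subrr enorm0 mulr_ge0// ltW.
(* With this weight a Newton step [s] raises the distance term by at most [a |s| <= |h u| / 4] and
   leaves a residual of at most the same size, so the objective drops unless [h u = 0]. *)
pose a := (4 * K)^-1; have a0 : 0 < a by rewrite invr_gt0 mulr_gt0.
have aK : a * K = 4^-1 by rewrite /a; field; rewrite gt_eqF.
have [d2 d20 hd2] := sd a a0.
pose r : R := Num.min d1 d2 / 2.
have m0 : 0 < Num.min d1 d2 by rewrite lt_min d10.
have r0 : 0 < r by rewrite divr_gt0.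
have /andP[rd1 rd2] : (r < d1) && (r < d2) by rewrite -lt_min /r; lra.
(* [Q |y - z|] bounds the distance from the minimizer to [z] plus the length of a Newton step;
   starting within [r / Q] keeps the trial point in the ball of radius [r]. *)
pose Q := a^-1 * L + 1 + K * L.
have ia0 : 0 < a^-1 by rewrite invr_gt0.
have aL0 : 0 <= a^-1 * L by rewrite mulr_ge0// ltW.
have KL0 : 0 <= K * L by rewrite mulr_ge0// ltW.
have Q1 : 1 <= Q by rewrite /Q; lra.
have Q0 : 0 < Q by apply: lt_le_trans Q1.
have rQ : r / Q <= r by rewrite ler_pdivrMr// ler_peMr// ltW.
exists (Num.max a^-1 Q) => [|]; first by rewrite lt_max invr_gt0 a0.
apply/nearE; exists (r / Q) => [|/= y yz]; first by rewrite divr_gt0.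
have yr : enorm (y - z) < r by apply: lt_le_trans rQ.
have zd (t : R) : 0 < t -> enorm (z - z) < t by rewrite subrr enorm0.
have hy : enorm (h y) <= L * enorm (y - z).
  by have := hL y z (lt_trans yr rd1) (zd _ d10); rewrite hz subr0.
pose S := [set u : 'rV[R]_n | enorm (u - z) <= r].
pose f u := enorm (h u) + a * enorm (u - y).
have [||u uS umin] := @EVT_min_rV R n f S _ (@compact_ball R n z r).
- by exists z; rewrite /S /= subrr enorm0 ltW.
- apply: continuous_in_subspaceT => u /[!inE] uS.
  have ud1 : enorm (u - z) < d1 by apply: le_lt_trans uS rd1.
  apply/(@continuous_normE _ n R^o f) => e e0.
  have LA : 0 < L + a by rewrite addr_gt0.
  apply/nearE; exists (Num.min (d1 - enorm (u - z)) (e / (L + a))) => [|x].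
    by rewrite lt_min subr_gt0 ud1 divr_gt0.
  rewrite lt_min ltr_pdivlMr// => /andP[xu1 xu2].
  have xd1 : enorm (x - z) < d1 by apply: le_lt_trans (enorm_dist u _ _) _; lra.
  apply: le_lt_trans xu2.
  have h1 := hL x u xd1 ud1; have h2 := hL u x ud1 xd1.
  have := enorm_lb (h x) (h u); have := enorm_lb (h u) (h x).
  have := enorm_dist u x y; have := enorm_dist x u y.
  rewrite (enormBC u x) in h2 *; rewrite ler_norml /f; nra.
have uz : enorm (u - z) <= r by move: uS; rewrite inE.
have Smem x : enorm (x - z) <= r -> x \in S by rewrite inE.
have fuy : f u <= enorm (h y).
  by apply: le_trans (umin y (Smem _ (ltW yr))) _; rewrite /f subrr enorm0 mulr0 addr0.
have hu : enorm (h u) <= L * enorm (y - z).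
  by apply: le_trans hy; apply: le_trans fuy; rewrite /f lerDl mulr_ge0// ltW.
have uy : enorm (u - y) <= a^-1 * enorm (h y).
  by rewrite ler_pdivlMl//; apply: le_trans fuy; rewrite /f lerDr.
have uzQ : enorm (u - z) + K * enorm (h u) <= Q * enorm (y - z).
  have := enorm_dist y u z.
  have : a^-1 * enorm (h y) <= a^-1 * (L * enorm (y - z)) by rewrite ler_wpM2l// invr_ge0 ltW.
  have : K * enorm (h u) <= K * (L * enorm (y - z)) by rewrite ler_wpM2l// ltW.
  rewrite /Q; nra.
have [s sA sK] := hK (h u).
have vz : enorm (u - s - z) < r.
  rewrite addrAC; apply: le_lt_trans (enormB _ _) _.
  apply: (@le_lt_trans _ _ (Q * enorm (y - z))); last by rewrite mulrC -ltr_pdivlMr.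
  by apply: le_trans uzQ; rewrite lerD2l.
have hv : enorm (h (u - s)) <= a * enorm s.
  have := hd2 (u - s) u (lt_trans vz rd2) (le_lt_trans uz rd2).
  have -> : u - s - u = - s by rewrite addrAC subrr add0r.
  by rewrite mulNmx sA opprK subrK enormN.
have hu0 : h u = 0.
  apply: enorm_eq0; apply/eqP; rewrite eq_le enorm_ge0 andbT.
  have := umin (u - s) (Smem _ (ltW vz)); rewrite /f.
  have := enormB (u - y) s; rewrite [u - y - s]addrAC => h1 h2.
  have : a * enorm s <= 4^-1 * enorm (h u).
    by rewrite -aK -mulrA ler_wpM2l// ltW.
  have : a * enorm (u - s - y) <= a * (enorm (u - y) + enorm s) by rewrite ler_wpM2l// ltW.
  by lra.
exists u; split=> //.
  by apply: le_trans uy _; rewrite ler_wpM2r// le_max lexx.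
apply: (@le_trans _ _ (Q * enorm (y - z))); last by rewrite ler_wpM2r// le_max lexx orbT.
by apply: le_trans uzQ; rewrite lerDl mulr_ge0// ltW.
Qed.

Definition chart n q (M : set 'rV[R]_n) (z : 'rV[R]_n) (h : 'rV[R]_n -> 'rV[R]_q)
    (A : 'M[R]_(n, q)) :=
  [/\ M z, strictly_differentiable h z A, row_full A & \forall y \near z, M y <-> h y = 0].

Lemma defining_map_chart n q (M : set 'rV[R]_n) z (h : 'rV[R]_n -> 'rV[R]_q) :
  defining_map M z h -> chart M z h ('J h z).
Proof. by case=> Mz hC hr Mh; split=> //; exact: strictly_differentiable_J. Qed.

(** * Local geometry of a manifold at a point, from one chart *)

Section Chart.
Context {n q : nat} {M : set 'rV[R]_n} {z : 'rV[R]_n} {h : 'rV[R]_n -> 'rV[R]_q}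
  {A : 'M[R]_(n, q)}.
Hypothesis hM : chart M z h A.

Lemma chart0 : h z = 0.
Proof. by case: hM => Mz _ _ /nbhs_singleton[/(_ Mz)]. Qed.

Lemma chart_error_bound : exists2 K : R, 0 < K & \forall y \near z, exists2 x : 'rV[R]_n, M x &
    enorm (x - y) <= K * enorm (h y).
Proof.
case: (hM) => Mz sd rA Mh; have [K K0 hK] := error_bound sd rA chart0.
exists K => //; have /nearP[e e0 he] := Mh; have /nearP[d d0 hd] := hK.
apply/nearE; exists (Num.min d (e / K)) => [|y]; first by rewrite lt_min d0 divr_gt0.
rewrite lt_min ltr_pdivlMr// => /andP[/hd[x [hx xy xz]] ye].
exists x => //; apply/he => //.
by apply: le_lt_trans xz _; rewrite mulrC.
Qed.

(** For [tau] in the kernel, [h (z + s tau)] is o(s), and the error bound turns this residual into a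
    distance to [M]. No regularity of [x] in [s] is claimed: approximate points suffice. *)
Lemma tangent_curve (tau : 'rV[R]_n) : tau *m A = 0 -> forall e : R, 0 < e ->
  exists2 d : R, 0 < d & forall s : R, 0 < s < d -> exists2 x : 'rV[R]_n, M x & enorm (x - (z + s *: tau)) <= e * s.
Proof.
move=> tA e e0; have [K K0 /nearP[d1 d10 hd1]] := chart_error_bound.
case: (hM) => _ sd _ _; have T0 : 0 < enorm tau + 1 by rewrite ltr_wpDl.
have E0 : 0 < e / K / (enorm tau + 1) by rewrite !divr_gt0.
have [d2 d20 hd2] := sd _ E0.
have m0 : 0 < Num.min d1 d2 by rewrite lt_min d10.
exists (Num.min d1 d2 / (enorm tau + 1)); first by rewrite divr_gt0.
move=> s /andP[s0]; rewrite ltr_pdivlMr// lt_min => /andP[sd1 sd2].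
have zs : enorm (z + s *: tau - z) = s * enorm tau by rewrite addrAC subrr add0r enormZ gtr0_norm.
have st : s * enorm tau <= s * (enorm tau + 1) by rewrite ler_pM2l// lerDl.
have [|x Mx xs] := hd1 (z + s *: tau); first by rewrite zs; apply: le_lt_trans sd1.
exists x => //; apply: le_trans xs _.
have := hd2 (z + s *: tau) z; rewrite zs subrr enorm0 => /(_ (le_lt_trans st sd2) d20).
have -> : z + s *: tau - z = s *: tau by rewrite addrAC subrr add0r.
rewrite chart0 subr0 -scalemxAl tA scaler0 subr0 => H.
apply: le_trans (ler_wpM2l (ltW K0) H) _.
have -> : K * (e / K / (enorm tau + 1) * (s * enorm tau)) = e * (s * (enorm tau / (enorm tau + 1))).
  by field; rewrite !gt_eqF.
rewrite ler_pM2l// ler_piMr ?(ltW s0)// ler_pdivrMr// mul1r lerDl//.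
Qed.

(** [p] is a nearest zero of [h]. Testing its optimality against points of [M] close to [p + r tau],
    with [tau] tangent at [z] rather than at [p], costs the tolerance [e]. *)
Lemma nearest_normal (e : R) : 0 < e -> \forall y \near z, exists p : 'rV[R]_n, [/\ M p,
    enorm (y - p) <= enorm (y - z) &
    forall tau : 'rV[R]_n, tau *m A = 0 -> dotp (y - p) tau <= e * enorm tau * enorm (y - p)].
Proof.
move=> e0; case: (hM) => Mz sd rA Mh.
have [K K0 /nearP[d1 d10 hd1]] := chart_error_bound.
have [L [d2 [L0 d20 hL]]] := strictly_differentiable_lip sd.
have E0 : 0 < e / K by rewrite divr_gt0.
have [d3 d30 hd3] := sd _ E0.
have /nearP[d4 d40 hd4] := Mh.
have [d [d0 dd1 dd2 dd3 dd4]] : exists d, [/\ 0 < d, d < d1, d < d2, d < d3 & d < d4].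
  pose d := Num.min (Num.min d1 d2) (Num.min d3 d4).
  have d0 : 0 < d by rewrite !lt_min d10 d20 d30.
  have : d / 2 < d by lra.
  by rewrite !lt_min => /andP[/andP[? ?] /andP[? ?]]; exists (d / 2); rewrite divr_gt0.
(* Zeros of [h] in a ball stand for [M]: they form a compact set, because [h] is Lipschitz there. *)
pose S := [set u : 'rV[R]_n | enorm (u - z) <= d /\ h u = 0].
have zS : S z by split; [rewrite subrr enorm0 ltW|exact: chart0].
have cS : compact S.
  apply: subclosed_compact (@compact_ball R n z d) _; last by move=> u [].
  move=> u cu.
  have uz : enorm (u - z) <= d.
    apply/ler_addgt0Pl => t t0; have [v [[vz _] /= vu]] := cu _ (near_enorm u t0).
    by apply: le_trans (enorm_dist v _ _) _; rewrite lerD// ltW// enormBC.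
  split=> //; apply: enorm_eq0; apply/eqP; rewrite eq_le enorm_ge0 andbT.
  apply/ler_addgt0Pl => t t0; rewrite addr0.
  have tL : 0 < t / L by rewrite divr_gt0.
  have [v [[vz hv] /= vu]] := cu _ (near_enorm u tL).
  have := hL u v (le_lt_trans uz dd2) (le_lt_trans vz dd2); rewrite hv subr0 => H; apply: le_trans H _.
  by rewrite mulrC -ler_pdivlMr// enormBC ltW.
apply/nearE; exists (d / 2) => [|y yz]; first by rewrite divr_gt0.
have [||p pS pmin] := @EVT_min_rV R n (fun u => enorm (u - y)) S _ cS.
- by exists z.
- apply: continuous_subspaceT => u; apply: continuous_comp; last exact: enorm_continuous.
  by apply: continuousB; [exact: cvg_id|exact: cst_continuous].
have {pS}[pz hp] : S p by move: pS; rewrite inE.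
have {}pmin u : enorm (u - z) <= d -> h u = 0 -> enorm (y - p) <= enorm (y - u).
  by move=> uz hu; rewrite !(enormBC y) pmin// inE; split.
have Mp : M p by apply/(hd4 p (le_lt_trans pz dd4)).
have yp : enorm (y - p) <= enorm (y - z) by apply: pmin; [case: zS|exact: chart0].
have {}pz : enorm (p - z) < d.
  by apply: le_lt_trans (enorm_dist y _ _) _; rewrite enormBC; lra.
exists p; split=> // tau tA.
have [->|t0] := eqVneq tau 0; first by rewrite dotp0 enorm0 mulr0 mul0r.
have T0 := enorm_gt0 t0; set D := enorm (y - p); set T := enorm tau.
have D1 : 0 <= D by exact: enorm_ge0.
have T1 : 0 <= T by exact: enorm_ge0.
have eT : 0 <= e * T by rewrite mulr_ge0// ltW.
pose Q := T + e * T.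
apply/ler_addgt0Pl => w w0.
(* [r] keeps the trial point in the ball and makes the quadratic term [r * Q ^+ 2] at most the
   arbitrary slack [w]. *)
pose r : R := Num.min ((d - enorm (p - z)) / (Q + 1)) (w / (Q ^+ 2 + 1)) / 2.
have Qge0 : 0 <= Q by rewrite /Q addr_ge0.
have Q10 : 0 < Q + 1 by rewrite ltr_wpDl.
have Q20 : 0 < Q ^+ 2 + 1 by rewrite ltr_wpDl// sqr_ge0.
have m0 : 0 < Num.min ((d - enorm (p - z)) / (Q + 1)) (w / (Q ^+ 2 + 1)).
  by rewrite lt_min !divr_gt0// subr_gt0.
have r0 : 0 < r by rewrite divr_gt0.
have /andP[] : (r < (d - enorm (p - z)) / (Q + 1)) && (r < w / (Q ^+ 2 + 1)).
  by rewrite -lt_min /r; lra.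
rewrite !ltr_pdivlMr// => rQ rw.
have rT : enorm (p + r *: tau - p) = r * T by rewrite addrAC subrr add0r enormZ gtr0_norm.
have ptz : enorm (p + r *: tau - z) < d.
  apply: le_lt_trans (enorm_dist p _ _) _; rewrite rT.
  by have : r * T <= r * (Q + 1) by [rewrite ler_pM2l// /Q; lra]; lra.
have [x Mx xp] := hd1 _ (lt_trans ptz dd1).
have hpt : enorm (h (p + r *: tau)) <= e / K * (r * T).
  have := hd3 _ p (lt_trans ptz dd3) (lt_trans pz dd3).
  have -> : p + r *: tau - p = r *: tau by rewrite addrAC subrr add0r.
  by rewrite hp subr0 -scalemxAl tA scaler0 subr0 enormZ gtr0_norm.
have {}xp : enorm (x - (p + r *: tau)) <= e * (r * T).
  apply: le_trans xp _; apply: le_trans (ler_wpM2l (ltW K0) hpt) _.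
  by have -> : K * (e / K * (r * T)) = e * (r * T) by field; rewrite gt_eqF.
have xpQ : enorm (x - p) <= r * Q.
  apply: le_trans (enorm_dist (p + r *: tau) _ _) _; rewrite rT /Q; lra.
have xz : enorm (x - z) < d.
  by apply: le_lt_trans (enorm_dist p _ _) _; lra.
have hx : h x = 0 by apply/(hd4 x (lt_trans xz dd4)).
have := pmin x (ltW xz) hx.
rewrite -ler_sqr ?nnegrE//.
have -> : y - x = (y - p) - (x - p) by rewrite opprB addrA subrK.
rewrite /D in D1 *; move: xpQ D1; set a := y - p; set b := x - p => xpQ D1.
rewrite (sqr_enormB a b) => H.
have Hx : enorm b ^+ 2 <= (r * Q) ^+ 2 by rewrite ler_sqr ?nnegrE// mulr_ge0// ltW.
have : dotp a (p + r *: tau - x) <= enorm a * (e * (r * T)).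
  by apply: le_trans (dotp_le _ _) _; rewrite ler_wpM2l// enormBC.
have -> : p + r *: tau - x = r *: tau - b by rewrite /b opprB addrCA addrA.
rewrite dotpBr dotpZr => H2.
have rQw : r * Q ^+ 2 <= w by nra.
rewrite -(ler_pM2l r0).
have : (r * Q) ^+ 2 <= r * w by rewrite exprMn expr2 -mulrA ler_pM2l.
have : 0 <= (r * Q) ^+ 2 by rewrite sqr_ge0.
lra.
Qed.

(** Points of [M] at distance o(s) from [z + s tau], built with the first chart, are zeros of the
    second map, whose derivative must then kill [tau]. *)
Lemma chart_tangent q' (h' : 'rV[R]_n -> 'rV[R]_q') A' : chart M z h' A' ->
  forall tau : 'rV[R]_n, tau *m A = 0 -> tau *m A' = 0.
Proof.
move=> hM' tau tA; case: (hM') => Mz sd' _ Mh'.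
have h'z : h' z = 0 by move: (nbhs_singleton Mh') => [/(_ Mz)].
apply: enorm_eq0; apply/eqP; rewrite eq_le enorm_ge0 andbT.
apply/ler_addgt0Pl => e e0; rewrite addr0.
have [K K0 hK] := mulmx_bounded A'.
pose b := e / (enorm tau + 1 + K).
have D0 : 0 < enorm tau + 1 + K by rewrite addr_gt0// ltr_wpDl.
have b0 : 0 < b by rewrite divr_gt0.
have [d1 d10 hd1] := sd' _ b0; have /nearP[d2 d20 hd2] := Mh'.
have c0 : 0 < Num.min b 1 by rewrite lt_min b0 ltr01.
have [d3 d30 hd3] := tangent_curve tA c0.
have T0 : 0 < enorm tau + 1 by rewrite ltr_wpDl.
pose m := Num.min (Num.min d1 d2 / (enorm tau + 1)) d3.
have m0 : 0 < m by rewrite !lt_min d30 divr_gt0// lt_min d10.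
pose s := m / 2; have s0 : 0 < s by rewrite divr_gt0.
have : s < m by rewrite /s; lra.
rewrite lt_min ltr_pdivlMr// lt_min => /andP[/andP[sd1 sd2] sd3].
have [|x Mx xs] := hd3 s; first by rewrite s0.
have xs1 : enorm (x - (z + s *: tau)) <= s.
  by apply: le_trans xs _; rewrite ler_piMl ?(ltW s0)// ge_min lexx orbT.
have {}xs : enorm (x - (z + s *: tau)) <= b * s.
  by apply: le_trans xs _; rewrite ler_wpM2r ?(ltW s0)// ge_min lexx.
have xz : enorm (x - z) <= s * (enorm tau + 1).
  apply: le_trans (enorm_dist (z + s *: tau) _ _) _.
  by rewrite [z + _ - z]addrAC subrr add0r enormZ gtr0_norm//; lra.
have h'x : h' x = 0 by apply/(hd2 x (le_lt_trans xz sd2)).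
have := hd1 x z (le_lt_trans xz sd1); rewrite subrr enorm0 h'x h'z subrr sub0r enormN => /(_ d10) H.
rewrite -(ler_pM2l s0).
have -> : s * enorm (tau *m A') = enorm ((x - z) *m A' - (x - (z + s *: tau)) *m A').
  have -> : x - z = (x - (z + s *: tau)) + s *: tau by rewrite opprD addrA subrK.
  rewrite mulmxDl addrAC subrr add0r.
  by rewrite -scalemxAl enormZ gtr0_norm.
apply: le_trans (enormB _ _) _.
have h1 := le_trans H (ler_wpM2l (ltW b0) xz).
have h2 := le_trans (hK _) (ler_wpM2l (ltW K0) xs).
have : b * (enorm tau + 1 + K) = e by rewrite /b divfK// gt_eqF.
nra.
Qed.

End Chart.

(* [cokermx A^T] has columns orthogonal to the rows of [A^T]. *)
Lemma orth_ker_image n q (A : 'M[R]_(n, q)) (v : 'rV[R]_n) :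
  (forall tau : 'rV[R]_n, tau *m A = 0 -> dotp v tau = 0) -> exists w, v = w *m A^T.
Proof.
move=> vA; apply/submxP; rewrite submxE; apply/eqP/rowP => j.
have H : dotp v (row j (cokermx A^T)^T) = 0.
  by apply: vA; rewrite -row_mul -{2}[A]trmxK -trmx_mul mulmx_coker trmx0 row0.
rewrite [RHS]mxE -H mxE /dotp.
by apply: eq_bigr => i _; rewrite !mxE.
Qed.

(** Removes the existential over defining maps: any one of them computes the normal space, as the
    orthogonal of its kernel. *)
Lemma normal_spaceE n q (M : set 'rV[R]_n) z (h : 'rV[R]_n -> 'rV[R]_q) :
  defining_map M z h -> forall v, Defs.normal_space M z v <->
    (forall tau : 'rV[R]_n, tau *m 'J h z = 0 -> dotp v tau = 0).
Proof.
move=> hM v; split=> [[q' [h' [hM' [w ->]]]] tau tA|/orth_ker_image[w ->]]; last first.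
  by exists q, h; split=> //; exists w.
rewrite dotp_mulmx_tr.
by rewrite (chart_tangent (defining_map_chart hM) (defining_map_chart hM') tA) dotp0.
Qed.

Lemma surjective_row_full n q (A : 'M[R]_(n, q)) :
  (forall w, exists u : 'rV[R]_n, u *m A = w) -> row_full A.
Proof.
move=> /choice[f hf]; apply/row_fullP; exists (\matrix_i f (row i 1%:M)).
by apply/row_matrixP => i; rewrite row_mul rowK hf.
Qed.

Lemma near_row_full n q (h : 'rV[R]_n -> 'rV[R]_q) (z : 'rV[R]_n) : Ck_near 2 z h ->
  row_full ('J h z) -> exists2 K : R, 0 < K & \forall y \near z,
  forall w, exists2 u, u *m 'J h y = w & enorm u <= K * enorm w.
Proof.
move=> hC /stable_right_inverse[K [e [K0 e0 hK]]]; exists K => //.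
by apply: filterS (near_jacobian hC e0) => y; exact: hK.
Qed.

Lemma Ck_near_near n (W : normedModType R) k (f : 'rV[R]_n -> W) (z : 'rV[R]_n) :
  Ck_near k z f -> \forall y \near z, Ck_near k y f.
Proof.
move=> [U [oU Uz fC]]; have : \forall y \near z, U y by exact: open_nbhs_nbhs.
by apply: filterS => y Uy; exists U.
Qed.

Lemma defining_map_near n q (M : set 'rV[R]_n) z (h : 'rV[R]_n -> 'rV[R]_q) :
  defining_map M z h -> \forall y \near z, M y -> defining_map M y h.
Proof.
move=> [Mz hC hr Mh]; have [K K0 hK] := near_row_full hC hr.
have /nearP[d1 d10 hd1] := Ck_near_near hC.
have /nearP[d2 d20 hd2] := hK; have /nearP[d3 d30 hd3] := near_near Mh.
apply/nearE; exists (Num.min (Num.min d1 d2) d3) => [|y]; first by rewrite !lt_min d10 d20.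
rewrite !lt_min => /andP[/andP[/hd1 yC /hd2 yr] /hd3 Mhy] My.
have yf : row_full ('J h y).
  by apply: surjective_row_full => w; have [u uE _] := yr w; exists u.
exact: And4 My yC yf Mhy.
Qed.

End Charts.

(** * Identification of the manifold *)

Section Subdifferential.
Context {R : realType} {m : nat}.
Implicit Types (g : 'rV[R]_m -> \bar R) (M : set 'rV[R]_m) (y v w : 'rV[R]_m).

Lemma inv_small (d : R) : 0 < d -> exists N, forall k, (N <= k)%N -> k.+1%:R^-1 < d.
Proof.
move=> d0; have [N _ hN] := near_infty_natSinv_lt (PosNum d0).
by exists N => k Nk; exact: hN.
Qed.

Lemma unit_cluster_point (u : nat -> 'rV[R]_m) : (forall k, enorm (u k) = 1) ->
  exists2 l, enorm l = 1 &
    forall (e : R) N, 0 < e -> exists2 k, (N <= k)%N & enorm (u k - l) < e.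
Proof.
move=> u1; have [k|l hl] := @cluster_point R m u 1; first by rewrite u1.
exists l => //; apply/eqP; rewrite eq_le; apply/andP; split; apply/ler_addgt0Pl => e e0.
  have [k _ kl] := hl e 0%N e0; have := enorm_lb l (u k).
  by rewrite u1 enormBC; lra.
have [k _ kl] := hl e 0%N e0; have := enorm_lb (u k) l.
by rewrite u1; lra.
Qed.

Lemma unit_dotp (u l : 'rV[R]_m) : enorm l = 1 -> 1 - enorm (u - l) <= dotp u l.
Proof.
move=> l1; have := norm_dotp (u - l) l; rewrite l1 mulr1 dotpBl -sqr_enorm l1 expr1n.
by rewrite ler_norml => /andP[+ _]; lra.
Qed.

Lemma normalize_enorm (a : 'rV[R]_m) : a != 0 -> enorm ((enorm a)^-1 *: a) = 1.
Proof.
move=> /enorm_gt0 a0; rewrite enormZ gtr0_norm ?invr_gt0// mulVf// gt_eqF//.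
Qed.

(** Projection on a closed convex set: minimizing over a ball that meets [C] gives [z], and moving
    from [z] slightly towards [x] gives the variational inequality. Closedness is stated in the form
    in which regular subdifferentials satisfy it. *)
Lemma convex_projection (C : set 'rV[R]_m) v : C !=set0 ->
  (forall w, (forall e : R, 0 < e -> exists2 x, C x & enorm (x - w) <= e) -> C w) ->
  (forall a b (t : R), C a -> C b -> 0 < t < 1 -> C (a + t *: (b - a))) ->
  exists2 z, C z & forall x, C x -> dotp (v - z) (x - z) <= 0.
Proof.
move=> [x0 Cx0] clC cvC; pose r := enorm (x0 - v).
pose S := [set x : 'rV[R]_m | enorm (x - v) <= r] `&` C.
have cS : compact S.
  apply: subclosed_compact (@compact_ball R m v r) _; last by move=> u [].
  move=> u cu; split.
    apply/ler_addgt0Pl => t t0; have [x [[xr _] /= xu]] := cu _ (near_enorm u t0).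
    by apply: le_trans (enorm_dist x _ _) _; rewrite lerD// ltW// enormBC.
  apply: clC => e e0; have [x [[_ Cx] /= xu]] := cu _ (near_enorm u e0).
  by exists x => //; exact: ltW.
have [||z zS zmin] := @EVT_min_rV R m (fun u => enorm (u - v)) S _ cS.
- by exists x0; split; rewrite /=.
- apply: continuous_subspaceT => u; apply: continuous_comp; last exact: enorm_continuous.
  by apply: continuousB; [exact: cvg_id|exact: cst_continuous].
have [zr Cz] : S z by move: zS; rewrite inE.
have {}zmin x : C x -> enorm (z - v) <= enorm (x - v).
  move=> Cx; have [xr|/ltW xr] := leP (enorm (x - v)) r; last exact: le_trans xr.
  by apply: zmin; rewrite inE.
exists z => // x Cx; apply/ler_addgt0Pl => e e0; rewrite addr0.
set a := v - z; set b := x - z.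
have B0 : 0 < enorm b ^+ 2 + 1 by rewrite ltr_wpDl// sqr_ge0.
have m0 : 0 < Num.min 1 (e / (enorm b ^+ 2 + 1)) by rewrite lt_min ltr01 divr_gt0.
pose t := Num.min 1 (e / (enorm b ^+ 2 + 1)) / 2.
have t0 : 0 < t by rewrite divr_gt0.
have /andP[t1] : (t < 1) && (t < e / (enorm b ^+ 2 + 1)) by rewrite -lt_min /t; lra.
rewrite ltr_pdivlMr// => te.
have := zmin (z + t *: b); rewrite -ler_sqr ?nnegrE//.
have -> : z + t *: b - v = t *: b - a by rewrite /a opprB addrA [t *: b + z]addrC.
rewrite (enormBC z) (sqr_enormB (t *: b) a) enormZ gtr0_norm// dotpZl (dotpC b) exprMn => H.
have {}H : a = v - z -> t * (2 * dotp a b) <= t * (t * enorm b ^+ 2).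
  by move=> _; have := H (cvC _ _ _ Cz Cx _); rewrite t0 t1 => /(_ isT); rewrite -/a; lra.
have := H erefl; rewrite ler_pM2l// => {}H.
have : t * enorm b ^+ 2 <= e by move: te; rewrite mulrDr mulr1; lra.
lra.
Qed.

(** * Regular subgradients and their tangential part *)

Lemma reg_subdiff_subdiff g y v : reg_subdiff g y v -> subdiff g y v.
Proof.
move=> gv; split; first by case: gv.
by exists (fun=> y), (fun=> v); split=> //; exact: cvg_cst.
Qed.

Lemma subdiff_fin g y v : subdiff g y v -> g y = (fine (g y))%:E.
Proof. by case=> gy _; rewrite fineK. Qed.

Lemma reg_subdiff_convex g y v w (t : R) :
  reg_subdiff g y v -> reg_subdiff g y w -> 0 < t < 1 -> reg_subdiff g y (v + t *: (w - v)).
Proof.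
move=> [gy hv] [_ hw] /andP[t0 t1]; split=> // e e0.
apply: filterS2 (hv e e0) (hw e e0) => z.
rewrite -(fineK gy) -!EFinD; case: (g z) => [b||//]; last by rewrite !leey.
rewrite !lee_fin dotpDl dotpZl dotpBl => h1 h2; nra.
Qed.

Lemma reg_subdiff_closed g y w : g y \is a fin_num ->
  (forall e : R, 0 < e -> exists2 x, reg_subdiff g y x & enorm (x - w) <= e) ->
  reg_subdiff g y w.
Proof.
move=> gy cl; split=> // e e0; have e20 : 0 < e / 2 by rewrite divr_gt0.
have [x [_ hx] xw] := cl _ e20.
apply: filterS (hx _ e20) => z; apply: le_trans.
rewrite -(fineK gy) -!EFinD lee_fin lerD2l.
have := dotp_le (w - x) (z - y); rewrite dotpBl (enormBC w).
have := ler_wpM2r (enorm_ge0 (z - y)) xw; lra.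
Qed.

Definition has_gradient (f : 'rV[R]_m -> R^o) (y G : 'rV[R]_m) :=
  forall e : R, 0 < e -> exists2 d : R, 0 < d & forall z : 'rV[R]_m, enorm (z - y) < d ->
    `|f z - f y - dotp G (z - y)| <= e * enorm (z - y).

Lemma Ck_near_gradient (f : 'rV[R]_m -> R^o) y : Ck_near 2 y f -> has_gradient f y (gradient f y).
Proof.
move=> [U [oU Uy fC]] e e0.
have [d d0 hd] := strict_diff (@mean_value_ineq_real _) oU Uy (Ck_on21 fC) e0.
exists d => // z zy; rewrite dotp_gradient; apply: hd => //.
by rewrite subrr enorm0.
Qed.

Lemma near_gradient n (f : 'rV[R]_n -> R^o) (y : 'rV[R]_n) : Ck_near 2 y f -> forall e : R, 0 < e ->
  \forall z \near y, enorm (gradient f z - gradient f y) <= e.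
Proof.
move=> [U [oU Uy fC]] e e0.
apply: filterS (diff_continuous_op (Ck_on21 fC) Uy e0) => z hz.
set G := gradient f z - gradient f y.
have := hz G; have -> : 'd f z G - 'd f y G = dotp (gradient f z) G - dotp (gradient f y) G.
  by congr (_ - _); rewrite dotp_gradient.
rewrite -dotpBl -/G -sqr_enorm ger0_norm ?sqr_ge0// expr2.
have [G0 _|/enorm_gt0 G0] := eqVneq G 0; first by rewrite G0 enorm0 ltW.
by rewrite ler_pM2r.
Qed.

Lemma has_gradient_continuous (f : 'rV[R]_m -> R^o) y G : has_gradient f y G ->
  forall e : R, 0 < e -> \forall z \near y, `|f z - f y| < e.
Proof.
move=> /(_ 1 ltr01)[d d0 hd] e e0; have K0 : 0 < 1 + enorm G by rewrite ltr_pwDl.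
apply/nearE; exists (Num.min d (e / (1 + enorm G))) => [|z].
  by rewrite lt_min d0 divr_gt0.
rewrite lt_min ltr_pdivlMr// => /andP[/hd h ze]; have := norm_dotp G (z - y).
rewrite !ler_norml ltr_norml in h * => /andP[h1 h2]; move/andP: h => [h3 h4].
by apply/andP; split; nra.
Qed.

(** On [M] the function agrees with a smooth one, so the subgradient inequality at points of [M]
    close to [y + s tau] gives [dotp (v - G) tau <= 0]; the same for [- tau] fixes the tangential
    part of [v]. *)
Lemma reg_subdiff_tangent g M (gt : 'rV[R]_m -> R^o) y G v q (h : 'rV[R]_m -> 'rV[R]_q) A :
  chart M y h A -> has_gradient gt y G -> (\forall z \near y, M z -> g z = (gt z)%:E) ->
  reg_subdiff g y v -> forall tau : 'rV[R]_m, tau *m A = 0 -> dotp v tau = dotp G tau.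
Proof.
move=> hM hG gM [gy hv].
suff H (tau : 'rV[R]_m) : tau *m A = 0 -> dotp (v - G) tau <= 0.
  move=> tau tA; apply/eqP; rewrite -subr_eq0 -dotpBl eq_le H//=.
  by rewrite -oppr_le0 -dotpNr H// mulNmx tA oppr0.
move=> tA; apply/ler_addgt0Pl => w w0; rewrite addr0.
pose T := enorm tau + 1; have T0 : 0 < T by rewrite ltr_wpDl.
pose Q := 2 * T + enorm (v - G); have Q0 : 0 < Q by rewrite ltr_pwDl// mulr_gt0.
pose e := w / Q; have e0 : 0 < e by rewrite divr_gt0.
have [d1 d10 hd1] := hG e e0; have /nearP[d2 d20 hd2] := gM.
have /nearP[d3 d30 hd3] := hv e e0.
have e10 : 0 < Num.min e 1 by rewrite lt_min e0 ltr01.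
have [d4 d40 hd4] := tangent_curve hM tA e10.
pose D := Num.min (Num.min (Num.min d1 d2) d3 / T) d4.
have D0 : 0 < D by rewrite !lt_min d40 divr_gt0// !lt_min d10 d20.
pose s := D / 2; have s0 : 0 < s by rewrite divr_gt0.
have : s < D by rewrite /s; lra.
rewrite lt_min ltr_pdivlMr// !lt_min => /andP[/andP[/andP[s1 s2] s3] s4].
have [|x Mx] := hd4 s; first by rewrite s0.
set p := y + s *: tau => xs.
have xs1 : enorm (x - p) <= s.
  by apply: le_trans xs _; rewrite ler_piMl ?(ltW s0)// ge_min lexx orbT.
have {}xs : enorm (x - p) <= e * s.
  by apply: le_trans xs _; rewrite ler_wpM2r ?(ltW s0)// ge_min lexx.
have xy : enorm (x - y) <= s * T.
  apply: le_trans (enorm_dist p _ _) _.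
  by rewrite {2}/p [y + _ - y]addrAC subrr add0r enormZ gtr0_norm// /T; lra.
have xe : e * enorm (x - y) <= e * (s * T) by rewrite ler_pM2l.
have My : M y by case: hM.
have h1 := hd1 x (le_lt_trans xy s1).
have h3 := hd3 x (le_lt_trans xy s3).
rewrite (hd2 x (le_lt_trans xy s2) Mx) (nbhs_singleton gM My) -EFinD lee_fin in h3.
rewrite ler_norml in h1; move/andP: h1 => [_ h1].
have h5 : dotp (v - G) (x - y) <= 2 * (e * (s * T)) by rewrite dotpBl; lra.
have h6 := dotp_le (v - G) (p - x); rewrite (enormBC p) in h6.
have h7 : enorm (v - G) * enorm (x - p) <= enorm (v - G) * (e * s) by rewrite ler_wpM2l.
have E : s *: tau = (x - y) + (p - x) by rewrite [RHS]addrC subrKA /p [RHS]addrAC subrr add0r.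
rewrite -(ler_pM2l s0) -dotpZr E dotpDr.
have : e * Q = w by rewrite /e divfK// gt_eqF.
rewrite /Q; nra.
Qed.

(** By contradiction, with points [Y k] off [M] and nearby projections [p k]. The unit vectors [u k]
    along [Y k - p k] cluster at a normal [l]. Prox-regularity, used at [p k] with a subgradient [w]
    close to [v + (e / 2) l] and at [Y k] with [V k] close to [v], bounds [dotp (w - V k) (u k)] by
    O(|Y k - p k|), whereas it is about [e / 2]. *)
Lemma identification g M ybar v (e : R) :
  partly_smooth g M ybar -> prox_regular g ybar -> subdiff g ybar v -> 0 < e ->
  (forall n, Defs.normal_space M ybar n -> enorm n < e -> subdiff g ybar (v + n)) ->
  exists2 d : R, 0 < d & forall y v', enorm (y - ybar) < d -> enorm (v' - v) < d ->
    (g y < g ybar + d%:E)%E -> subdiff g y v' -> M y.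
Proof.
move=> ps pr gv e0 ball; case: (ps) => [[q [h hM]] [gt [gtC gM]] _ _ [_ isc]].
have cM := defining_map_chart hM.
have My : M ybar by case: cM.
pose ek k : R := k.+1%:R^-1; have ek0 k : 0 < ek k by rewrite invr_gt0.
apply: contrapT => H.
have /choice[f hf] : forall k, exists f : 'rV[R]_m * 'rV[R]_m * 'rV[R]_m,
    [/\ [/\ enorm (f.1.1 - ybar) < ek k, enorm (f.1.2 - v) < ek k,
      (g f.1.1 < g ybar + (ek k)%:E)%E, subdiff g f.1.1 f.1.2 & ~ M f.1.1],
      M f.2, enorm (f.1.1 - f.2) <= enorm (f.1.1 - ybar) &
      forall tau : 'rV[R]_m, tau *m 'J h ybar = 0 ->
        dotp (f.1.1 - f.2) tau <= ek k * enorm tau * enorm (f.1.1 - f.2)].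
  move=> k; apply: contrapT => N; apply: H.
  have /nearP[d d0 hd] := nearest_normal cM (ek0 k).
  exists (Num.min d (ek k)) => [|y v']; first by rewrite lt_min d0 ek0.
  rewrite !lt_min => /andP[yd yk] /andP[_ vk] gk gv'.
  apply: contrapT => nMy; apply: N; have [p [Mp py pn]] := hd y yd.
  exists (y, v', p); split=> //; split=> //; apply: lt_le_trans gk _.
  by rewrite leeD2l// lee_fin ge_min lexx orbT.
pose Y k := (f k).1.1; pose V k := (f k).1.2; pose p k := (f k).2.
have {}hf k : [/\ [/\ enorm (Y k - ybar) < ek k, enorm (V k - v) < ek k,
      (g (Y k) < g ybar + (ek k)%:E)%E, subdiff g (Y k) (V k) & ~ M (Y k)],
      M (p k), enorm (Y k - p k) <= enorm (Y k - ybar) &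
      forall tau : 'rV[R]_m, tau *m 'J h ybar = 0 ->
        dotp (Y k - p k) tau <= ek k * enorm tau * enorm (Y k - p k)] := hf k.
have Yp k : Y k - p k != 0.
  by case: (hf k) => [[_ _ _ _ nM] Mp _ _]; apply: contra_notN nM => /eqP/subr0_eq ->.
pose u k := (enorm (Y k - p k))^-1 *: (Y k - p k).
have u1 k : enorm (u k) = 1 by exact: normalize_enorm.
have [l l1 hl] := unit_cluster_point u1.
(* The tolerance [ek k] in the approximate normality of [u k] vanishes in the limit, so [l] is
   exactly normal. *)
have lN : Defs.normal_space M ybar ((e / 2) *: l).
  apply/(normal_spaceE hM) => tau tA; rewrite dotpZl.
  suff S (s : 'rV[R]_m) : s *m 'J h ybar = 0 -> dotp l s <= 0.
    have -> : dotp l tau = 0; last by rewrite mulr0.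
    apply/eqP; rewrite eq_le S//= -oppr_le0 -dotpNr S//.
    by rewrite mulNmx tA oppr0.
  move=> sA; apply/ler_addgt0Pl => t t0; rewrite addr0.
  have D0 : 0 < 2 * (enorm s + 1) by rewrite mulr_gt0// ltr_wpDl.
  have t1 : 0 < t / (2 * (enorm s + 1)) by rewrite divr_gt0.
  have [N hN] := inv_small t1; have [k Nk] := hl _ N t1; have := hN k Nk.
  rewrite -/(ek k) !ltr_pdivlMr// => kt ul.
  have us : dotp (u k) s <= ek k * enorm s.
    have [_ _ _ /(_ s sA)] := hf k; rewrite /u dotpZl => us.
    by rewrite ler_pdivrMl ?enorm_gt0// mulrC.
  have := dotp_le (l - u k) s; rewrite dotpBl enormBC.
  by have := enorm_ge0 s; have := ek0 k; have := enorm_ge0 (u k - l); nra.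
have nl : enorm ((e / 2) *: l) < e by rewrite enormZ l1 gtr0_norm ?divr_gt0//; lra.
set w0 := v + (e / 2) *: l; have gw0 : subdiff g ybar w0 := ball _ lN nl.
have [gyf _ [r1 [e1 [r10 e10 pr1]]]] := pr _ gw0.
have [_ _ [r2 [e2 [r20 e20 pr2]]]] := pr _ gv.
(* Error budget: [e / 2 * dotp l (u k)] will be at least [e / 4], against an upper bound made of
   three errors of [e / 64]. *)
pose t := Num.min (e / 64) e1; have t0 : 0 < t by rewrite lt_min divr_gt0.
have [t1 t2] : t <= e / 64 /\ t <= e1 by rewrite /t !ge_min !lexx orbT.
have /nearP[d1 d10 hd1] := isc _ gw0 t t0.
have /nearP[d2 d20 hd2] := has_gradient_continuous (Ck_near_gradient gtC) e10.
have /nearP[d3 d30 hd3] := gM.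
pose D := Num.min (Num.min (Num.min d1 d2) (Num.min d3 e1)) (Num.min (Num.min e2 (e / 64)) (e / 64 / (r1 + r2))) / 2.
have r0 : 0 < r1 + r2 by rewrite addr_gt0.
have D0 : 0 < D by rewrite divr_gt0// !lt_min d10 d20 d30 e10 e20 !divr_gt0.
have [N hN] := inv_small D0.
have h20 : (0 : R) < 2^-1 by rewrite invr_gt0.
have [k Nk ul] := hl _ N h20; have := hN k Nk; rewrite -/(ek k).
have D2 : D < 2 * D by lra.
have D2E : 2 * D = Num.min (Num.min (Num.min d1 d2) (Num.min d3 e1)) (Num.min (Num.min e2 (e / 64)) (e / 64 / (r1 + r2))).
  by rewrite /D mulrCA mulfV ?mulr1.
move=> kD; have : 2 * ek k < 2 * D by lra.
rewrite D2E !lt_min => /andP[/andP[/andP[k1 k2] /andP[k3 k4]] /andP[/andP[k5 k6] k7]].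
have ekk := ek0 k.
have [[yk vk gk gvk _] Mp py _] := hf k.
have pk : enorm (p k - ybar) < 2 * ek k.
  by apply: le_lt_trans (enorm_dist (Y k) _ _) _; rewrite enormBC; clear -py yk; lra.
have [w gw ww0] := hd1 _ (lt_trans pk k1) Mp.
have gp := hd3 _ (lt_trans pk k3) Mp.
have gy := nbhs_singleton gM My.
have gY := subdiff_fin gvk; set b := fine _ in gY.
have gtp := hd2 _ (lt_trans pk k2); rewrite ltr_norml in gtp; move/andP: gtp => [_ gtp].
have kk : ek k < 2 * ek k by clear -ekk; lra.
have yke1 := lt_trans (lt_trans yk kk) k4.
have yke2 := lt_trans (lt_trans yk kk) k5.
have pke1 := lt_trans pk k4.
have pke2 := lt_trans pk k5.
have wke1 := lt_le_trans ww0 t2.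
have vke2 := lt_trans (lt_trans vk kk) k5.
have gpe1 : (g (p k) < g ybar + e1%:E)%E by rewrite gp gy -EFinD lte_fin; clear -gtp; lra.
have gye2 : (g (Y k) < g ybar + e2%:E)%E.
  by apply: lt_trans gk _; rewrite gy -!EFinD lte_fin; clear -kk k5; lra.
have := pr1 _ _ _ gw pke1 yke1 wke1 gpe1; rewrite gY gp -EFinD lee_fin => I1.
have := pr2 _ _ _ gvk yke2 pke2 vke2 gye2; rewrite gY gp -EFinD lee_fin => I2.
have E0 := enorm_gt0 (Yp k).
have YE : Y k - p k = enorm (Y k - p k) *: u k.
  by rewrite /u scalerA mulfV ?gt_eqF// scale1r.
have pE : p k - Y k = - (Y k - p k) by rewrite opprB.
rewrite pE dotpNr enormN in I2.
(* Sum of the two prox-regularity inequalities, in which the values of [g] cancel. *)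
have I3 : dotp (w - V k) (Y k - p k) <= (r1 + r2) / 2 * enorm (Y k - p k) ^+ 2.
  by rewrite dotpBl; clear -I1 I2; lra.
rewrite {1}YE dotpZr expr2 mulrCA ler_pM2l// in I3.
have I4 : dotp (w0 - v) (u k) <= dotp (w - V k) (u k) + t + ek k.
  have := dotp_le (w0 - w) (u k); have := dotp_le (V k - v) (u k).
  by rewrite !dotpBl u1 !mulr1 (enormBC w0); clear -vk ww0; lra.
have I5 : e / 2 * dotp l (u k) <= 3 * (e / 64).
  rewrite -dotpZl; have <- : w0 - v = (e / 2) *: l by rewrite /w0 addrAC subrr add0r.
  apply: le_trans I4 _.
  have I7 := ltW (le_lt_trans py yk).
  have I6 : (r1 + r2) / 2 * enorm (Y k - p k) <= (r1 + r2) / 2 * ek k.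
    by rewrite ler_wpM2l// divr_ge0// ltW.
  rewrite ltr_pdivlMr// in k7.
  by clear -I3 I6 k6 k7 t1 ekk; lra.
have := unit_dotp (u k) l1; rewrite dotpC => I6.
by clear -I5 I6 ul e0; nra.
Qed.

End Subdifferential.

(** * Uniqueness of structure manifolds *)

Section Uniqueness.
Context {R : realType} {m : nat}.
Implicit Types (g : 'rV[R]_m -> \bar R) (M : set 'rV[R]_m) (y v w : 'rV[R]_m).

Lemma near_kernel q (h : 'rV[R]_m -> 'rV[R]_q) y : Ck_near 2 y h -> forall e : R, 0 < e ->
  \forall z \near y, forall tau : 'rV[R]_m, tau *m 'J h y = 0 ->
    enorm (tau *m 'J h z) <= e * enorm tau.
Proof.
move=> hC e e0; apply: filterS (near_jacobian hC e0) => z hz tau tA.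
have H (a b : 'rV[R]_q) c : b = 0 -> enorm (a - b) <= c -> enorm a <= c.
  by move=> ->; rewrite subr0.
exact: H tA (hz tau).
Qed.

(** By regularity the subdifferential is closed and convex, so the projection [z] of [v] on it
    separates; [v] and [z] have the same tangential part, hence the direction [v - z] is normal. *)
Lemma separating_normal g M (gt : 'rV[R]_m -> R^o) y v q (h : 'rV[R]_m -> 'rV[R]_q) A G :
  chart M y h A -> has_gradient gt y G -> (\forall z \near y, M z -> g z = (gt z)%:E) ->
  clarke_regular g y -> subdiff g y !=set0 ->
  (forall tau : 'rV[R]_m, tau *m A = 0 -> dotp v tau = dotp G tau) -> ~ subdiff g y v ->
  exists u : 'rV[R]_m, [/\ enorm u = 1, forall x, subdiff g y x -> dotp u (x - v) <= 0 &
    forall tau : 'rV[R]_m, tau *m A = 0 -> dotp u tau = 0].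
Proof.
move=> cM gG gM; rewrite /clarke_regular => -> ne vt nv.
have [x0 [gy _]] := ne.
have [w|a b t|z gz hz] := @convex_projection R m (reg_subdiff g y) v ne.
- exact: reg_subdiff_closed.
- exact: reg_subdiff_convex.
have vz : v - z != 0 by apply: contra_notN nv => /eqP/subr0_eq ->.
have E0 := enorm_gt0 vz.
exists ((enorm (v - z))^-1 *: (v - z)); split; first exact: normalize_enorm.
- move=> x gx; rewrite dotpZl mulr_ge0_le0 ?invr_ge0//.
  have -> : x - v = (x - z) - (v - z) by rewrite opprB addrA subrK.
  rewrite dotpBr -sqr_enorm subr_le0; apply: le_trans (hz x gx) _.
  exact: sqr_ge0.
- move=> tau tA; rewrite dotpZl dotpBl vt// (reg_subdiff_tangent cM gG gM gz tA).
  by rewrite subrr mulr0.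
Qed.

(* Compactness of the unit sphere turns the inner semicontinuity of [subdiff g]
   at [ybar] into a ball of uniform radius inside [subdiff g y]. *)
Lemma near_inner_ball g M ybar v (e : R) q (h : 'rV[R]_m -> 'rV[R]_q) (gt : 'rV[R]_m -> R^o) :
  partly_smooth g M ybar -> 0 < e ->
  (forall n, Defs.normal_space M ybar n -> enorm n < e -> subdiff g ybar (v + n)) ->
  defining_map M ybar h -> smooth_extension g M ybar gt ->
  \forall y \near ybar, M y -> forall v', enorm (v' - v) < e / 4 ->
    (forall tau : 'rV[R]_m, tau *m 'J h y = 0 -> dotp v' tau = dotp (gradient gt y) tau) ->
    subdiff g y v'.
Proof.
move=> ps e0 ball hM [gtC gM]; apply: contrapT => H.
pose ek k : R := k.+1%:R^-1; have ek0 k : 0 < ek k by rewrite invr_gt0.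
case: (hM) => _ hC hr _; have [K K0 /nearP[d1 d10 hd1]] := near_row_full hC hr.
have /nearP[d2 d20 hd2] := defining_map_near hM.
have /nearP[d3 d30 hd3] := Ck_near_near gtC.
have /nearP[d4 d40 hd4] := near_near gM.
have /nearP[d5 d50 hd5] := ps_regular ps.
have /choice[f hf] : forall k, exists f : 'rV[R]_m * 'rV[R]_m * 'rV[R]_m,
    [/\ M f.1.1, enorm (f.1.1 - ybar) < ek k /\ enorm (f.1.1 - ybar) < d1,
      enorm (f.1.2 - v) < e / 4, enorm f.2 = 1 &
      (forall x, subdiff g f.1.1 x -> dotp f.2 (x - f.1.2) <= 0) /\
      forall tau : 'rV[R]_m, tau *m 'J h f.1.1 = 0 -> dotp f.2 tau = 0].
  move=> k; apply: contrapT => N; apply: H.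
  apply/nearE; exists (Num.min (Num.min (Num.min d1 d2) (Num.min d3 d4)) (Num.min d5 (ek k))) => [|y].
    by rewrite !lt_min d10 d20 d30 d40 d50 ek0.
  rewrite !lt_min => /andP[/andP[/andP[y1 y2] /andP[y3 y4]] /andP[y5 y6]].
  move=> My v' vv' vt; apply: contrapT => nv'; apply: N.
  have [cr ne] := hd5 y y5 My.
  have [u [u1 u2 u3]] := separating_normal (defining_map_chart (hd2 y y2 My))
     (Ck_near_gradient (hd3 y y3)) (hd4 y y4) cr ne vt nv'.
  by exists (y, v', u).
pose Y k := (f k).1.1; pose V k := (f k).1.2; pose u k := (f k).2.
have {}hf k : [/\ M (Y k), enorm (Y k - ybar) < ek k /\ enorm (Y k - ybar) < d1,
      enorm (V k - v) < e / 4, enorm (u k) = 1 &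
      (forall x, subdiff g (Y k) x -> dotp (u k) (x - V k) <= 0) /\
      forall tau : 'rV[R]_m, tau *m 'J h (Y k) = 0 -> dotp (u k) tau = 0] := hf k.
have u1 k : enorm (u k) = 1 by case: (hf k).
have [l l1 hl] := unit_cluster_point u1.
(* A tangent vector at [ybar] differs by a small [s] from one in the kernel at [Y k], to which [u k]
   is orthogonal; in the limit [l] is normal at [ybar]. *)
have lN : Defs.normal_space M ybar ((e / 2) *: l).
  apply/(normal_spaceE hM) => tau tA; rewrite dotpZl.
  suff -> : dotp l tau = 0 by rewrite mulr0.
  apply/eqP; rewrite -normr_le0; apply/ler_addgt0Pl => t t0; rewrite addr0.
  pose T := enorm tau; have T0 : 0 <= T by exact: enorm_ge0.
  pose Q := K * T + T + 1; have Q0 : 0 < Q by rewrite ltr_wpDl// addr_ge0// mulr_ge0// ltW.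
  have t1 : 0 < t / Q by rewrite divr_gt0.
  have /nearP[d d0 hd] := near_kernel hC t1.
  have [N hN] := inv_small d0; have [k Nk ul] := hl _ N t1; have {}Nk := hN k Nk.
  have [_ [yk yd1] _ _ [_ un]] := hf k.
  have tJ := hd (Y k) (lt_trans yk Nk) tau tA; rewrite -/T in tJ.
  have [s sA sK] := hd1 (Y k) yd1 (tau *m 'J h (Y k)).
  have : (tau - s) *m 'J h (Y k) = 0 by rewrite mulmxBl sA subrr.
  move=> /un; rewrite dotpBr => /subr0_eq ut.
  have H1 := norm_dotp (l - u k) tau; rewrite dotpBl ut enormBC -/T in H1.
  have H2 := norm_dotp (u k) s; rewrite u1 mul1r in H2.
  have H3 := ler_normD (dotp l tau - dotp (u k) s) (dotp (u k) s); rewrite subrK in H3.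
  have H4 : enorm s <= K * (t / Q * T) by apply: le_trans sK _; rewrite ler_wpM2l// ltW.
  have H5 : enorm (u k - l) * T <= t / Q * T by rewrite ler_wpM2r// ltW.
  have H6 : t / Q * Q = t by rewrite divfK// gt_eqF.
  by rewrite /Q in H6 *; clear -H1 H2 H3 H4 H5 H6 t1; lra.
have nl : enorm ((e / 2) *: l) < e by rewrite enormZ l1 gtr0_norm ?divr_gt0//; lra.
have [_ isc] := ps_continuous ps.
have e16 : 0 < e / 16 by rewrite divr_gt0.
have /nearP[d d0 hd] := isc _ (ball _ lN nl) _ e16.
have [N hN] := inv_small d0.
have h16 : (0 : R) < 16^-1 by rewrite invr_gt0.
have [k Nk ul] := hl _ N h16; have {}Nk := hN k Nk.
have [My [yk _] vk _ [us _]] := hf k.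
have [x gx xv] := hd (Y k) (lt_trans yk Nk) My.
have := us x gx.
(* Against [u k] the first term contributes about [e / 2], the other two at most [e / 16] and
   [e / 4]: the separation inequality fails at [x]. *)
have -> : x - V k = (e / 2) *: l + (x - (v + (e / 2) *: l)) - (V k - v).
  by apply/rowP => i; rewrite !mxE; ring.
rewrite dotpBr (dotpDr _ ((e / 2) *: l)) dotpZr.
have := norm_dotp (u k) (x - (v + (e / 2) *: l)); have := dotp_le (u k) (V k - v).
rewrite u1 !mul1r ler_norml => H1 /andP[H2 _]; have H3 := unit_dotp (u k) l1.
by clear -H1 H2 H3 vk xv ul e0; nra.
Qed.

Lemma affine_span_tangent g y (G tau : 'rV[R]_m) x :
  (forall v, subdiff g y v -> dotp v tau = dotp G tau) ->
  affine_span (subdiff g y) x -> dotp x tau = dotp G tau.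
Proof.
move=> gt [k [a [w [ga w1 ->]]]]; rewrite dotp_suml.
under eq_bigr do rewrite dotpZl gt//.
by rewrite -mulr_suml w1 mul1r.
Qed.

Lemma sub_affine_span (A : set 'rV[R]_m) x : A x -> affine_span A x.
Proof.
by move=> Ax; exists 1%N, (fun=> x), (fun=> 1); split=> //; rewrite big_ord1 ?scale1r.
Qed.

(** A matrix and its transpose have the same operator norm; the hypothesis is tested on the vector
    [x] to be bounded. *)
Lemma mulmx_tr_dist q (A B : 'M[R]_(m, q)) (w : 'rV[R]_q) (c : R) : 0 <= c ->
  (forall v : 'rV[R]_m, enorm (v *m A - v *m B) <= c * enorm v) ->
  enorm (w *m A^T - w *m B^T) <= c * enorm w.
Proof.
move=> c0 H; set x := w *m A^T - w *m B^T.
have := dotp_le w (x *m A - x *m B); rewrite dotpBr -!dotp_mulmx_tr -dotpBl -/x.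
rewrite -sqr_enorm expr2 => H3.
have [x0|/enorm_gt0 x0] := eqVneq x 0; first by rewrite x0 enorm0 mulr_ge0.
rewrite -(ler_pM2r x0); apply: le_trans H3 _.
by apply: le_trans (ler_wpM2l (enorm_ge0 w) (H x)) _; rewrite mulrCA mulrA.
Qed.

(** This field transports a subgradient along the manifold: its tangential part is that of the
    gradient of the extension, and its normal coordinates [w] are frozen. *)
Lemma near_tangent_field q (h : 'rV[R]_m -> 'rV[R]_q) (gt : 'rV[R]_m -> R^o) (w : 'rV[R]_q) y :
  Ck_near 2 y h -> Ck_near 2 y gt -> forall e : R, 0 < e -> \forall z \near y,
  enorm ((gradient gt z + w *m ('J h z)^T) - (gradient gt y + w *m ('J h y)^T)) < e.
Proof.
move=> hC gC e e0; have W0 : 0 < enorm w + 1 by rewrite ltr_wpDl.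
have e1 : 0 < e / 3 by rewrite divr_gt0.
have e2 : 0 < e / 3 / (enorm w + 1) by rewrite divr_gt0.
have /nearP[d1 d10 hd1] := near_gradient gC e1.
have /nearP[d2 d20 hd2] := near_jacobian hC e2.
apply/nearE; exists (Num.min d1 d2) => [|z]; first by rewrite lt_min d10.
rewrite lt_min => /andP[/hd1 H1 /hd2 H2]; rewrite opprD addrACA.
apply: le_lt_trans (enormD _ _) _.
have H3 := mulmx_tr_dist w (ltW e2) H2.
have H4 : e / 3 / (enorm w + 1) * enorm w <= e / 3.
  by rewrite mulrAC ler_pdivrMr// ler_pM2l// lerDl.
by clear -H1 H3 H4 e0; lra.
Qed.

(** Let [z] be in [M'] and [p] its projection on [M]. Both are zeros of [h'], so [z - p] lies within
    a quarter of its length of [ker A'], hence of the tangent space of [M]; being also nearly normal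
    to [M], it vanishes. *)
Lemma germ_of_inclusion M M' y q q' (h : 'rV[R]_m -> 'rV[R]_q) (h' : 'rV[R]_m -> 'rV[R]_q') A A' :
  chart M y h A -> chart M' y h' A' -> (\forall z \near y, M z -> M' z) ->
  (forall tau : 'rV[R]_m, tau *m A' = 0 -> tau *m A = 0) -> \forall z \near y, M' z -> M z.
Proof.
move=> cM cM' MM' TT'; case: (cM') => _ sd' rA' M'h'.
have [K [e1 [K0 e10 hK]]] := stable_right_inverse rA'.
have {}hK (w : 'rV[R]_q') : exists2 u, u *m A' = w & enorm u <= K * enorm w.
  by apply: hK => v; rewrite subrr enorm0 mulr_ge0// ltW.
have q4 : (0 : R) < 4^-1 by rewrite invr_gt0.
have k4 : 0 < 4^-1 / K by rewrite divr_gt0.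
have /nearP[d1 d10 hd1] := nearest_normal cM q4.
have [d2 d20 hd2] := sd' _ k4.
have /nearP[d3 d30 hd3] := MM'; have /nearP[d4 d40 hd4] := M'h'.
apply/nearE; exists (Num.min (Num.min d1 d2) (Num.min d3 d4) / 2) => [|z].
  by rewrite divr_gt0// !lt_min d10 d20 d30.
rewrite ltr_pdivlMr// !lt_min => /andP[/andP[z1 z2] /andP[z3 z4]] M'z.
have zz t : enorm (z - y) * 2 < t -> enorm (z - y) < t.
  by have := enorm_ge0 (z - y); lra.
have [p [Mp zp pn]] := hd1 z (zz _ z1).
have pp t : enorm (z - y) * 2 < t -> enorm (p - y) < t.
  by have := enorm_dist z p y; rewrite (enormBC p z); lra.
have hz : h' z = 0 by apply/(hd4 z (zz _ z4)).
have hp : h' p = 0 by apply/(hd4 p (pp _ z4)); apply: hd3 => //; exact: pp.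
have := hd2 z p (zz _ z2) (pp _ z2); rewrite hz hp subrr sub0r enormN => H1.
have [x xA xK] := hK ((z - p) *m A').
have tA : (z - p - x) *m A = 0 by apply: TT'; rewrite mulmxBl xA subrr.
have {pn}H2 := pn _ tA.
have H3 := dotp_le (z - p) x; have H4 := enormB (z - p) x.
have H5 : enorm x <= 4^-1 * enorm (z - p).
  apply: le_trans xK _; apply: le_trans (ler_wpM2l (ltW K0) H1) _.
  by rewrite mulrA mulrCA mulfV ?gt_eqF// mulr1.
rewrite dotpBr -sqr_enorm in H2.
suff /enorm_eq0/subr0_eq -> : enorm (z - p) = 0 by [].
apply/eqP; rewrite eq_le enorm_ge0 andbT leNgt; apply/negP => E0.
have H6 : enorm (z - p) * enorm x <= enorm (z - p) * (4^-1 * enorm (z - p)) by rewrite ler_pM2l.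
have H7 : enorm (z - p) * enorm (z - p - x) <= enorm (z - p) * (2 * enorm (z - p)).
  by rewrite ler_pM2l//; clear -H4 H5 E0; lra.
have H8 : 0 < enorm (z - p) * enorm (z - p) by rewrite mulr_gt0.
by clear -H2 H3 H6 H7 H8; rewrite expr2 in H2; lra.
Qed.

(** The ball of subgradients in normal directions persists along [M], so sharpness of a competitor
    [M'] at [y] ties its normal directions to those of [M]. Identification, applied at [y] to [M'],
    then puts [M] inside [M'], and the inclusion of the tangent space of [M'] in that of [M] gives
    the converse. *)
Lemma structure_unique g M ybar v (e : R) :
  partly_smooth g M ybar -> subdiff g ybar v -> 0 < e ->
  (forall n, Defs.normal_space M ybar n -> enorm n < e -> subdiff g ybar (v + n)) ->
  \forall y \near ybar, M y -> forall M', structure_manifold g M' y ->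
    \forall z \near y, M z <-> M' z.
Proof.
move=> ps gv e0 ball; case: (ps) => [[q [h hM]] [gt gtM] reg _ _].
have /nearP[d1 d10 hd1] := near_near (near_inner_ball ps e0 ball hM gtM).
case: (gtM) => gtC gM; case: (hM) => My hC hr _.
have cM := defining_map_chart hM.
have [w wE] : exists w : 'rV[R]_q, v - gradient gt ybar = w *m ('J h ybar)^T.
  apply: orth_ker_image => tau tA; rewrite dotpBl.
  have [cr _] := nbhs_singleton reg My; rewrite /clarke_regular in cr; rewrite cr in gv.
  by rewrite (reg_subdiff_tangent cM (Ck_near_gradient gtC) gM gv tA) subrr.
pose v0 y := gradient gt y + w *m ('J h y)^T.
have v0E : v0 ybar = v by rewrite /v0 -wE addrC subrK.
have v0t y tau : tau *m 'J h y = 0 -> dotp (v0 y) tau = dotp (gradient gt y) tau.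
  by move=> tA; rewrite /v0 dotpDl dotp_mulmx_tr tA dotp0 addr0.
have e8 : 0 < e / 8 by rewrite divr_gt0.
have /nearP[d2 d20 hd2] : \forall y \near ybar, \forall z \near y, enorm (v0 z - v) < e / 8.
  by apply: near_near; rewrite -v0E; exact: near_tangent_field.
have /nearP[d3 d30 hd3] := Ck_near_near hC.
have /nearP[d4 d40 hd4] := Ck_near_near gtC.
have /nearP[d5 d50 hd5] := near_near gM.
have /nearP[d6 d60 hd6] := reg.
have /nearP[d7 d70 hd7] := defining_map_near hM.
apply/nearE; exists (Num.min (Num.min (Num.min d1 d2) (Num.min d3 d4)) (Num.min (Num.min d5 d6) d7)) => [|y].
  by rewrite !lt_min d10 d20 d30 d40 d50 d60.
rewrite !lt_min => /andP[/andP[/andP[/hd1 y1 /hd2 y2] /andP[/hd3 y3 /hd4 y4]]].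
move=> /andP[/andP[/hd5 y5 /hd6 y6] /hd7 y7] My' M' [ps' pr'].
have [cr ne] := y6 My'; have hMy := y7 My'.
have [[q' [h' hM']] _ _ [a' sharp] _] := ps'.
have cM' := defining_map_chart hM'; have cMy := defining_map_chart hMy.
have By := nbhs_singleton y1 My'.
have v0y : enorm (v0 y - v) < e / 8 := nbhs_singleton y2.
have e84 t : t < e / 8 -> t < e / 4 by clear -e0; lra.
have gv0 : subdiff g y (v0 y) by apply: By => [|tau]; [exact: e84|exact: v0t].
have gt_tan tau x : tau *m 'J h y = 0 -> subdiff g y x -> dotp x tau = dotp (gradient gt y) tau.
  move=> tA; rewrite /clarke_regular in cr; rewrite cr => gx.
  exact: (reg_subdiff_tangent cMy (Ck_near_gradient y4) y5 gx tA).
have N'B (a b : 'rV[R]_m) (s t : R) : Defs.normal_space M' y a -> Defs.normal_space M' y b ->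
    Defs.normal_space M' y (s *: a + t *: b).
  move=> /(normal_spaceE hM') ha /(normal_spaceE hM') hb; apply/(normal_spaceE hM') => tau tA.
  by rewrite dotpDl !dotpZl ha// hb// !mulr0 addr0.
have span x : affine_span (subdiff g y) x <-> exists2 n, Defs.normal_space M' y n & a' + n = x.
  by rewrite sharp.
have [n0 Nn0 n0E] := (span _).1 (sub_affine_span gv0).
(* Adding a normal of [M'] stays in the affine span, on which the tangential part along [M] is
   constant; the uniform ball then contains the sum. *)
have ball' n : Defs.normal_space M' y n -> enorm n < e / 8 -> subdiff g y (v0 y + n).
  move=> Nn n8; apply: By => [|tau tA].
    rewrite addrAC; apply: le_lt_trans (enormD _ _) _.
    by clear -v0y n8; lra.
  apply: (affine_span_tangent (fun x => gt_tan tau x tA)).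
  apply/span; exists (n0 + n); last by rewrite addrA n0E.
  by have := N'B n0 n 1 1 Nn0 Nn; rewrite !scale1r.
(* Every point [z] of [M] near [y] carries the subgradient [v0 z], close to [v0 y], so
   identification at [y] places it in [M']. *)
have MM' : \forall z \near y, M z -> M' z.
  have [d d0 hd] := identification ps' pr' gv0 e8 ball'.
  have /nearP[r1 r10 hr1] := y1; have /nearP[r2 r20 hr2] := y2.
  have /nearP[r3 r30 hr3] : \forall z \near y, enorm (v0 z - v0 y) < d.
    exact: near_tangent_field.
  have /nearP[r4 r40 hr4] := has_gradient_continuous (Ck_near_gradient y4) d0.
  have /nearP[r5 r50 hr5] := y5.
  apply/nearE; exists (Num.min (Num.min (Num.min r1 r2) (Num.min r3 r4)) (Num.min r5 d)) => [|z].
    by rewrite !lt_min r10 r20 r30 r40 r50.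
  rewrite !lt_min => /andP[/andP[/andP[/hr1 z1 /hr2 z2] /andP[/hr3 z3 /hr4 z4]] /andP[/hr5 z5 z6]] Mz.
  apply: (hd z (v0 z) z6 z3).
    rewrite (z5 Mz) (nbhs_singleton y5 My') -EFinD lte_fin.
    by move: z4; rewrite ltr_norml => /andP[_]; clear; lra.
  by apply: z1 => // [|tau]; [exact: e84|exact: v0t].
have TT' (tau : 'rV[R]_m) : tau *m 'J h' y = 0 -> tau *m 'J h y = 0.
  (* [n] is normal to [M], and [dotp n tau] is the square norm of [tau *m 'J h y]. Since [v0 y] and
     [v0 y + s *: n] are both subgradients, [n] is also normal to [M'], hence orthogonal to
     [tau]. *)
  move=> tA'; pose n := (tau *m 'J h y) *m ('J h y)^T.
  pose s := e / 16 / (enorm n + 1).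
  have n10 : 0 < enorm n + 1 by rewrite ltr_wpDl.
  have s0 : 0 < s by rewrite !divr_gt0.
  have sn : enorm (s *: n) < e / 8.
    rewrite enormZ gtr0_norm// /s mulrAC ltr_pdivrMr//.
    by clear -e0; have := enorm_ge0 n; nra.
  have gsn : subdiff g y (v0 y + s *: n).
    apply: By => [|t tA].
      rewrite addrAC; apply: le_lt_trans (enormD _ _) _.
      by clear -v0y sn; lra.
    by rewrite dotpDl v0t// dotpZl dotp_mulmx_tr tA dotp0 mulr0 addr0.
  have [n1 Nn1 n1E] := (span _).1 (sub_affine_span gsn).
  have : Defs.normal_space M' y (s *: n).
    have -> : s *: n = 1 *: n1 + (-1) *: n0; last exact: N'B.
    rewrite scale1r scaleN1r; have -> : n1 = v0 y + s *: n - a' by rewrite -n1E addrC addKr.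
    by rewrite -n0E; apply/rowP => i; rewrite !mxE; ring.
  move=> /(normal_spaceE hM')/(_ tau tA') /eqP.
  rewrite dotpZl mulf_eq0 gt_eqF//= dotp_mulmx_tr -sqr_enorm sqrf_eq0 => /eqP.
  exact: enorm_eq0.
have M'M := germ_of_inclusion cMy cM' MM' TT'.
have /nearP[r1 r10 hr1] := MM'; have /nearP[r2 r20 hr2] := M'M.
apply/nearE; exists (Num.min r1 r2) => [|z]; first by rewrite lt_min r10.
by rewrite lt_min => /andP[/hr1 ? /hr2 ?]; split.
Qed.

Lemma defining_map_germ M M' y q (h : 'rV[R]_m -> 'rV[R]_q) :
  (\forall z \near y, M z <-> M' z) -> defining_map M' y h -> defining_map M y h.
Proof.
move=> MM' [M'y hC hr M'h]; split=> //; first by apply/(nbhs_singleton MM').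
by apply: filterS2 MM' M'h => z H1 H2; apply: (iff_trans H1).
Qed.

Lemma normal_space_germ M M' y : (\forall z \near y, M z <-> M' z) ->
  Defs.normal_space M y = Defs.normal_space M' y.
Proof.
move=> MM'; have M'M : \forall z \near y, M' z <-> M z by apply: filterS MM' => z ->.
by apply/seteqP; split=> v [q [h [hM vE]]]; exists q, h; split=> //; exact: defining_map_germ hM.
Qed.

Lemma partly_smooth_germ g M M' y : (\forall z \near y, M z <-> M' z) ->
  partly_smooth g M' y -> partly_smooth g M y.
Proof.
move=> MM' [[q [h hM]] [gt [gtC gM]] reg [a sharp] [osc isc]]; split.
- by exists q, h; exact: defining_map_germ hM.
- by exists gt; split=> //; apply: filterS2 MM' gM => z [H _] H' /H/H'.
- by apply: filterS2 MM' reg => z [H _] H' /H/H'.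
- by exists a; rewrite sharp (normal_space_germ MM').
split=> [ys vs v Mys gvs ysy vsv|v gv e e0].
  (* Outer semicontinuity is stated for sequences lying entirely in the manifold, so the first [N]
     terms are dropped. *)
  have [N _ hN] : \forall k \near \oo, M' (ys k).
    have H0 : \forall k \near \oo, M (ys k) <-> M' (ys k) := ysy _ MM'.
    by apply: filterS H0 => k [H _]; exact: H.
  apply: (osc (fun k => ys (k + N)%N) (fun k => vs (k + N)%N) v) => //.
  - by move=> k; apply: hN; rewrite /= leq_addl.
  - by rewrite (cvg_shiftn N ys).
  - by rewrite (cvg_shiftn N vs).
by apply: filterS2 MM' (isc v gv e e0) => z [H _] H' /H/H'.
Qed.

Lemma associated_data_near g (s : structure R m) ybar : associated_data g s ybar ->
  \forall y \near ybar, mfd s y -> associated_data g s y.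
Proof.
move=> [hM [gtC gM]]; have /nearP[d1 d10 hd1] := defining_map_near hM.
have /nearP[d2 d20 hd2] := Ck_near_near gtC; have /nearP[d3 d30 hd3] := near_near gM.
apply/nearE; exists (Num.min (Num.min d1 d2) d3) => [|y]; first by rewrite !lt_min d10 d20.
rewrite !lt_min => /andP[/andP[/hd1 y1 /hd2 y2] /hd3 y3] My.
by split; [exact: y1|split].
Qed.

(* Partial smoothness need not persist at nearby points of the manifold, because
   continuity of the subdifferential is only required at [ybar]; it does as soon
   as some structure manifold exists there. *)
Lemma structure_detected g (s : structure R m) ybar v (e : R) :
  partly_smooth g (mfd s) ybar -> associated_data g s ybar -> subdiff g ybar v -> 0 < e ->
  (forall n, Defs.normal_space (mfd s) ybar n -> enorm n < e -> subdiff g ybar (v + n)) ->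
  \forall y \near ybar, mfd s y -> forall s', structure_at g s' y -> structure_at g s y.
Proof.
move=> ps sd gv e0 ball.
have /nearP[d1 d10 hd1] := structure_unique ps gv e0 ball.
have /nearP[d2 d20 hd2] := associated_data_near sd.
apply/nearE; exists (Num.min d1 d2) => [|y]; first by rewrite lt_min d10.
rewrite lt_min => /andP[/hd1 y1 /hd2 y2] My s' [sm _]; split; last exact: y2.
split; last by case: sm.
by apply: partly_smooth_germ (y1 My _ sm) _; case: sm.
Qed.

End Uniqueness.

(** * Proximal points *)

Section Prox.
Context {R : realType} {m : nat}.
Implicit Types (g : 'rV[R]_m -> \bar R) (M : set 'rV[R]_m) (y v w : 'rV[R]_m).

Lemma small_scale (k d : R) : 0 <= k -> 0 < d ->
  exists2 t : R, 0 < t & forall s : R, 0 < s -> s <= t -> k * s < d.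
Proof.
move=> k0 d0; have k1 : 0 < k + 1 by rewrite ltr_wpDl.
exists (d / (k + 1)) => [|s s0]; first by rewrite divr_gt0.
by rewrite ler_pdivlMr// mulrDr mulr1 mulrC; lra.
Qed.

Lemma sqr_enormD (u v : 'rV[R]_m) :
  enorm (u + v) ^+ 2 = enorm u ^+ 2 + 2 * dotp u v + enorm v ^+ 2.
Proof. by rewrite -{1}[v]opprK sqr_enormB dotpNr enormN; ring. Qed.

Lemma sqr_enormD_le (u v : 'rV[R]_m) :
  enorm (u + v) ^+ 2 <= 2 * enorm u ^+ 2 + 2 * enorm v ^+ 2.
Proof. by have := sqr_ge0 (enorm (u - v)); rewrite sqr_enormD sqr_enormB; lra. Qed.

Lemma prox_fin g (gamma : R) y0 y : proper_function g -> prox gamma g y0 y ->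
  g y \is a fin_num.
Proof.
move=> [gN [y1 gy1]] [_ /(_ y1 I)]; rewrite fin_numE gN /= => H.
apply/eqP => gy; move: H gy1; rewrite gy addye//.
by case: (g y1) (gN y1).
Qed.

(** Fermat's rule: the proximal term exceeds its linear part by [|z - y|^2 / (2 gamma)], at most
    [e |z - y|] as soon as [|z - y| < gamma e]. *)
Lemma prox_subdiff g (gamma : R) y0 y : 0 < gamma -> proper_function g ->
  prox gamma g y0 y -> subdiff g y (gamma^-1 *: (y0 - y)).
Proof.
move=> g0 pg py; have gy := prox_fin pg py; case: (py) => _ hy.
apply: reg_subdiff_subdiff; split=> // e e0.
apply/nearE; exists (gamma * e) => [|z zy]; first by rewrite mulr_gt0.
have := hy z I; rewrite -(fineK gy) -!EFinD.
have : (g z != -oo)%E by case: pg.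
case: (g z) => [b _||//]; last by rewrite !leey.
rewrite -EFinD !lee_fin.
have -> : z - y0 = (z - y) + (y - y0) by rewrite subrKA.
rewrite (sqr_enormD (z - y)) dotpZl (dotpC (y0 - y)) -(opprB y y0) dotpNr => H.
have H1 : (2 * gamma)^-1 * enorm (z - y) ^+ 2 <= e * enorm (z - y).
  rewrite ler_pdivrMl ?mulr_gt0// expr2 mulrA ler_wpM2r//.
  by clear -zy e0 g0; nra.
have E : (enorm (z - y) ^+ 2 + 2 * dotp (z - y) (y - y0) + enorm (y - y0) ^+ 2) / (2 * gamma) =
   (2 * gamma)^-1 * enorm (z - y) ^+ 2 + gamma^-1 * dotp (z - y) (y - y0)
     + enorm (y - y0) ^+ 2 / (2 * gamma) by field; rewrite gt_eqF.
by rewrite E in H; clear -H H1; lra.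
Qed.

(** A crude localization: comparison with [ybar] and the lower bound from prox-boundedness give
    [|y - y0|^2 = O(gamma)], once [r gamma] is small enough to absorb the quadratic term. *)
Lemma prox_close g ybar (a e : R) : proper_function g -> prox_bounded g -> g ybar = a%:E ->
  0 < e -> exists2 Gamma : R, 0 < Gamma & forall (gamma : R) y0 y, 0 < gamma -> gamma <= Gamma ->
    enorm (y0 - ybar) <= gamma -> prox gamma g y0 y -> enorm (y - ybar) < e.
Proof.
move=> pg [r [b [r0 hb]]] ga e0.
pose C := `|a - b| + 1 + r * (enorm ybar + 1) ^+ 2.
have C0 : 0 < C by rewrite /C -addrA addrCA ltr_pwDl// addr_ge0// mulr_ge0// sqr_ge0.
have [t1 t10 ht1] := small_scale r0 (ltac:(by rewrite invr_gt0) : (0 : R) < 4^-1).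
have [t2 t20 ht2] := small_scale (ltW C0) (ltac:(by rewrite divr_gt0// exprn_gt0) : 0 < e ^+ 2 / 16).
have [t3 t30 ht3] := small_scale ler01 (ltac:(by rewrite divr_gt0) : 0 < e / 2).
exists (Num.min (Num.min t1 t2) (Num.min t3 1)) => [|gamma y0 y g0].
  by rewrite !lt_min t10 t20 t30 ltr01.
rewrite !le_min => /andP[/andP[/(ht1 _ g0) g1 /(ht2 _ g0) g2] /andP[/(ht3 _ g0) g3 g4]] yg py.
have gy := prox_fin pg py; case: py => _ /(_ ybar I).
have := hb y; rewrite ga -(fineK gy) -!EFinD !lee_fin => H1 H2.
have {}H2 : gamma * fine (g y) + enorm (y - y0) ^+ 2 / 2 <= gamma * a + enorm (ybar - y0) ^+ 2 / 2.
  have E (s t : R) : gamma * (s + t / (2 * gamma)) = gamma * s + t / 2 by field; rewrite gt_eqF.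
  by rewrite -!E ler_pM2l.
have H3 : enorm (ybar - y0) ^+ 2 <= gamma * 1.
  by rewrite enormBC expr2 ler_pM// (le_trans yg).
have H4 : enorm y ^+ 2 <= 2 * enorm (y - y0) ^+ 2 + 2 * (enorm ybar + 1) ^+ 2.
  rewrite -{1}(subrK y0 y); apply: le_trans (sqr_enormD_le _ _) _.
  rewrite lerD2l ler_pM2l// ler_sqr ?nnegrE ?addr_ge0//.
  rewrite -(subrK ybar y0); apply: le_trans (enormD _ _) _.
  by rewrite addrC lerD2l (le_trans yg).
have H5 : enorm (y - y0) ^+ 2 <= 4 * (gamma * C).
  have H6 : gamma * (a - b) <= gamma * `|a - b| by rewrite ler_pM2l// ler_norm.
  have H7 : r * enorm y ^+ 2 <= r * (2 * enorm (y - y0) ^+ 2 + 2 * (enorm ybar + 1) ^+ 2).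
    by rewrite ler_wpM2l.
  have H8 : r * gamma * enorm (y - y0) ^+ 2 <= 4^-1 * enorm (y - y0) ^+ 2.
    by rewrite ler_wpM2r ?sqr_ge0// ltW.
  have H9 : gamma * (r * enorm y ^+ 2) <= gamma * (r * (2 * enorm (y - y0) ^+ 2 + 2 * (enorm ybar + 1) ^+ 2)).
    by rewrite ler_pM2l.
  have H10 : gamma * b <= gamma * (fine (g y) + r / 2 * enorm y ^+ 2) by rewrite ler_pM2l.
  by rewrite /C; clear -H2 H3 H6 H8 H9 H10 g0; lra.
have H6 : enorm (y - y0) < e / 2.
  by rewrite -ltr_sqr ?nnegrE ?divr_ge0 ?(ltW e0)//; clear -H5 g2; lra.
by apply: le_lt_trans (enorm_dist y0 _ _) _; clear -H6 g3 yg; lra.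
Qed.

(* The prox objective at [y] is compared with its value at a point of [M] close
   to [ybar - gamma v], where [v], the tangential subgradient, is the Riemannian
   gradient of [g] at [ybar]. *)
Lemma prox_asymptotics g M ybar v (gt : 'rV[R]_m -> R^o) G q (h : 'rV[R]_m -> 'rV[R]_q) A (e : R) :
  proper_function g -> prox_bounded g -> chart M ybar h A -> has_gradient gt ybar G ->
  (\forall z \near ybar, M z -> g z = (gt z)%:E) -> prox_regular_for g ybar v ->
  subdiff g ybar v -> v *m A = 0 -> dotp v v = dotp G v -> 0 < e ->
  exists eps Gamma : R, [/\ 0 < eps, 0 < Gamma &
    forall (gamma : R) y0 y, 0 < gamma -> gamma <= Gamma -> enorm (y0 - ybar) <= eps * gamma ->
      prox gamma g y0 y -> [/\ enorm (y - ybar) < e, enorm (gamma^-1 *: (y0 - y) - v) < e &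
        (g y < g ybar + e%:E)%E]].
Proof.
move=> pg pb cM gG gM [gf _ [r [e1 [r0 e10 pr]]]] gv vA vG e0.
have My : M ybar by case: cM.
have ga := nbhs_singleton gM My; set a := gt ybar in ga.
pose V := enorm v; have V0 : 0 <= V by exact: enorm_ge0.
pose K := 3 * (V + 1) + enorm G; have K0 : 0 < K by rewrite /K ltr_pwDl// mulr_gt0// ltr_wpDl.
have KV : 0 < K + V by rewrite ltr_pwDl.
(* [eta] is both the relative accuracy of the comparison point and the allowed ratio of
   [|y0 - ybar|] to [gamma]. *)
pose eta := Num.min 1 (e ^+ 2 / 16 / (K + V)).
have e2 : 0 < e ^+ 2 / 16 by rewrite divr_gt0// exprn_gt0.
have eta0 : 0 < eta by rewrite lt_min ltr01 divr_gt0.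
have eta1 : eta <= 1 by rewrite ge_min lexx.
have etaK : eta * (K + V) <= e ^+ 2 / 16 by rewrite -ler_pdivlMr// ge_min lexx orbT.
have [d1 d10 hd1] := gG _ eta0; have /nearP[d2 d20 hd2] := gM.
have vNA : (- v) *m A = 0 by rewrite mulNmx vA oppr0.
have [d3 d30 hd3] := tangent_curve cM vNA eta0.
have ee10 : 0 < Num.min e e1 by rewrite lt_min e0.
have [t0 t00 ht0] := prox_close pg pb ga ee10.
have V1 : 0 <= V + 1 by rewrite addr_ge0.
have [t1 t10 ht1] := small_scale V1 d10; have [t2 t20 ht2] := small_scale V1 d20.
have [t3 t30 ht3] := small_scale ler01 d30.
have r1 : 0 <= r * (1 + 2 * V ^+ 2) by rewrite mulr_ge0 ?(ltW r0)// addr_ge0// mulr_ge0// sqr_ge0.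
have [t4 t40 ht4] := small_scale r1 e2.
have [t5 t50 ht5] := small_scale (ltW r0) (ltac:(by rewrite invr_gt0) : (0 : R) < 8^-1).
have [t6 t60 ht6] := small_scale (ltW K0) e0.
exists eta, (Num.min (Num.min (Num.min t0 t1) (Num.min t2 t3)) (Num.min (Num.min t4 t5) t6)).
split=> [//||gamma y0 y g0]; first by rewrite !lt_min t00 t10 t20 t30 t40 t50.
rewrite !le_min => /andP[/andP[/andP[g_0 /(ht1 _ g0) g1] /andP[/(ht2 _ g0) g2 /(ht3 _ g0) g3]]].
move=> /andP[/andP[/(ht4 _ g0) g4 /(ht5 _ g0) g5] /(ht6 _ g0) g6] yg py.
have ygg : enorm (y0 - ybar) <= gamma by apply: le_trans yg _; rewrite ler_piMl// ltW.
have := ht0 _ _ _ g0 g_0 ygg py; rewrite lt_min => /andP[ye ye1].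
have gy := prox_fin pg py; case: (py) => _ hprox; pose b := fine (g y).
have gyE : g y = b%:E by rewrite /b fineK.
have [|p Mp] := hd3 gamma; first by rewrite g0 -[gamma]mul1r.
rewrite scalerN => pp.
have pyb : enorm (p - ybar) <= (V + 1) * gamma.
  have -> : p - ybar = (p - (ybar - gamma *: v)) - gamma *: v.
    by apply/rowP => i; rewrite !mxE; ring.
  apply: le_trans (enormB _ _) _; rewrite enormZ gtr0_norm//.
  have : eta * gamma <= 1 * gamma by rewrite ler_pM2r.
  by rewrite -/V; clear -pp; lra.
have gp : g p = (gt p)%:E by apply: hd2 => //; exact: le_lt_trans pyb g2.
have P1 : gt p <= a - gamma * V ^+ 2 + gamma * eta * (V + 1 + enorm G).
  have := hd1 p (le_lt_trans pyb g1); rewrite ler_norml => /andP[_ H].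
  have H1 : eta * enorm (p - ybar) <= eta * ((V + 1) * gamma) by rewrite ler_pM2l.
  have E : p - ybar = (p - (ybar - gamma *: v)) - gamma *: v.
    by apply/rowP => i; rewrite !mxE; ring.
  have H2 := dotp_le G (p - (ybar - gamma *: v)).
  have H3 : enorm G * enorm (p - (ybar - gamma *: v)) <= enorm G * (eta * gamma) by rewrite ler_wpM2l.
  have H4 : dotp G (p - ybar) = dotp G (p - (ybar - gamma *: v)) - gamma * V ^+ 2.
    by rewrite E (dotpBr _ _ (gamma *: v)) dotpZr -vG -sqr_enorm.
  by rewrite -/a in H; clear -H H1 H2 H3 H4; lra.
have P2 : enorm (p - y0) ^+ 2 <= gamma ^+ 2 * (V ^+ 2 + 4 * eta * (V + 1)).
  have H : enorm (p - y0) <= gamma * (V + 2 * eta).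
    have -> : p - y0 = (p - (ybar - gamma *: v)) - gamma *: v - (y0 - ybar).
      by apply/rowP => i; rewrite !mxE; ring.
    apply: le_trans (enormB _ _) _; have := enormB (p - (ybar - gamma *: v)) (gamma *: v).
    by rewrite enormZ gtr0_norm// -/V; clear -pp yg; lra.
  have : enorm (p - y0) ^+ 2 <= (gamma * (V + 2 * eta)) ^+ 2.
    by rewrite ler_sqr ?nnegrE// mulr_ge0 ?(ltW g0)// addr_ge0// mulr_ge0// ltW.
  rewrite exprMn => H1; apply: le_trans H1 _; rewrite ler_wpM2l ?sqr_ge0//.
  by clear -eta0 eta1 V0; nra.
pose u := gamma^-1 *: (y0 - y).
have yE : y0 - y = gamma *: u by rewrite /u scalerA mulfV ?gt_eqF// scale1r.
(* Upper estimate: the proximal value at [p] is [a - gamma / 2 * V ^+ 2] to first order, because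
   [dotp G v = V ^+ 2]. *)
have P3 : b + gamma / 2 * enorm u ^+ 2 <= a - gamma / 2 * V ^+ 2 + gamma * eta * K.
  have := hprox p I; rewrite gyE gp -!EFinD lee_fin (enormBC y) yE enormZ gtr0_norm// => H.
  have E : (gamma * enorm u) ^+ 2 / (2 * gamma) = gamma / 2 * enorm u ^+ 2.
    by field; rewrite gt_eqF.
  rewrite E in H.
  have H1 : enorm (p - y0) ^+ 2 / (2 * gamma) <= gamma / 2 * (V ^+ 2 + 4 * eta * (V + 1)).
    rewrite ler_pdivrMr ?mulr_gt0//; apply: le_trans P2 _.
    by rewrite le_eqVlt; apply/orP; left; apply/eqP; field.
  by rewrite /K; clear -H H1 P1; lra.
have P4 : b <= a + gamma * eta * K.
  have H : 0 <= gamma / 2 * enorm u ^+ 2 by rewrite mulr_ge0 ?divr_ge0 ?(ltW g0)// sqr_ge0.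
  have H1 : 0 <= gamma / 2 * V ^+ 2 by rewrite mulr_ge0 ?divr_ge0 ?(ltW g0)// sqr_ge0.
  by clear -H H1 P3; lra.
split=> //; last first.
  rewrite gyE ga -EFinD lte_fin; have H : eta * (gamma * K) <= 1 * (gamma * K).
    by rewrite ler_wpM2r// mulr_ge0// ltW.
  by clear -P4 H g6; lra.
have yy : enorm (ybar - ybar) < e1 by rewrite subrr enorm0.
have vv : enorm (v - v) < e1 by rewrite subrr enorm0.
have gg : (g ybar < g ybar + e1%:E)%E by rewrite ga -EFinD lte_fin ltrDl.
(* Lower estimate, by prox-regularity at [v]; combined with the upper one it completes the square
   and leaves [|u - v|^2 / 2] bounded by the errors. *)
have := pr ybar y v gv yy ye1 vv gg; rewrite ga gyE -EFinD lee_fin => H.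
have E1 : y - ybar = (y0 - ybar) - gamma *: u by rewrite -yE; apply/rowP => i; rewrite !mxE; ring.
have H1 : enorm (y - ybar) ^+ 2 <= 2 * gamma ^+ 2 + 2 * gamma ^+ 2 * enorm u ^+ 2.
  rewrite E1; apply: le_trans (sqr_enormD_le _ _) _; rewrite enormN enormZ gtr0_norm// exprMn.
  apply: lerD; last by rewrite mulrA.
  by rewrite ler_pM2l// ler_sqr ?nnegrE// ltW.
have H2 := norm_dotp v (y0 - ybar); rewrite ler_norml -/V in H2; move/andP: H2 => [H2 _].
have H3 : V * enorm (y0 - ybar) <= V * (eta * gamma) by rewrite ler_wpM2l.
rewrite E1 dotpBr dotpZr -E1 in H.
have E2 := sqr_enormB u v; rewrite -/V in E2; rewrite (dotpC v u) in H.
pose D := enorm (u - v) ^+ 2; rewrite -/D in E2.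
have D0 : 0 <= D by exact: sqr_ge0.
have E3 := congr1 (fun t => gamma / 2 * t) E2; rewrite /= in E3.
have H4 : enorm u ^+ 2 <= 2 * D + 2 * V ^+ 2.
  by rewrite -{1}(subrK v u); exact: sqr_enormD_le.
have H5 : r / 2 * enorm (y - ybar) ^+ 2 <= gamma * (r * gamma * (1 + enorm u ^+ 2)).
  have -> : gamma * (r * gamma * (1 + enorm u ^+ 2)) =
      r / 2 * (2 * gamma ^+ 2 + 2 * gamma ^+ 2 * enorm u ^+ 2) by field.
  by rewrite ler_pM2l// divr_gt0.
have H6 : D / 2 <= eta * (K + V) + r * gamma * (1 + enorm u ^+ 2).
  rewrite -(ler_pM2l g0); clear -H H2 H3 H5 E3 P3; lra.
have H7 : r * gamma * (1 + enorm u ^+ 2) <= r * gamma * (1 + (2 * D + 2 * V ^+ 2)).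
  by rewrite ler_pM2l ?mulr_gt0// lerD2l.
have H8 : r * gamma * D <= 8^-1 * D by rewrite ler_wpM2r// ltW.
by rewrite -ltr_sqr ?nnegrE ?(ltW e0)// -/D; clear -H6 H7 H8 etaK g4 D0; lra.
Qed.

End Prox.

(** * Second derivatives of the Lagrangian *)

Section SecondOrder.
Context {R : realType}.
Implicit Types (n p : nat).

(** A differential depends on the whole map, while the formula for the derivative of the Lagrangian
    holds only on [U]; equality of germs must therefore be transferred explicitly. *)
Lemma differentiable_near_eq (V W : normedModType R) (f g : V -> W) (x : V) :
  (\forall y \near x, f y = g y) -> differentiable f x ->
  differentiable g x /\ forall v, 'd g x v = 'd f x v.
Proof.
move=> fg fx; have fgx := nbhs_singleton fg.
have cf : continuous ('d f x) by exact: diff_continuous.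
have gE : g \o shift x = cst (g x) + 'd f x +o_ 0 id.
  apply/eqaddoP => e e0; have /eqaddoP/(_ e e0) := diff_locally fx.
  have fg0 : \forall y \near (0 : V), f (y + x) = g (y + x) by move: fg; rewrite (near_shift 0) /= subr0.
  by apply: filterS2 fg0 => y /= E; rewrite -fgx /= !fctE /= E.
have dg := diff_unique cf gE.
by split=> [|v]; [apply/diff_locallyP; rewrite dg; split|rewrite dg].
Qed.

Lemma dotp_is_linear n (l : 'rV[R]_n) : linear (dotp l : 'rV[R]_n -> R^o).
Proof. by move=> a u v; rewrite dotpDr dotpZr. Qed.

Lemma dotp_continuous n (l : 'rV[R]_n) : continuous (dotp l : 'rV[R]_n -> R^o).
Proof.
move=> x; apply/continuous_normE => e e0; have L0 : 0 < enorm l + 1 by rewrite ltr_wpDl.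
apply/nearE; exists (e / (enorm l + 1)) => [|y]; first by rewrite divr_gt0.
rewrite ltr_pdivlMr// -dotpBr => ye; apply: le_lt_trans (norm_dotp _ _) _.
by have := enorm_ge0 (y - x); move: ye; clear; nra.
Qed.

Lemma diff_dotp n (V : normedModType R) (l : 'rV[R]_n) (f : V -> 'rV[R]_n) x :
  differentiable f x -> differentiable (fun y => dotp l (f y) : R^o) x /\
  forall v, 'd (fun y => dotp l (f y) : R^o) x v = dotp l ('d f x v).
Proof.
move=> fx; pose L := GRing.isLinear.Build _ _ _ _ _ (dotp_is_linear l).
pose C : {linear 'rV[R]_n -> R^o} := HB.pack (dotp l : 'rV[R]_n -> R^o) L.
have cC : continuous C by exact: dotp_continuous.
have dC : differentiable C (f x) by exact: linear_differentiable.
split; first exact: (differentiable_comp fx dC).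
move=> v; have -> : 'd (fun y => dotp l (f y) : R^o) x v = 'd C (f x) ('d f x v).
  exact: (congr1 (@^~ v) (diff_comp fx dC)).
by rewrite (diff_lin _ cC).
Qed.

Lemma diff_add_dotp n (V : normedModType R) (l : 'rV[R]_n) (f : V -> R^o) (h : V -> 'rV[R]_n) x :
  differentiable f x -> differentiable h x ->
  differentiable (fun y => f y + dotp l (h y) : R^o) x /\
  forall v, 'd (fun y => f y + dotp l (h y) : R^o) x v = 'd f x v + dotp l ('d h x v).
Proof.
move=> fx /(diff_dotp l)[hx dh]; split; first exact: differentiableD.
by move=> v; apply: etrans (congr1 (@^~ v) (diffD fx hx)) _; congr (_ + _); exact: dh.
Qed.

Lemma gradient_differentiable n (f : 'rV[R]_n -> R^o) (x : 'rV[R]_n) :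
  (forall v, differentiable (fun y => 'd f y v) x) -> differentiable (gradient f) x.
Proof.
move=> df.
have -> : gradient f = \sum_(i < n) (fun y => 'd f y (delta_mx 0 i) *: (delta_mx 0 i : 'rV[R]_n)).
  apply/funext => y; rewrite fct_sumE [LHS]row_sum_delta.
  by apply: eq_bigr => i _; rewrite mxE.
by apply: differentiable_sum => i; exact: differentiableZl.
Qed.

(** Passes from the matrix [hessian], a Jacobian of the gradient, to iterated directional
    derivatives, on which the estimates are available. *)
Lemma dotp_hessian n (f : 'rV[R]_n -> R^o) (x u v : 'rV[R]_n) :
  (forall v, differentiable (fun y => 'd f y v) x) ->
  dotp (v *m hessian f x) u = 'd (fun y => 'd f y u) x v.
Proof.
move=> df; have [_ dG] := diff_dotp u (gradient_differentiable df).
have E : (fun y => dotp u (gradient f y) : R^o) = (fun y => 'd f y u).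
  by apply/funext => y; exact: etrans (dotpC _ _) (dotp_gradient f y u).
rewrite dotpC /hessian mul_jacobian; apply: etrans (esym (dG v)) _.
exact: (congr1 (fun F : 'rV[R]_n -> R^o => 'd F x v) E).
Qed.

Section Lagrangian.
Context {n p : nat} {U : set 'rV[R]_n} {f : 'rV[R]_n -> R^o} {h : 'rV[R]_n -> 'rV[R]_p}.
Hypotheses (oU : open U) (fC : Ck_on 2 U f) (hC : Ck_on 2 U h).

Let nearU x : U x -> \forall y \near x, U y.
Proof. by move=> Ux; exact: open_nbhs_nbhs. Qed.

Lemma diff_lagrangian l x : U x -> differentiable (lagrangian f h l) x /\
  forall v, 'd (lagrangian f h l) x v = 'd f x v + dotp l ('d h x v).
Proof. by move=> Ux; apply: diff_add_dotp; [exact: fC.1|exact: hC.1]. Qed.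

Lemma second_diff_lagrangian l x u : U x ->
  differentiable (fun y => 'd (lagrangian f h l) y u) x /\
  forall v, 'd (fun y => 'd (lagrangian f h l) y u) x v =
    'd (fun y => 'd f y u) x v + dotp l ('d (fun y => 'd h y u) x v).
Proof.
move=> Ux; have [d1 d2] := diff_add_dotp l ((fC.2 u).1 x Ux) ((hC.2 u).1 x Ux).
have E : \forall y \near x, 'd f y u + dotp l ('d h y u) = 'd (lagrangian f h l) y u.
  by apply: filterS (nearU Ux) => y Uy; have [_ H] := diff_lagrangian l Uy; exact: (esym (H u)).
have [d3 d4] := differentiable_near_eq E d1.
split; first exact: d3.
by move=> v; exact: etrans (d4 v) (d2 v).
Qed.

Lemma Ck_on2_lagrangian l : Ck_on 2 U (lagrangian f h l).
Proof.
split=> [x Ux|u]; first by have [] := diff_lagrangian l Ux.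
split=> [x Ux|v x Ux]; first by have [] := second_diff_lagrangian l u Ux.
apply/continuous_normE => e e0.
have e2 : 0 < e / 2 by rewrite divr_gt0.
have L0 : 0 < enorm l * p%:R + 1 by rewrite ltr_wpDl// mulr_ge0.
have el : 0 < e / 2 / (enorm l * p%:R + 1) by rewrite divr_gt0.
have /continuous_normE/(_ _ e2)/nearP[d1 d10 h1] := (fC.2 u).2 v x Ux.
have /continuous_normE/(_ _ el)/nearP[d2 d20 h2] := (hC.2 u).2 v x Ux.
have /nearP[d3 d30 h3] := nearU Ux.
apply/nearE; exists (Num.min (Num.min d1 d2) d3) => [|y]; first by rewrite !lt_min d10 d20.
rewrite !lt_min => /andP[/andP[/h1 H1 /h2 H2] /h3 Uy].
have [_ /(_ v) Ex] := second_diff_lagrangian l u Ux.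
have [_ /(_ v) Ey] := second_diff_lagrangian l u Uy.
have aux (a b a1 b1 : R) (a2 b2 : 'rV[R]_p) : a = a1 + dotp l a2 -> b = b1 + dotp l b2 ->
    `|a1 - b1| < e / 2 -> `|a2 - b2| < e / 2 / (enorm l * p%:R + 1) -> `|a - b| < e.
  move=> -> -> A B; rewrite ltr_pdivlMr// in B.
  have -> : a1 + dotp l a2 - (b1 + dotp l b2) = (a1 - b1) + dotp l (a2 - b2).
    by rewrite dotpBr; ring.
  apply: le_lt_trans (ler_normD _ _) _.
  have := norm_dotp l (a2 - b2); have := enorm_le_norm (a2 - b2) => C D.
  have : enorm l * enorm (a2 - b2) <= enorm l * (p%:R * `|a2 - b2|) by rewrite ler_wpM2l.
  by have := normr_ge0 (a2 - b2); clear -A B D; lra.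
exact: aux Ey Ex H1 H2.
Qed.

Lemma dotp_hessian_lagrangian l x u v : U x ->
  dotp (v *m hessian (lagrangian f h l) x) u =
    'd (fun y => 'd f y u) x v + dotp l ('d (fun y => 'd h y u) x v).
Proof.
move=> Ux; have [_ <-] := second_diff_lagrangian l u Ux.
by apply: dotp_hessian => w; have [] := second_diff_lagrangian l w Ux.
Qed.

Lemma hessian_lagrangian_sym l x u v : U x ->
  dotp (v *m hessian (lagrangian f h l) x) u = dotp (u *m hessian (lagrangian f h l) x) v.
Proof.
move=> Ux; have D w : differentiable (fun y => 'd (lagrangian f h l) y w) x.
  by have [] := second_diff_lagrangian l w Ux.
apply: etrans (dotp_hessian u v D) _; apply: esym.
apply: etrans (dotp_hessian v u D) _; apply: esym.
exact: (second_diff_sym _ _ oU Ux (Ck_on2_lagrangian l)).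
Qed.

End Lagrangian.

(** Gathers the estimates on [f] near [x] under one constant and one radius. Taylor constants are
    not halved: only the order of the remainders matters. *)
Lemma C2_lipschitz_bounds n (W : normedModType R) (f : 'rV[R]_n -> W) (x : 'rV[R]_n) :
  mean_value_inequality W -> C2_lipschitz_near x f -> exists (U : set 'rV[R]_n) (c r : R),
  [/\ open U, Ck_on 2 U f, 0 < c /\ 0 < r, forall y, enorm (y - x) < r -> U y &
   forall y z : 'rV[R]_n, enorm (y - x) < r -> enorm (z - x) < r ->
   [/\ forall u, `|'d f y u - 'd f z u| <= c * enorm (y - z) * enorm u,
     forall u v, `|'d (fun w => 'd f w u) y v - 'd (fun w => 'd f w u) z v|
        <= c * enorm (y - z) * enorm u * enorm v,
     `|f y - f z - 'd f z (y - z)| <= c * enorm (y - z) ^+ 2 &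
     forall u, `|'d f y u - 'd f z u - 'd (fun w => 'd f w u) z (y - z)|
        <= c * enorm (y - z) ^+ 2 * enorm u]].
Proof.
move=> mvW [U [L [oU Ux fC lip]]].
have [L1 [d [L10 d0 hd]]] := diff_lipschitz mvW oU Ux fC.
have /nearP[d1 d10 hd1] : \forall y \near x, U y by exact: open_nbhs_nbhs.
pose c := L1 + `|L|; pose r := Num.min d d1.
have c0 : 0 < c by rewrite /c ltr_pwDl.
have L1c : L1 <= c by rewrite lerDl.
have Lc : L <= c by rewrite (le_trans (ler_norm L))// lerDr ltW.
have r0 : 0 < r by rewrite lt_min d0.
have rd w : enorm (w - x) < r -> enorm (w - x) < d by rewrite lt_min => /andP[].
have rU w : enorm (w - x) < r -> U w by rewrite lt_min => /andP[_ /hd1].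
exists U, c, r; split=> // y z yr zr.
have P1 (a b : 'rV[R]_n) : enorm (a - x) < r -> enorm (b - x) < r ->
    forall u : 'rV[R]_n, `|'d f a u - 'd f b u| <= c * enorm (a - b) * enorm u.
  move=> ar br u; apply: le_trans (hd a b (rd a ar) (rd b br) u) _.
  by rewrite ler_wpM2r// ler_wpM2r.
have P2 (a b : 'rV[R]_n) : enorm (a - x) < r -> enorm (b - x) < r ->
    forall u v : 'rV[R]_n, `|'d (fun w => 'd f w u) a v - 'd (fun w => 'd f w u) b v|
      <= c * enorm (a - b) * enorm u * enorm v.
  move=> ar br u v; apply: le_trans (lip a b (rU a ar) (rU b br) u v) _.
  apply: le_trans (_ : c * `|a - b| * `|u| * `|v| <= _).
    by rewrite !ler_wpM2r.
  by rewrite !ler_pM ?mulr_ge0 ?(ltW c0)// norm_le_enorm.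
split; [exact: P1|exact: P2| |].
- apply: (taylor1 mvW (ltW c0)) => t t01; have tr := seg_ball t01 yr zr.
  by split; [apply: fC.1; exact: rU|exact: P1].
- move=> u; rewrite mulrAC.
  have cu : 0 <= c * enorm u by rewrite mulr_ge0// ltW.
  apply: (@taylor1 _ n W (fun w : 'rV[R]_n => 'd f w u) y z _ mvW cu).
  move=> t t01; have tr := seg_ball t01 yr zr; split; first by apply: (fC.2 u).1; exact: rU.
  apply: le_trans (P2 _ _ tr zr u _) _.
  by rewrite [c * _ * enorm u]mulrAC.
Qed.

End SecondOrder.

(** * Quadratic convergence of the SQP step *)

Section SQP.
Context {R : realType}.
Implicit Types (n p : nat).

(** A nonzero linear term would win at [s = - A / b] with [b = |B| + 1]. *)
Lemma quadratic_ge0 (A B : R) : (forall s, 0 <= s * A + s ^+ 2 * B) -> A = 0.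
Proof.
move=> H; apply/eqP/negPn/negP => A0.
pose b := `|B| + 1; have b0 : 0 < b by rewrite ltr_wpDl.
have Bb : B < b by rewrite /b ltr_pwDr// ler_norm.
have A20 : 0 < A ^+ 2 by rewrite lt0r sqr_ge0 andbT sqrf_eq0.
have := H (- A / b).
have -> : - A / b * A + (- A / b) ^+ 2 * B = - (A ^+ 2 * (b - B)) / b ^+ 2.
  by field; rewrite gt_eqF.
rewrite mulNr oppr_ge0 pmulr_lle0 ?invr_gt0 ?exprn_gt0// pmulr_rle0//.
by rewrite subr_le0 leNgt Bb.
Qed.

(** Stationarity is expressed on the kernel of [J], so that no multiplier of the quadratic
    subproblem appears. *)
Lemma quadratic_argmin n p (g d : 'rV[R]_n) (J : 'M[R]_(n, p)) (H : 'M[R]_n) (b : 'rV[R]_p) :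
  (forall u v : 'rV[R]_n, dotp (u *m H) v = dotp (v *m H) u) ->
  argmin [set d | b + d *m J = 0] (fun d => dotp g d + 2^-1 * dotp (d *m H) d) d ->
  b + d *m J = 0 /\
  forall tau : 'rV[R]_n, tau *m J = 0 -> dotp g tau + dotp (d *m H) tau = 0.
Proof.
move=> symH [/= dJ dmin]; split=> // tau tJ.
apply: (@quadratic_ge0 _ (2^-1 * dotp (tau *m H) tau)) => s.
have := dmin (d + s *: tau); rewrite mulmxDl -scalemxAl tJ scaler0 addr0 => /(_ dJ).
rewrite mulmxDl -scalemxAl !(dotpDr, dotpDl) !dotpZr !dotpZl (symH tau d).
rewrite -subr_ge0 => H0; apply: le_trans H0 _.
by rewrite le_eqVlt; apply/orP; left; apply/eqP; field.
Qed.

(** The residual of [l] is at most that of [ls], so [(l - ls) *m J^T] is at most twice the latter; a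
    bounded right inverse for [J] bounds [J^T] from below. *)
Lemma multiplier_dist n p (g : 'rV[R]_n) (J : 'M[R]_(n, p)) (l ls : 'rV[R]_p) (K : R) :
  0 <= K -> (forall w, exists2 u : 'rV[R]_n, u *m J = w & enorm u <= K * enorm w) ->
  enorm (g + l *m J^T) <= enorm (g + ls *m J^T) ->
  enorm (l - ls) <= 2 * K * enorm (g + ls *m J^T).
Proof.
move=> K0 hK lmin.
have H1 : enorm ((l - ls) *m J^T) <= 2 * enorm (g + ls *m J^T).
  have -> : (l - ls) *m J^T = (g + l *m J^T) - (g + ls *m J^T).
    by rewrite mulmxBl opprD addrACA subrr add0r.
  by apply: le_trans (enormB _ _) _; move: lmin; clear; lra.
have [u uJ uK] := hK (l - ls).
have H2 : enorm (l - ls) ^+ 2 <= 2 * enorm (g + ls *m J^T) * (K * enorm (l - ls)).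
  rewrite sqr_enorm -{2}uJ -dotp_mulmx_tr; apply: le_trans (dotp_le _ _) _.
  by rewrite ler_pM.
have [->|/enorm_gt0 l0] := eqVneq (l - ls) 0; first by rewrite enorm0 !mulr_ge0.
rewrite expr2 in H2; rewrite -(ler_pM2r l0); apply: le_trans H2 _.
by rewrite le_eqVlt; apply/orP; left; apply/eqP; ring.
Qed.

(** A vector of [ker J] is moved into [ker Js] by a correction [nu] of relative size [k]; with
    [k <= 1/16] and [C k <= eta / 24] the losses leave at least [eta / 2]. *)
Lemma coercive_perturb n p (Hs : 'M[R]_n) (Js : 'M[R]_(n, p)) (eta : R) :
  0 < eta -> row_full Js ->
  (forall tau : 'rV[R]_n, tau *m Js = 0 -> eta * enorm tau ^+ 2 <= dotp (tau *m Hs) tau) ->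
  exists2 delta : R, 0 < delta & forall (H : 'M[R]_n) (J : 'M[R]_(n, p)),
    (forall v : 'rV[R]_n, enorm (v *m H - v *m Hs) <= delta * enorm v) ->
    (forall v : 'rV[R]_n, enorm (v *m J - v *m Js) <= delta * enorm v) ->
    forall tau : 'rV[R]_n, tau *m J = 0 -> eta / 2 * enorm tau ^+ 2 <= dotp (tau *m H) tau.
Proof.
move=> eta0 rJ coer; have [C C0 hC] := mulmx_bounded Hs.
have [K [e1 [K0 e10 hK]]] := stable_right_inverse rJ.
have {}hK w : exists2 u, u *m Js = w & enorm u <= K * enorm w.
  by apply: hK => v; rewrite subrr enorm0 mulr_ge0// ltW.
pose k := Num.min 16^-1 (eta / (24 * C)).
have C24 : 0 < 24 * C by rewrite mulr_gt0.
have k0 : 0 < k by rewrite lt_min invr_gt0 ltr0n/= divr_gt0.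
have k16 : k <= 16^-1 by rewrite ge_min lexx.
have kC : C * k <= eta / 24.
  have : k <= eta / (24 * C) by rewrite ge_min lexx orbT.
  by rewrite ler_pdivlMr ?mulr_gt0//; clear; lra.
exists (Num.min (k / K) (eta / 8)) => [|H J hH hJ tau tJ]; first by rewrite lt_min !divr_gt0.
pose t := enorm tau; have t0 : 0 <= t by exact: enorm_ge0.
have h1 : enorm (tau *m Js) <= k / K * t.
  have := hJ tau; rewrite tJ sub0r enormN => h; apply: le_trans h _.
  by rewrite ler_wpM2r// ge_min lexx.
have h2 : enorm (tau *m H - tau *m Hs) <= eta / 8 * t.
  by apply: le_trans (hH tau) _; rewrite ler_wpM2r// ge_min lexx orbT.
have [nu nJ nK] := hK (tau *m Js).
have {nK}nk : enorm nu <= k * t.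
  apply: le_trans nK _; apply: le_trans (ler_wpM2l (ltW K0) h1) _.
  by rewrite le_eqVlt; apply/orP; left; apply/eqP; field; rewrite gt_eqF.
have c0 : (tau - nu) *m Js = 0 by rewrite mulmxBl nJ subrr.
have {c0}c0 := coer _ c0.
have n1 : t - k * t <= enorm (tau - nu) by have := enorm_lb tau nu; rewrite -/t; move: nk; clear; lra.
have n2 : enorm (tau - nu) <= 2 * t.
  by have := enormB tau nu; rewrite -/t; have := ler_wpM2r t0 k16; move: nk t0; clear; lra.
have kt : k * t <= 16^-1 * t by rewrite ler_wpM2r.
have d1 : dotp (tau *m Hs) tau = dotp ((tau - nu) *m Hs) (tau - nu)
    + dotp (nu *m Hs) tau + dotp ((tau - nu) *m Hs) nu.
  by rewrite mulmxBl !(dotpBl, dotpBr); ring.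
have b1 : - (C * (k * t) * t) <= dotp (nu *m Hs) tau.
  have := norm_dotp (nu *m Hs) tau; rewrite ler_norml -/t => /andP[h _].
  apply: le_trans h; rewrite lerN2 ler_wpM2r//; apply: le_trans (hC _) _.
  by rewrite ler_pM2l.
have b2 : - (C * (2 * t) * (k * t)) <= dotp ((tau - nu) *m Hs) nu.
  have := norm_dotp ((tau - nu) *m Hs) nu; rewrite ler_norml => /andP[h _].
  apply: le_trans h; rewrite lerN2; apply: ler_pM => //.
  by apply: le_trans (hC _) _; rewrite ler_pM2l.
have b3 : - (eta / 8 * t * t) <= dotp (tau *m H - tau *m Hs) tau.
  have := norm_dotp (tau *m H - tau *m Hs) tau; rewrite ler_norml -/t => /andP[h _].
  by apply: le_trans h; rewrite lerN2 ler_wpM2r.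
have b4 : eta * (15 / 16 * t) ^+ 2 <= eta * enorm (tau - nu) ^+ 2.
  have t15 : 0 <= 15 / 16 * t by rewrite mulr_ge0// divr_ge0.
  rewrite ler_pM2l// ler_sqr ?nnegrE//.
  by move: n1 kt; clear; lra.
have b5 : C * k * t ^+ 2 <= eta / 24 * t ^+ 2 by rewrite ler_wpM2r ?sqr_ge0.
have b6 : 0 <= eta * t ^+ 2 by rewrite mulr_ge0 ?sqr_ge0 ?ltW.
rewrite dotpBl in b3; rewrite -/t.
by move: c0 d1 b1 b2 b3 b4 b5 b6; clear; lra.
Qed.

(** Error equation of Newton's method, with [e0] the current error and [b] the constraint value. The
    new error splits as [tau + nu]: [nu] repairs the linearized constraint and is quadratic in [e0],
    while stationarity tested on [tau] and coercivity control [tau]. *)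
Lemma sqp_core n p (G Gs e0 d : 'rV[R]_n) (J Js : 'M[R]_(n, p)) (H : 'M[R]_n)
    (l ls b : 'rV[R]_p) (c1 c2 c3 c4 cH K eta : R) :
  0 <= c3 -> 0 <= K -> 0 < eta -> 0 <= cH ->
  enorm (b - e0 *m J) <= c1 * enorm e0 ^+ 2 ->
  enorm (Gs + l *m Js^T - (G + l *m J^T) + e0 *m H) <= c2 * enorm e0 ^+ 2 ->
  Gs + ls *m Js^T = 0 ->
  (forall v : 'rV[R]_n, enorm (v *m J - v *m Js) <= c3 * enorm e0 * enorm v) ->
  enorm (l - ls) <= c4 * enorm e0 ->
  (forall tau : 'rV[R]_n, tau *m J = 0 -> eta * enorm tau ^+ 2 <= dotp (tau *m H) tau) ->
  (forall w, exists2 u : 'rV[R]_n, u *m J = w & enorm u <= K * enorm w) ->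
  (forall v : 'rV[R]_n, enorm (v *m H) <= cH * enorm v) ->
  b + d *m J = 0 ->
  (forall tau : 'rV[R]_n, tau *m J = 0 -> dotp G tau + dotp (d *m H) tau = 0) ->
  enorm (e0 + d) <= ((c2 + c3 * c4 + cH * (K * c1)) / eta + K * c1) * enorm e0 ^+ 2.
Proof.
move=> c30 K0 eta0 cH0 A1 A2 A3 A4 A5 A6 A7 A9 dJ dH.
pose e := e0 + d; pose D := enorm e0; have D0 : 0 <= D by exact: enorm_ge0.
have eJ : enorm (e *m J) <= c1 * D ^+ 2.
  rewrite /e mulmxDl; have -> : d *m J = - b by apply/eqP; rewrite -addr_eq0 addrC dJ.
  by rewrite enormBC.
have [nu nJ nK] := A7 (e *m J).
have nk : enorm nu <= K * c1 * D ^+ 2.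
  by apply: le_trans nK _; rewrite -mulrA ler_wpM2l.
have [tau tauE] : exists tau, tau = e - nu by exists (e - nu).
have tJ : tau *m J = 0 by rewrite tauE mulmxBl nJ subrr.
have B1 : dotp (e *m H) tau <= (c2 + c3 * c4) * D ^+ 2 * enorm tau.
  have E1 : dotp (e *m H) tau = dotp (Gs + l *m Js^T - (G + l *m J^T) + e0 *m H) tau
      + dotp (l - ls) (tau *m J - tau *m Js).
    have E : dotp (Gs + ls *m Js^T) tau = 0 by rewrite A3 dot0p.
    have := dH tau tJ; rewrite /e mulmxDl !(dotpDl, dotpNl, dotpBr, dotp_mulmx_tr) tJ !dotp0.
    by rewrite dotpDl dotp_mulmx_tr in E; move: E; clear; lra.
  have h1 := dotp_le (Gs + l *m Js^T - (G + l *m J^T) + e0 *m H) tau.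
  have h2 := dotp_le (l - ls) (tau *m J - tau *m Js).
  have h3 : enorm (Gs + l *m Js^T - (G + l *m J^T) + e0 *m H) * enorm tau <= c2 * D ^+ 2 * enorm tau.
    by rewrite ler_wpM2r.
  have h4 : enorm (l - ls) * enorm (tau *m J - tau *m Js) <= c4 * D * (c3 * D * enorm tau).
    by rewrite ler_pM.
  by rewrite E1; move: h1 h2 h3 h4; clear; lra.
have B2 : - dotp (nu *m H) tau <= cH * (K * c1) * D ^+ 2 * enorm tau.
  rewrite -dotpNl; apply: le_trans (dotp_le _ _) _; rewrite enormN ler_wpM2r//.
  by apply: le_trans (A9 _) _; rewrite -mulrA ler_wpM2l.
have B3 := A6 tau tJ.
have B4 : dotp (tau *m H) tau = dotp (e *m H) tau - dotp (nu *m H) tau.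
  by rewrite -dotpBl -mulmxBl -tauE.
have B5 : eta * enorm tau <= (c2 + c3 * c4 + cH * (K * c1)) * D ^+ 2.
  have [t0|/enorm_gt0 t0] := eqVneq tau 0.
    have : 0 <= c2 * D ^+ 2 by exact: le_trans A2.
    have : 0 <= c4 * D by exact: le_trans A5.
    have : 0 <= c1 * D ^+ 2 by exact: le_trans A1.
    move=> p1 p2 p3; rewrite t0 enorm0 mulr0.
    have p4 : 0 <= c3 * D * (c4 * D) by rewrite mulr_ge0// mulr_ge0.
    have p5 : 0 <= cH * (K * (c1 * D ^+ 2)) by rewrite mulr_ge0// mulr_ge0.
    by move: p3 p4 p5; clear; lra.
  rewrite -(ler_pM2r t0) -mulrA -expr2.
  by move: B1 B2 B3 B4; clear; lra.
have E : e = tau + nu by rewrite tauE subrK.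
rewrite -/e E; apply: le_trans (enormD _ _) _; rewrite mulrDl lerD//.
by rewrite mulrAC ler_pdivlMr// mulrC.
Qed.

(** [gl] stands for the gradient of the Lagrangian, [Hs] for its Hessian. Growth is tested at points
    of [M] close to [xs + s tau]; half of [eta] absorbs the remainder of [gl], and the slack [w]
    covers the distance to [tau] of the rescaled displacement [u]. *)
Lemma coercive_of_growth n p (M : set 'rV[R]_n) (xs : 'rV[R]_n) (h : 'rV[R]_n -> 'rV[R]_p) A
    (Hs : 'M[R]_n) (gl : 'rV[R]_n -> 'rV[R]_n) (eta c r : R) :
  chart M xs h A -> 0 < eta -> 0 <= c -> 0 < r ->
  (forall x, enorm (x - xs) < r -> enorm (gl x - (x - xs) *m Hs) <= c * enorm (x - xs) ^+ 2) ->
  (forall q, M q -> enorm (q - xs) < r -> exists2 t : R, 0 <= t <= 1 &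
    eta * enorm (q - xs) ^+ 2 <= dotp (gl (xs + t *: (q - xs))) (q - xs)) ->
  forall tau : 'rV[R]_n, tau *m A = 0 -> eta / 2 * enorm tau ^+ 2 <= dotp (tau *m Hs) tau.
Proof.
move=> cM eta0 c0 r0 gH gr tau tA; apply/ler_addgt0Pl => w w0.
have [C C0 hC] := mulmx_bounded Hs.
pose T := enorm tau; have T0 : 0 <= T by exact: enorm_ge0.
have T1 : 0 < T + 1 by rewrite ltr_wpDl.
pose Q := (C + eta) * (2 * T + 1).
have T21 : 0 < 2 * T + 1 by rewrite ltr_wpDl// mulr_ge0.
have Q0 : 0 < Q by rewrite mulr_gt0// addr_gt0.
pose eps := Num.min 1 (w / Q).
have eps0 : 0 < eps by rewrite lt_min ltr01 divr_gt0.
have eps1 : eps <= 1 by rewrite ge_min lexx.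
have epsQ : eps * Q <= w by rewrite -ler_pdivlMr// ge_min lexx orbT.
have [d1 d10 hd1] := tangent_curve cM tA eps0.
have [d2 d20 hd2] := small_scale (ltW T1) r0.
have cT : 0 <= c * (T + 1) by rewrite mulr_ge0// ltW.
have e2 : 0 < eta / 2 by rewrite divr_gt0.
have [d3 d30 hd3] := small_scale cT e2.
pose s := Num.min (d1 / 2) (Num.min d2 d3).
have s0 : 0 < s by rewrite !lt_min d20 d30 divr_gt0.
have [s1 s2 s3] : [/\ s < d1, s <= d2 & s <= d3].
  rewrite /s !ge_min !lexx !orbT; split=> //; rewrite gt_min.
  by apply/orP; left; move: d10; clear; lra.
have [|q Mq qs] := hd1 s; first by rewrite s0.
have [a aq] : exists a, a = q - xs by exists (q - xs).
have aE : a = (q - (xs + s *: tau)) + s *: tau by rewrite aq opprD addrA subrK.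
have aT : enorm a <= (T + 1) * s.
  rewrite aE; apply: le_trans (enormD _ _) _; rewrite enormZ gtr0_norm// -/T.
  by have := ler_wpM2r (ltW s0) eps1; move: qs; clear; lra.
have ar : enorm a < r by apply: le_lt_trans aT _; exact: hd2.
have ca : c * enorm a <= eta / 2.
  by apply: le_trans (ltW (hd3 s s0 s3)); rewrite -mulrA ler_wpM2l.
rewrite aq in ar; have [t /andP[t0 t1]] := gr q Mq ar; rewrite -aq in ar * => grt.
have ta : xs + t *: a - xs = t *: a by rewrite addrAC subrr add0r.
have tae : enorm (t *: a) <= enorm a by rewrite enormZ ger0_norm// ler_piMl.
have := gH (xs + t *: a); rewrite ta => /(_ (le_lt_trans tae ar)).
set z := gl _ in grt *; move=> zH.
have X1 : eta / 2 * enorm a ^+ 2 <= t * dotp (a *m Hs) a.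
  have h1 := dotp_le (z - t *: a *m Hs) a.
  have h2 : enorm (z - t *: a *m Hs) * enorm a <= c * enorm a ^+ 2 * enorm a.
    rewrite ler_wpM2r//; apply: le_trans zH _; rewrite ler_wpM2l// ler_sqr ?nnegrE//.
  have h3 : c * enorm a * enorm a ^+ 2 <= eta / 2 * enorm a ^+ 2 by rewrite ler_wpM2r ?sqr_ge0.
  rewrite -scalemxAl in h1 h2; rewrite dotpBl dotpZl in h1.
  by move: grt h1 h2 h3; clear; lra.
(* The intermediate [t] may be small, which is harmless: a negative form would force [a = 0], and a
   nonnegative one only grows when [t <= 1] is dropped. *)
have X2 : eta / 2 * enorm a ^+ 2 <= dotp (a *m Hs) a.
  have [X0|X0] := leP 0 (dotp (a *m Hs) a).
    by apply: le_trans X1 _; rewrite ler_piMl.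
  have : eta / 2 * enorm a ^+ 2 <= 0.
    by apply: le_trans X1 _; rewrite mulr_ge0_le0// ltW.
  rewrite pmulr_rle0// => a0.
  have : enorm a ^+ 2 = 0 by apply/eqP; rewrite eq_le a0 sqr_ge0.
  move/eqP; rewrite sqrf_eq0 => /eqP/enorm_eq0 aa.
  by rewrite aa dotp0 ltxx in X0.
pose u := s^-1 *: a.
have su : a = s *: u by rewrite /u scalerA mulfV ?gt_eqF// scale1r.
have X3 : eta / 2 * enorm u ^+ 2 <= dotp (u *m Hs) u.
  rewrite -(@ler_pM2l _ (s ^+ 2)) ?exprn_gt0//.
  move: X2; rewrite su enormZ gtr0_norm// -scalemxAl dotpZl dotpZr exprMn.
  by clear; lra.
have ut : enorm (u - tau) <= eps.
  rewrite -(ler_pM2l s0) -{1}(gtr0_norm s0) -enormZ scalerBr -su.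
  by rewrite aE addrK mulrC.
have u1 : enorm u <= T + 1.
  by have := enorm_lb u tau; rewrite -/T; move: ut eps1; clear; lra.
have X4 : dotp (u *m Hs) u <= dotp (tau *m Hs) tau + C * eps * (2 * T + 1).
  have -> : dotp (u *m Hs) u = dotp (tau *m Hs) tau + (dotp ((u - tau) *m Hs) u + dotp (tau *m Hs) (u - tau)).
    by rewrite mulmxBl !(dotpBl, dotpBr); ring.
  rewrite lerD2l.
  have h1 := dotp_le ((u - tau) *m Hs) u; have h2 := dotp_le (tau *m Hs) (u - tau).
  have h3 : enorm ((u - tau) *m Hs) * enorm u <= C * eps * (T + 1).
    by rewrite ler_pM//; apply: le_trans (hC _) _; rewrite ler_pM2l.
  have h4 : enorm (tau *m Hs) * enorm (u - tau) <= C * T * eps by rewrite ler_pM// hC.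
  by move: h1 h2 h3 h4; clear; lra.
have X5 : T ^+ 2 <= enorm u ^+ 2 + eps * (2 * T + 1).
  have h1 : T - enorm u <= eps.
    by have := enorm_lb tau u; rewrite -/T (enormBC tau); move: ut; clear; lra.
  have h2 := enorm_ge0 u.
  have h3 : (T - enorm u) * (T + enorm u) <= eps * (T + enorm u).
    by rewrite ler_wpM2r// addr_ge0.
  have h4 : eps * (T + enorm u) <= eps * (2 * T + 1).
    by rewrite ler_pM2l//; move: u1; clear; lra.
  by move: h3 h4; clear; lra.
have X6 : eta / 2 * T ^+ 2 <= eta / 2 * (enorm u ^+ 2 + eps * (2 * T + 1)) by rewrite ler_pM2l.
rewrite -/T; rewrite /Q in epsQ.
have X7 : 0 <= eta * eps * (2 * T + 1) by rewrite mulr_ge0 ?(ltW T21)// mulr_ge0// ltW.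
by move: X3 X4 X6 X7 epsQ; clear; lra.
Qed.

(** [G], [J] and [H] are arbitrary maps linked by estimates, so that no differential occurs. The
    bounds involve [enorm l] because the multiplier is controlled only inside the proof. *)
Lemma sqp_abstract n p (G : 'rV[R]_n -> 'rV[R]_n) (J : 'rV[R]_n -> 'M[R]_(n, p))
    (H : 'rV[R]_p -> 'rV[R]_n -> 'M[R]_n) (h : 'rV[R]_n -> 'rV[R]_p) (xs : 'rV[R]_n)
    (ls : 'rV[R]_p) (c r eta : R) :
  0 < c -> 0 < r -> 0 < eta -> row_full (J xs) -> G xs + ls *m (J xs)^T = 0 ->
  (forall tau : 'rV[R]_n, tau *m J xs = 0 -> eta * enorm tau ^+ 2 <= dotp (tau *m H ls xs) tau) ->
  (forall x, enorm (x - xs) < r ->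
   [/\ enorm (h x - (x - xs) *m J x) <= c * enorm (x - xs) ^+ 2 /\
       enorm (G x - G xs) <= c * enorm (x - xs),
     forall l, enorm (G xs + l *m (J xs)^T - (G x + l *m (J x)^T) + (x - xs) *m H l x)
       <= c * (1 + enorm l) * enorm (x - xs) ^+ 2,
     forall v : 'rV[R]_n, enorm (v *m J x - v *m J xs) <= c * enorm (x - xs) * enorm v,
     forall l (v : 'rV[R]_n), enorm (v *m H l x - v *m H ls xs) <=
        c * (enorm (x - xs) * (1 + enorm l) + enorm (l - ls)) * enorm v &
     forall l (u v : 'rV[R]_n), dotp (u *m H l x) v = dotp (v *m H l x) u]) ->
  exists C rho : R, [/\ 0 < C, 0 < rho & forall x d l, enorm (x - xs) < rho ->
    (forall l', enorm (G x + l *m (J x)^T) <= enorm (G x + l' *m (J x)^T)) ->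
    argmin [set d | h x + d *m J x = 0] (fun d => dotp (G x) d + 2^-1 * dotp (d *m H l x) d) d ->
    enorm (x + d - xs) <= C * enorm (x - xs) ^+ 2].
Proof.
move=> c0 r0 eta0 rJ gl0 coer hyp.
have [K [e1 [K0 e10 hK]]] := stable_right_inverse rJ.
have [delta delta0 hdelta] := coercive_perturb eta0 rJ coer.
have [CH CH0 hCH] := mulmx_bounded (H ls xs).
pose a := enorm ls; have a0 : 0 <= a by exact: enorm_ge0.
(* [c4] is the first-order constant of the multiplier, [c5] bounds [1 + enorm l] within radius 1,
   and [c6] controls the variation of the Hessian in [x] and [l] together. *)
pose c4 := 2 * K * (c * (1 + a)).
have c40 : 0 <= c4 by rewrite !mulr_ge0 ?(ltW K0) ?(ltW c0)// addr_ge0.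
pose c5 := 1 + a + c4; have c50 : 0 <= c5 by rewrite !addr_ge0.
pose c6 := c * (c5 + c4); have c60 : 0 <= c6 by rewrite mulr_ge0 ?addr_ge0// ltW.
have [d1 d10 hd1] := small_scale (ltW c0) e10.
have [d2 d20 hd2] := small_scale (ltW c0) delta0.
have [d3 d30 hd3] := small_scale c60 delta0.
pose C := ((c * c5 + c * c4 + (CH + delta) * (K * c)) / (eta / 2) + K * c).
have C0 : 0 < C.
  have p1 : 0 <= c * c5 by rewrite mulr_ge0// ltW.
  have p2 : 0 <= c * c4 by rewrite mulr_ge0// ltW.
  have p3 : 0 < (CH + delta) * (K * c) by rewrite mulr_gt0 ?mulr_gt0// addr_gt0.
  rewrite /C addr_gt0 ?(mulr_gt0 K0 c0)// divr_gt0// ?divr_gt0//.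
  by move: p1 p2 p3; clear; lra.
exists C, (Num.min (Num.min r 1) (Num.min d1 (Num.min d2 d3))); split=> //.
  by rewrite !lt_min r0 ltr01 d10 d20.
move=> x d l; rewrite !lt_min; set D := enorm (x - xs).
move=> /andP[/andP[xr x1] /andP[xd1 /andP[xd2 xd3]]] lmin dmin.
have [[B1 B4] B2 B3 B5 B6] := hyp x xr.
have D0 : 0 <= D by exact: enorm_ge0.
have {}x1 := ltW x1.
(* The radii were obtained for positive scales only; this adds the case [D = 0]. *)
have small (k e d0 : R) : 0 <= k -> 0 < e -> (forall s, 0 < s -> s <= d0 -> k * s < e) ->
    D < d0 -> k * D <= e.
  move=> k0 e0 hs Dd; have [->|Dn0] := eqVneq D 0; first by rewrite mulr0 ltW.
  by apply/ltW/hs; rewrite ?ltW// lt0r Dn0.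
have s1 := small _ _ _ (ltW c0) e10 hd1 xd1.
have s2 := small _ _ _ (ltW c0) delta0 hd2 xd2.
have s3 := small _ _ _ c60 delta0 hd3 xd3.
have hKx : forall w, exists2 u : 'rV[R]_n, u *m J x = w & enorm u <= K * enorm w.
  by apply: hK => v; apply: le_trans (B3 v) _; rewrite ler_wpM2r.
have lls : enorm (l - ls) <= c4 * D.
  apply: le_trans (multiplier_dist (ltW K0) hKx (lmin ls)) _.
  rewrite /c4 -[leRHS]mulrA ler_wpM2l ?mulr_ge0 ?(ltW K0)//.
  have -> : G x + ls *m (J x)^T = (G x - G xs) + (ls *m (J x)^T - ls *m (J xs)^T).
    by rewrite addrACA -opprD gl0 subr0.
  apply: le_trans (enormD _ _) _.
  have := mulmx_tr_dist ls _ B3; rewrite -/D -/a => /(_ _) h1.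
  have h2 : 0 <= c * D by rewrite mulr_ge0// ltW.
  by have := h1 h2; move: B4; rewrite -/D; clear; lra.
have l1 : 1 + enorm l <= c5.
  have := enorm_lb l ls; rewrite -/a /c5.
  have : c4 * D <= c4 * 1 by rewrite ler_wpM2l.
  by move: lls; clear; lra.
have Hclose (v : 'rV[R]_n) : enorm (v *m H l x - v *m H ls xs) <= c6 * D * enorm v.
  apply: le_trans (B5 l v) _; rewrite ler_wpM2r// /c6 -mulrA ler_pM2l// -/D mulrDl lerD//.
  by rewrite mulrC ler_wpM2r.
have Hd (v : 'rV[R]_n) : enorm (v *m H l x - v *m H ls xs) <= delta * enorm v.
  by apply: le_trans (Hclose v) _; rewrite ler_wpM2r.
have Jd (v : 'rV[R]_n) : enorm (v *m J x - v *m J xs) <= delta * enorm v.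
  by apply: le_trans (B3 v) _; rewrite ler_wpM2r.
have coerx := hdelta _ _ Hd Jd.
have Hb (v : 'rV[R]_n) : enorm (v *m H l x) <= (CH + delta) * enorm v.
  rewrite -(subrK (v *m H ls xs) (v *m H l x)); apply: le_trans (enormD _ _) _.
  by rewrite mulrDl addrC lerD// hCH.
have [dJ dH] := quadratic_argmin (B6 l) dmin.
have B2' : enorm (G xs + l *m (J xs)^T - (G x + l *m (J x)^T) + (x - xs) *m H l x) <= c * c5 * D ^+ 2.
  by apply: le_trans (B2 l) _; rewrite -/D ler_wpM2r ?sqr_ge0// ler_pM2l.
have eta2 : 0 < eta / 2 by rewrite divr_gt0.
have CHd : 0 <= CH + delta by rewrite addr_ge0// ltW.
have := sqp_core (ltW c0) (ltW K0) eta2 CHd B1 B2' gl0 B3 lls coerx hKx Hb dJ dH.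
by rewrite addrAC.
Qed.

End SQP.

(** * Quadratic convergence for data with Lipschitz second derivatives *)

Section SQPStep.
Context {R : realType}.
Implicit Types (n p : nat).

Lemma enorm_le_dotp n (a : 'rV[R]_n) (k : R) : 0 <= k ->
  (forall u, dotp a u <= k * enorm u) -> enorm a <= k.
Proof.
move=> k0 /(_ a); rewrite -sqr_enorm expr2.
by have [->|/enorm_gt0 a0] := eqVneq a 0; [rewrite enorm0|rewrite ler_pM2r].
Qed.

Lemma multiplier_sum n p (h : 'rV[R]_n -> 'rV[R]_p) (x : 'rV[R]_n) (l : 'rV[R]_p) :
  differentiable h x ->
  \sum_(i < p) l 0 i *: gradient (fun z => h z 0 i) x = l *m ('J h x)^T.
Proof.
move=> dh; apply/rowP => j; rewrite -!dotp_delta dotp_suml.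
apply: esym; apply: etrans (dotp_mulJT h x l _) _; apply: eq_bigr => i _.
rewrite dotpZl; congr (_ * _); apply: esym; apply: etrans (dotp_gradient _ _ _) _.
by have [_] := diff_coord i dh; exact.
Qed.

Lemma dotp_diff_le p (l b : 'rV[R]_p) (B : R) : `|b| <= B ->
  `|dotp l b| <= enorm l * (p%:R * B).
Proof.
move=> bB; apply: le_trans (norm_dotp _ _) _; rewrite ler_wpM2l//.
by apply: le_trans (enorm_le_norm _) _; rewrite ler_wpM2l.
Qed.

(** Each coordinate of the second derivative of [h] is the Hessian form of a Lagrangian with zero
    objective and a basis vector as multiplier, so the bound for matrices applies. *)
Lemma second_diff_bounded n p (U : set 'rV[R]_n) (h : 'rV[R]_n -> 'rV[R]_p) (x : 'rV[R]_n) :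
  open U -> U x -> Ck_on 2 U h -> exists2 B : R, 0 < B &
    forall u v, enorm ('d (fun w => 'd h w u) x v) <= B * enorm u * enorm v.
Proof.
move=> oU Ux hC; pose f : 'rV[R]_n -> R^o := cst 0.
have fC : Ck_on 2 U f.
  have d0 (y v : 'rV[R]_n) : 'd f y v = 0 by rewrite /f diff_cst.
  have E v : (fun y => 'd f y v) = cst 0 :> ('rV[R]_n -> R^o) by apply/funext => y; exact: d0.
  split=> [y _|v]; first exact: differentiable_cst.
  rewrite E; split=> [y _|w y _]; first exact: differentiable_cst.
  have -> : (fun y => 'd (cst 0 : 'rV[R]_n -> R^o) y w) = cst 0 by apply/funext => z; rewrite diff_cst.
  exact: cst_continuous.
pose l i : 'rV[R]_p := delta_mx 0 i.
have /choice[K hK] : forall i, exists K : R, 0 < K /\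
    forall v, enorm (v *m hessian (lagrangian f h (l i)) x) <= K * enorm v.
  by move=> i; have [K K0 hK] := mulmx_bounded (hessian (lagrangian f h (l i)) x); exists K.
pose S := \sum_i K i; have S0 : 0 <= S by apply: sumr_ge0 => i _; have [/ltW] := hK i.
exists (p%:R * S + 1) => [|u v]; first by rewrite ltr_wpDl// mulr_ge0.
set b := 'd _ x v.
have bi i : `|b 0 i| <= S * enorm u * enorm v.
  have E : dotp (v *m hessian (lagrangian f h (l i)) x) u = b 0 i.
    apply: etrans (dotp_hessian_lagrangian oU fC hC (l i) u v Ux) _.
    rewrite [dotp (l i) _]dotpC dotp_delta -/b.
    have -> : (fun y => 'd f y u) = cst 0 :> ('rV[R]_n -> R^o).
      by apply/funext => y; rewrite /f diff_cst.
    by rewrite diff_cst add0r.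
  rewrite -E; apply: le_trans (norm_dotp _ _) _.
  have [Ki0 Ki] := hK i; rewrite mulrAC ler_wpM2r//; apply: le_trans (Ki v) _.
  rewrite ler_wpM2r// /S (bigD1 i)//= lerDl sumr_ge0// => j _.
  by have [/ltW] := hK j.
have b0 : 0 <= S * enorm u * enorm v by rewrite !mulr_ge0.
have := ler_wpM2l (ler0n R p) (norm_le_coord b0 bi).
have := enorm_le_norm b; have : 0 <= enorm u * enorm v by rewrite mulr_ge0.
by move: (enorm b) (`|b|); clear; move=> x y; lra.
Qed.

Lemma sqp_quadratic n p (F : 'rV[R]_n -> \bar R) (f : 'rV[R]_n -> R^o)
    (h : 'rV[R]_n -> 'rV[R]_p) (xs : 'rV[R]_n) :
  C2_lipschitz_near xs f -> C2_lipschitz_near xs h -> row_full ('J h xs) -> h xs = 0 ->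
  (\forall x \near xs, h x = 0 -> F x = (f x)%:E) -> strong_minimizer F xs ->
  exists C rho : R, [/\ 0 < C, 0 < rho & forall x d, enorm (x - xs) < rho ->
    sqp_step f h x d -> enorm (x + d - xs) <= C * enorm (x - xs) ^+ 2].
Proof.
move=> fL hL rJ h0 Ff [eta [e1 [eta0 e10 smin]]].
have [Uf [cf [rf [oUf fC [cf0 rf0] fU fB]]]] := C2_lipschitz_bounds (@mean_value_ineq_real R) fL.
have [Uh [ch [rh [oUh hC [ch0 rh0] hU hB]]]] := C2_lipschitz_bounds (@mean_value_ineq_row R p) hL.
pose U := Uf `&` Uh; have oU : open U by exact: openI.
have CkU (W : normedModType R) k (A B : set 'rV[R]_n) (phi : 'rV[R]_n -> W) :
    B `<=` A -> Ck_on k A phi -> Ck_on k B phi.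
  move=> BA; elim: k phi => [|k IH] phi /=; first by move=> H x /BA/H.
  by move=> [H1 H2]; split=> [x /BA/H1//|v]; exact: IH.
have fCU : Ck_on 2 U f by apply: CkU fC => x [].
have hCU : Ck_on 2 U h by apply: CkU hC => x [].
pose r0 := Num.min rf rh.
have r00 : 0 < r0 by rewrite lt_min rf0.
have xs0 t : 0 < t -> enorm (xs - xs) < t by rewrite subrr enorm0.
have inU x : enorm (x - xs) < r0 -> U x by rewrite lt_min => /andP[/fU ? /hU ?]; split.
have nf w : enorm (w - xs) < r0 -> enorm (w - xs) < rf by rewrite lt_min => /andP[].
have nh w : enorm (w - xs) < r0 -> enorm (w - xs) < rh by rewrite lt_min => /andP[].
pose P : R := p%:R; have P0 : 0 <= P by [].
pose k := P * ch; have k0 : 0 <= k by rewrite mulr_ge0// ltW.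
have cf0' := ltW cf0; have ch0' := ltW ch0.
have [B B0 hB2] := second_diff_bounded oUh (hU xs (xs0 _ rh0)) hC.
(* Kept opaque, as unifying differentials at distinct points is intractable. *)
have [G GE] : exists G, G = gradient f by exists (gradient f).
have [J JE] : exists J, J = jacobian h by exists (jacobian h).
have [H HE] : exists H, H = fun l x => hessian (lagrangian f h l) x.
  by exists (fun l x => hessian (lagrangian f h l) x).
have dG y u : dotp (G y) u = 'd f y u by rewrite GE dotp_gradient.
have dJ l y u : dotp (l *m (J y)^T) u = dotp l ('d h y u) by rewrite JE dotp_mulJT.
have dH l y u v : U y -> dotp (v *m H l y) u =
    'd (fun w => 'd f w u) y v + dotp l ('d (fun w => 'd h w u) y v).
  by move=> Uy; rewrite HE; exact: (dotp_hessian_lagrangian oU fCU hCU l u v Uy).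
rewrite -JE in rJ.
have arith (q L X : R) : 0 <= q -> 0 <= L -> 0 <= X ->
    q * X + L * (k * X) <= (q + k) * (1 + L) * X.
  move=> q0 L0 X0; have : 0 <= q * L * X by rewrite !mulr_ge0.
  have : 0 <= k * X by rewrite mulr_ge0.
  by clear; lra.
(* Expansion of the gradient of the Lagrangian, explicit in [l]: centred at [xs] it serves
   coercivity, centred at [x] the Newton error. *)
have T (y z : 'rV[R]_n) (l : 'rV[R]_p) : enorm (y - xs) < r0 -> enorm (z - xs) < r0 ->
    enorm (G y + l *m (J y)^T - (G z + l *m (J z)^T) - (y - z) *m H l z)
      <= (cf + k) * (1 + enorm l) * enorm (y - z) ^+ 2.
  move=> yr zr; apply: enorm_le_dotp => [|u].
    by rewrite mulr_ge0 ?sqr_ge0// mulr_ge0// addr_ge0.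
  have [_ _ _ /(_ u) Tf] := fB y z (nf y yr) (nf z zr).
  have [_ _ _ /(_ u) Th] := hB y z (nh y yr) (nh z zr).
  have al (a1 a2 a3 : R) (b1 b2 b3 : 'rV[R]_p) :
      (a1 + dotp l b1) - (a2 + dotp l b2) - (a3 + dotp l b3) =
      (a1 - a2 - a3) + dotp l (b1 - b2 - b3) by rewrite !dotpBr; ring.
  have E : dotp (G y + l *m (J y)^T - (G z + l *m (J z)^T) - (y - z) *m H l z) u =
      ('d f y u - 'd f z u - 'd (fun w => 'd f w u) z (y - z))
      + dotp l ('d h y u - 'd h z u - 'd (fun w => 'd h w u) z (y - z)).
    apply: etrans _ (al _ _ _ _ _ _).
    rewrite (dotpBl _ ((y - z) *m _)) (dotpBl _ (G z + _)) (dotpDl (G y)) (dotpDl (G z)).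
    congr (_ + _ - (_ + _) - _); [exact: dG|exact: dJ|exact: dG|exact: dJ|].
    exact: dH (inU z zr).
  have h2 := dotp_diff_le l Th.
  rewrite E; apply: le_trans (ler_norm _) _; apply: le_trans (ler_normD _ _) _.
  apply: le_trans (lerD Tf h2) _.
  have := arith cf (enorm l) (enorm (y - z) ^+ 2 * enorm u) cf0' (enorm_ge0 l).
  rewrite mulr_ge0 ?sqr_ge0// => /(_ isT); rewrite /k -/P.
  by clear; lra.
have cM : chart [set x | h x = 0] xs h (J xs).
  split=> //; last by apply/nearE; exists 1 => // y _; split.
  by rewrite JE; apply: strictly_differentiable_J; exists Uh; split=> //; exact: hU (xs0 _ rh0).
have fxs : F xs = (f xs)%:E by exact: (nbhs_singleton Ff h0).
(* Growth makes 0 a regular subgradient of [F] at [xs], so the gradient of [f] has no tangential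
   part there and a multiplier [ls] exists. *)
have tangent0 tau : tau *m J xs = 0 -> dotp (G xs) tau = 0.
  move=> tA; rewrite -(dot0p tau); apply: esym.
  apply: (reg_subdiff_tangent cM _ Ff _ tA).
    by rewrite GE; apply: Ck_near_gradient; exists Uf; split=> //; exact: fU (xs0 _ rf0).
  split=> [|e e0]; first by rewrite fxs.
  apply/nearE; exists e1 => // z ze; have := smin z ze; rewrite dot0p sub0r.
  apply: le_trans; rewrite leeD2l// lee_fin; apply: (@le_trans _ _ 0).
    by rewrite oppr_le0 mulr_ge0// ltW.
  by rewrite mulr_ge0 ?sqr_ge0// ltW.
have [w wE] := orth_ker_image tangent0.
pose ls := - w; have gl0 : G xs + ls *m (J xs)^T = 0 by rewrite /ls mulNmx -wE subrr.
pose a := enorm ls; have a0 : 0 <= a by exact: enorm_ge0.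
have ck0 : 0 <= cf + k by rewrite addr_ge0.
have c10 : 0 <= (cf + k) * (1 + a) by rewrite mulr_ge0// addr_ge0.
have /nearP[e2 e20 Ff'] := Ff.
have r10 : 0 < Num.min r0 (Num.min e1 e2) by rewrite lt_min r00 lt_min e10.
have coer (tau : 'rV[R]_n) : tau *m J xs = 0 ->
    eta / 2 * enorm tau ^+ 2 <= dotp (tau *m H ls xs) tau.
  apply: (@coercive_of_growth R n p _ xs h (J xs) (H ls xs)
    (fun x => G x + ls *m (J x)^T) eta ((cf + k) * (1 + a)) (Num.min r0 (Num.min e1 e2)) cM eta0 c10 r10).
    move=> x; rewrite lt_min => /andP[xr _]; have := T x xs ls xr (xs0 _ r00).
    by rewrite gl0 subr0.
  move=> q hq; rewrite lt_min => /andP[qr]; rewrite lt_min => /andP[qe qe2].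
  have dl (t : R) : 0 <= t <= 1 -> U (xs + t *: (q - xs)).
    by move=> t01; apply: inU; exact: (seg_ball t01 qr (xs0 _ r00)).
  have [t t01|t t01 E] := @mean_value R n (lagrangian f h ls) q xs.
    by have [] := diff_lagrangian fCU hCU ls (dl t t01).
  exists t => //; have [_ /(_ (q - xs)) dE] := diff_lagrangian fCU hCU ls (dl t t01).
  have E2 : dotp (G (xs + t *: (q - xs)) + ls *m (J (xs + t *: (q - xs)))^T) (q - xs) =
      lagrangian f h ls q - lagrangian f h ls xs.
    apply: esym; apply: etrans E _; apply: etrans dE _.
    rewrite dotpDl; congr (_ + _); apply: esym; [exact: dG|exact: dJ].
  rewrite E2 /lagrangian hq h0 !dotp0 !addr0.
  by have := smin q qe; rewrite fxs (Ff' q qe2 hq) -EFinD lee_fin; clear; lra.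
have eta2 : 0 < eta / 2 by rewrite divr_gt0.
pose c := (cf + k) + B.
have c0 : 0 < c by rewrite /c ltr_wpDl.
have cfkc : cf + k <= c by rewrite lerDl ltW.
have Bc : B <= c by rewrite lerDr.
have kc : k <= c by apply: le_trans cfkc; rewrite lerDr.
have cfc : cf <= c by apply: le_trans cfkc; rewrite lerDl.
have [|C [rho [C0 rho0 hC']]] := @sqp_abstract R n p G J H h xs ls c r0 (eta / 2) c0 r00 eta2 rJ gl0 coer.
  move=> x xr; have xsr := xs0 _ r00; have D0 := enorm_ge0 (x - xs).
  have [Tf1 Tf2 _ _] := fB x xs (nf x xr) (nf xs xsr).
  have [Th1 Th2 _ _] := hB x xs (nh x xr) (nh xs xsr).
  split.
  - split.
      (* Centred at [x], where the constraint is linearized, and evaluated at [xs], where [h]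
         vanishes. *)
      have [_ _ Th3 _] := hB xs x (nh xs xsr) (nh x xr); rewrite h0 sub0r in Th3.
      have E : h x - (x - xs) *m J x = - (- h x - 'd h x (xs - x)).
        have -> : 'd h x (xs - x) = (xs - x) *m J x by rewrite JE mul_jacobian.
        by rewrite -(opprB x xs) mulNmx !opprK opprD opprK.
      rewrite E enormN; apply: le_trans (enorm_le_norm _) _.
      apply: le_trans (ler_wpM2l P0 Th3) _; rewrite (enormBC xs) mulrA.
      by rewrite ler_wpM2r ?sqr_ge0.
    apply: enorm_le_dotp => [|u]; first by rewrite mulr_ge0// ltW.
    have E : dotp (G x - G xs) u = 'd f x u - 'd f xs u.
      by rewrite dotpBl; congr (_ - _); exact: dG.
    rewrite E; apply: le_trans (ler_norm _) _; apply: le_trans (Tf1 u) _.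
    by rewrite ler_wpM2r// ler_wpM2r.
  - move=> l; have := T xs x l xsr xr; rewrite -(opprB x xs) mulNmx opprK (enormN (x - xs)).
    move=> h1; apply: le_trans h1 _; rewrite ler_wpM2r ?sqr_ge0// ler_wpM2r//.
    exact: addr_ge0.
  - move=> v; have E : v *m J x - v *m J xs = 'd h x v - 'd h xs v.
      by congr (_ - _); rewrite JE mul_jacobian.
    rewrite E; apply: le_trans (enorm_le_norm _) _.
    apply: le_trans (ler_wpM2l P0 (Th1 v)) _; rewrite !mulrA.
    by rewrite ler_wpM2r// ler_wpM2r.
  - move=> l v; apply: enorm_le_dotp => [|u].
      by rewrite !mulr_ge0 ?addr_ge0 ?mulr_ge0 ?addr_ge0// ltW.
    have al (a1 a2 : R) (b1 b2 : 'rV[R]_p) :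
        (a1 + dotp l b1) - (a2 + dotp ls b2) = (a1 - a2) + dotp l (b1 - b2) + dotp (l - ls) b2.
      by rewrite !dotpBr dotpBl; ring.
    have E : dotp (v *m H l x - v *m H ls xs) u =
        ('d (fun w => 'd f w u) x v - 'd (fun w => 'd f w u) xs v) +
        dotp l ('d (fun w => 'd h w u) x v - 'd (fun w => 'd h w u) xs v) +
        dotp (l - ls) ('d (fun w => 'd h w u) xs v).
      apply: etrans _ (al _ _ _ _); rewrite dotpBl; congr (_ - _).
        exact: dH (inU x xr).
      exact: dH (inU xs xsr).
    have h2 := dotp_diff_le l (Th2 u v).
    have h3 := norm_dotp (l - ls) ('d (fun w => 'd h w u) xs v).
    have h4 := ler_wpM2l (enorm_ge0 (l - ls)) (hB2 u v).
    rewrite E; apply: le_trans (ler_norm _) _; apply: le_trans (ler_normD _ _) _.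
    apply: le_trans (lerD (le_trans (ler_normD _ _) (lerD (Tf2 u v) h2)) (le_trans h3 h4)) _.
    set X := enorm (x - xs); set Y := enorm (l - ls); set L := enorm l.
    set u' := enorm u; set v' := enorm v.
    have uv : 0 <= u' * v' by rewrite mulr_ge0 ?enorm_ge0.
    have h5 := arith cf L (X * (u' * v')) cf0' (enorm_ge0 l); rewrite mulr_ge0 ?enorm_ge0// in h5.
    have {}h5 := h5 isT.
    have h6 : (cf + k) * ((1 + L) * (X * (u' * v'))) <= c * ((1 + L) * (X * (u' * v'))).
      by rewrite ler_wpM2r// mulr_ge0 ?addr_ge0 ?enorm_ge0// mulr_ge0 ?enorm_ge0.
    have h7 : B * (Y * (u' * v')) <= c * (Y * (u' * v')).
      by rewrite ler_wpM2r// mulr_ge0 ?enorm_ge0.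
    by move: h5 h6 h7; rewrite /k; clear; lra.
  - by move=> l u v; rewrite HE; exact: (hessian_lagrangian_sym oU fCU hCU l v u (inU x xr)).
exists C, (Num.min rho r0); split=> // [|x d]; first by rewrite lt_min rho0.
rewrite lt_min => /andP[xrho xr] [l [_ lmin] dmin].
apply: (hC' x d l xrho).
  have dhx : differentiable h x by apply: hC.1; exact: hU (nh x xr).
  move=> l'; have := lmin l' I; rewrite (multiplier_sum l dhx) (multiplier_sum l' dhx).
  by rewrite GE JE ler_sqr ?nnegrE.
by rewrite GE HE JE.
Qed.

End SQPStep.

(** * Local convergence of the algorithm *)

Section Assembly.
Context {R : realType}.

(** The subgradient [v] projecting to 0 is tangent. The affine span of the subdifferential is
    parallel to the normal space, so any subgradient [u] projects to [u - v], and a relative ball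
    around 0 lifts to one around [v]. *)
Lemma normal_ascent_ball m (g : 'rV[R]_m -> \bar R) (M : set 'rV[R]_m) ybar q
    (h : 'rV[R]_m -> 'rV[R]_q) :
  partly_smooth g M ybar -> defining_map M ybar h -> normal_ascent g M ybar ->
  exists (v : 'rV[R]_m) (e : R), [/\ subdiff g ybar v, v *m 'J h ybar = 0, 0 < e &
    forall n, Defs.normal_space M ybar n -> enorm n < e -> subdiff g ybar (v + n)].
Proof.
move=> ps hM [[v gv [_ vmin]] [e e0 ri]].
set N := Defs.normal_space M ybar in vmin ri *.
have NE n : N n <-> forall tau : 'rV[R]_m, tau *m 'J h ybar = 0 -> dotp n tau = 0.
  exact: (normal_spaceE hM).
have ND (a b : 'rV[R]_m) (s t : R) : N a -> N b -> N (s *: a + t *: b).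
  move=> /NE ha /NE hb; apply/NE => tau tA.
  by rewrite dotpDl !dotpZl ha// hb// !mulr0 addr0.
have NB (a b : 'rV[R]_m) : N a -> N b -> N (a - b).
  by move=> Na Nb; have := ND a b 1 (-1) Na Nb; rewrite scale1r scaleN1r.
have orth (u p : 'rV[R]_m) : nearest N u p -> forall n, N n -> dotp (u - p) n = 0.
  move=> [Np pmin] n Nn.
  have : -2 * dotp (u - p) n = 0.
    apply: (@quadratic_ge0 _ _ (dotp n n)) => s.
    have := pmin (p + s *: n); rewrite -{1}[p]scale1r => /(_ (ND _ _ _ _ Np Nn)).
    rewrite -ler_sqr ?nnegrE// opprD addrA (sqr_enormB (u - p)) enormZ dotpZr exprMn -normrX.
    rewrite ger0_norm ?sqr_ge0// (sqr_enorm n).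
    by move: (enorm _ ^+ 2) (dotp (u - p) n) (dotp n n); clear; move=> a b c; lra.
  by move/eqP; rewrite mulf_eq0 oppr_eq0 pnatr_eq0/= => /eqP.
have N0 : N 0 by apply/NE => tau _; rewrite dot0p.
have vN n : N n -> dotp v n = 0 by move=> Nn; rewrite -[v]subr0; exact: orth Nn.
have [a sharp] := ps_sharp ps.
have span x : affine_span (subdiff g ybar) x <-> exists2 n, N n & a + n = x by rewrite sharp.
have diffN x y : affine_span (subdiff g ybar) x -> affine_span (subdiff g ybar) y -> N (x - y).
  move=> /span[n Nn <-] /span[n' Nn' <-].
  by rewrite opprD addrACA subrr add0r; exact: NB.
have sv := sub_affine_span gv.
have near_v u : subdiff g ybar u -> nearest N u (u - v).
  move=> gu; have Nuv := diffN _ _ (sub_affine_span gu) sv.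
  split=> // n Nn; rewrite subKr -ler_sqr ?nnegrE//.
  have -> : u - n = v + (u - v - n) by rewrite addrA addrCA subrr addr0.
  by rewrite sqr_enormD vN ?mulr0 ?addr0 ?lerDl ?sqr_ge0//; exact: NB.
exists v, e; split=> // [|n Nn ne].
  apply: enorm_eq0; apply/eqP; rewrite -sqrf_eq0 sqr_enorm -dotp_mulmx_tr dotpC.
  by apply/eqP/vN/NE => tau tA; rewrite dotp_mulmx_tr tA dotp0.
have [k [b [w [gb w1 vnE]]]] : affine_span (subdiff g ybar) (v + n).
  have [n0 Nn0 vE] := (span v).1 sv; apply/span; exists (n0 + n); last by rewrite addrA vE.
  by have := ND n0 n 1 1 Nn0 Nn; rewrite !scale1r.
have nspan : affine_span (nearest_image N (subdiff g ybar)) n.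
  exists k, (fun i => b i - v), w; split=> // [i|].
    by exists (b i) => //; exact: near_v.
  under eq_bigr do rewrite scalerBr.
  by rewrite sumrB -vnE -scaler_suml w1 scale1r addrC addKr.
have n0e : enorm (n - 0) < e by rewrite subr0.
have [u gu un] := ri n nspan n0e.
have Nu : N (u - n - v) by rewrite addrAC; apply: NB => //; exact: diffN (sub_affine_span gu) sv.
have u0 : u - n - v = 0.
  apply: enorm_eq0; apply/eqP; rewrite -sqrf_eq0 sqr_enorm.
  by rewrite dotpBl (orth _ _ un)// vN// subrr.
by rewrite -(subr0_eq u0) subrK.
Qed.

(** The accuracy [Num.min d r] places the proximal point both where identification puts it on
    [mfd sstar] and where [sstar] inherits the structure property; the catalogue then gives
    equality. *)
Lemma prox_detects_structure m (g : 'rV[R]_m -> \bar R) (Cat : set (structure R m))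
    (sstar : structure R m) (ybar : 'rV[R]_m) :
  proper_function g -> prox_bounded g -> prox_regular g ybar ->
  partly_smooth g (mfd sstar) ybar -> normal_ascent g (mfd sstar) ybar ->
  associated_data g sstar ybar -> catalogue g Cat -> Cat sstar ->
  exists eps Gamma : R, [/\ 0 < eps, 0 < Gamma & forall (gamma : R) y0 y s,
    0 < gamma -> gamma <= Gamma -> enorm (y0 - ybar) <= eps * gamma ->
    prox gamma g y0 y -> Cat s -> structure_at g s y -> s = sstar].
Proof.
move=> pg pb pr ps na sd cat Cs; have [hM [gtC gM]] := sd.
have [v [e [gv vJ e0 ball]]] := normal_ascent_ball ps hM na.
have [d d0 hd] := identification ps pr gv e0 ball.
have /nearP[r r0 hr] := structure_detected ps sd gv e0 ball.
have cM := defining_map_chart hM; have gG := Ck_near_gradient gtC.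
have My : mfd sstar ybar by case: cM.
have vG : dotp v v = dotp (gradient (@ext _ _ sstar) ybar) v.
  have [cr _] := nbhs_singleton (ps_regular ps) My.
  apply: (reg_subdiff_tangent cM gG gM _ vJ).
  by move: gv; rewrite [subdiff g ybar]cr.
have dr0 : 0 < Num.min d r by rewrite lt_min d0.
have [eps [Gamma [eps0 G0 H]]] := prox_asymptotics pg pb cM gG gM (pr v gv) gv vJ vG dr0.
exists eps, Gamma; split=> // gamma y0 y s g0 gG0 yg py sC sy.
have [yb vb gyb] := H gamma y0 y g0 gG0 yg py.
have [yd yr] : enorm (y - ybar) < d /\ enorm (y - ybar) < r.
  by move: yb; rewrite lt_min => /andP[].
have vd : enorm (gamma^-1 *: (y0 - y) - v) < d by move: vb; rewrite lt_min => /andP[].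
have gyd : (g y < g ybar + d%:E)%E.
  by apply: lt_le_trans gyb _; rewrite leeD2l// lee_fin ge_min lexx.
have Msy := hd y _ yd vd gyd (prox_subdiff g0 pg py).
exact: (cat s sstar y sC Cs sy (hr y yr Msy s sy)).
Qed.

(** On a connected set the distance to [xs] takes all intermediate values: leaving the ball would
    force a point on the sphere of radius [r], where growth exceeds the level [b]. *)
Lemma sublevel_component_ball n (F : 'rV[R]_n -> \bar R) (xs x : 'rV[R]_n) (a eta e r : R) (b : \bar R) :
  F xs = a%:E ->
  (forall x, enorm (x - xs) < e -> (F xs + (eta * enorm (x - xs) ^+ 2)%:E <= F x)%E) ->
  0 <= r -> r < e -> (b < (a + eta * r ^+ 2)%:E)%E ->
  connected_component [set z | (F z <= b)%E] xs x -> enorm (x - xs) <= r.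
Proof.
move=> Fxs smin r0 re br [C [Cxs Cb cC] Cx]; rewrite leNgt; apply/negP => rx.
have ph : continuous (fun y : 'rV[R]_n => enorm (y - xs)).
  move=> y; apply: continuous_comp; last exact: enorm_continuous.
  by apply: continuousB; [exact: cvg_id|exact: cst_continuous].
have : connected [set enorm (y - xs) | y in C].
  by apply: connected_continuous_connected => //; exact: continuous_subspaceT.
move=> /connected_intervalP/(_ 0 (enorm (x - xs))) H.
have C0 : [set enorm (y - xs) | y in C] 0 by exists xs => //; rewrite subrr enorm0.
have C1 : [set enorm (y - xs) | y in C] (enorm (x - xs)) by exists x.
have r01 : 0 <= r <= enorm (x - xs) by rewrite r0 ltW.
have [z Cz zr] := H C0 C1 r r01.
have ze : enorm (z - xs) < e by rewrite zr.
have := le_lt_trans (le_trans (smin z ze) (Cb z Cz)) br.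
by rewrite Fxs zr -EFinD ltxx.
Qed.

(** At the first index not above [G] the predecessor exceeds [G], so its half exceeds [G / 2]; if
    that index is 0, the initial stepsize equals [G]. *)
Lemma halving_hits_window (gamma : nat -> R) (G : R) :
  (forall k, gamma k.+1 = gamma k / 2) -> 0 < G -> G <= gamma 0%N ->
  exists k, G / 2 <= gamma k <= G.
Proof.
move=> half G0 GG.
have gE k : gamma k = gamma 0%N / 2 ^+ k.
  elim: k => [|k IH]; first by rewrite expr0 divr1.
  by rewrite half IH exprSr invfM mulrA.
have ex : exists k, gamma k <= G.
  have [k hk] : exists k, gamma 0%N / G < k%:R.
    by exists (Num.truncn (gamma 0%N / G)).+1; rewrite truncnS_gt.
  exists k; rewrite gE ler_pdivrMr ?exprn_gt0// mulrC -ler_pdivrMr//.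
  apply: le_trans (ltW hk) _; rewrite -natrX ler_nat.
  exact: ltnW (ltn_expl _ _).
have [k kG kmin] := ex_minnP ex; exists k; rewrite kG andbT.
case: k kG kmin => [|k] kG kmin; first by move: GG G0; clear; lra.
have : ~~ (gamma k <= G) by apply/negP => /kmin; rewrite ltnn.
by rewrite half -ltNge; clear; lra.
Qed.

End Assembly.

Unset Implicit Arguments.
Set Strict Implicit.

Theorem theorem4p5 (R : realType) (n m : nat)
    (c : 'rV[R]_n -> 'rV[R]_m) (g : 'rV[R]_m -> \bar R)
    (xstar : 'rV[R]_n)
    (Cat : set (structure R m)) (sstar : structure R m)
    (rho : R -> R)
    (c_C2 : Ck_on 2 setT c)
    (g_proper : proper_function g)
    (g_lsc : lower_semicontinuous g)
    (xstar_min : strong_minimizer (g \o c) xstar)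
    (Cat_catalogue : catalogue g Cat)
    (sstar_Cat : Cat sstar)
    (sstar_data : associated_data g sstar (c xstar))
    (xstar_qualified : qualified g c (mfd sstar) xstar)
    (Ftilde_smooth : C2_lipschitz_near xstar (ext sstar \o c))
    (h_smooth : C2_lipschitz_near xstar (defmap sstar \o c))
    (h_full_rank : \forall x \near xstar, row_full ('J (defmap sstar \o c) x))
    (rho_gt0 : forall K, 0 < K -> 0 < rho K) :
  exists eps Gamma : R, [/\ 0 < eps, 0 < Gamma &
    forall (gamma : nat -> R) (x : nat -> 'rV[R]_n)
           (s : nat -> structure R m) (d : nat -> 'rV[R]_n),
      algorithm_run g c Cat gamma x s d ->
      enorm (x 0%N - xstar) < eps ->
      (`| (g \o c) (x 0%N) - (g \o c) xstar | < eps%:E)%E ->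
      Gamma <= gamma 0%N ->
      nonconvex_stability (g \o c) xstar x ->
      no_maratos (g \o c) xstar rho x d ->
      exists2 C : R, 0 < C &
        \forall k \near \oo,
          c @^-1` mfd (s k) = c @^-1` mfd sstar /\
          enorm (x k.+1 - xstar) <= C * enorm (x k - xstar) ^+ 2].
Proof.
case: (xstar_qualified) => pb pr ps _ na _; have [hM [gtC gM]] := sstar_data.
have [epsp [G [epsp0 G0 detect]]] :=
  prox_detects_structure g_proper pb pr ps na sstar_data Cat_catalogue sstar_Cat.
have cC : Ck_near 2 xstar c by exists setT; split=> //; exact: openT.
have [L [rc [L0 rc0 cL]]] := strictly_differentiable_lip (strictly_differentiable_J cC).
have cxx (r : R) : 0 < r -> enorm (xstar - xstar) < r by rewrite subrr enorm0.
have near_c (A : set 'rV[R]_m) : (\forall y \near c xstar, A y) -> \forall x \near xstar, A (c x).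
  move=> /nearP[r r0 hr]; apply/nearE; exists (Num.min rc (r / L)) => [|x].
    by rewrite lt_min rc0 divr_gt0.
  rewrite lt_min ltr_pdivlMr// => /andP[xrc xr]; apply: hr.
  by apply: le_lt_trans (cL x xstar xrc (cxx _ rc0)) _; rewrite mulrC.
have [M0 _ _ Mh] := hM.
have h0 : (defmap sstar \o c) xstar = 0 by case: (nbhs_singleton Mh) => /(_ M0).
have Ff : \forall x \near xstar, (defmap sstar \o c) x = 0 -> (g \o c) x = ((ext sstar \o c) x)%:E.
  have := near_c _ Mh; have := near_c _ gM.
  by apply: filterS2 => x gx [_ Mx] hx; exact: gx (Mx hx).
have rJ := nbhs_singleton h_full_rank.
have [K [rs [K0 rs0 sqp]]] := sqp_quadratic Ftilde_smooth h_smooth rJ h0 Ff xstar_min.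
have [eta [e [eta0 e0 smin]]] := xstar_min.
have fxs : (g \o c) xstar = ((ext sstar \o c) xstar)%:E by exact: (nbhs_singleton Ff h0).
(* In order: the SQP estimate, the descent condition for the constant [K], the Lipschitz ball of
   [c], the growth ball; then [L r <= epsp (G / 2)] starts detection, and [K r <= 1/2] halves the
   distance at each step. *)
pose r1 := Num.min (Num.min (Num.min rs (rho K)) (Num.min rc e))
  (Num.min (epsp * (G / 2) / L) (2 * K)^-1).
have r10 : 0 < r1.
  by rewrite !lt_min rs0 rho_gt0// rc0 e0 invr_gt0 !divr_gt0 ?mulr_gt0// divr_gt0.
pose r := r1 / 2; have r0 : 0 < r by rewrite divr_gt0.
have : r < r1 by rewrite /r; move: r10; clear; lra.
rewrite !lt_min => /andP[/andP[/andP[r_s r_rho] /andP[r_c r_e]] /andP[r_L r_K]].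
have rL : L * r <= epsp * (G / 2) by move: r_L; rewrite ltr_pdivlMr// mulrC => /ltW.
have rK : K * r <= 2^-1.
  move: r_K; rewrite -div1r ltr_pdivlMr ?mulr_gt0//; clear; lra.
(* [eta * r ^+ 2] is the growth on the sphere of radius [r], which the starting level must not
   reach. *)
exists (eta * r ^+ 2), G; split=> //; first by rewrite mulr_gt0// exprn_gt0.
move=> gamma x s d run _ Fx0 Gg stab maratos.
have ball k : enorm (x k - xstar) <= r.
  apply: (sublevel_component_ball fxs smin (ltW r0) r_e _ (stab k)).
  move: Fx0; rewrite fxs; case: ((g \o c) (x 0%N)) => [b||]//=.
    by rewrite !lte_fin ltr_norml => /andP[_]; clear; lra.
have [k0 /andP[k0G k0G']] : exists k, G / 2 <= gamma k <= G.
  by apply: halving_hits_window => // k; have [] := run k.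
(* The last conclusion restores the last hypothesis at [k.+1]: the stepsize is halved and the
   distance at least halved. *)
have step k : 0 < gamma k -> gamma k <= G -> L * enorm (x k - xstar) <= epsp * gamma k ->
    [/\ s k = sstar, enorm (x k.+1 - xstar) <= K * enorm (x k - xstar) ^+ 2 &
      L * enorm (x k.+1 - xstar) <= epsp * gamma k.+1].
  move=> gk0 gkG xk; have xr := ball k; have [ghalf sC [y py sy] sq xS] := run k.
  have cx : enorm (c (x k) - c xstar) <= epsp * gamma k.
    by apply: le_trans xk; apply: cL (cxx _ rc0); exact: le_lt_trans r_c.
  have sE := detect _ _ _ _ gk0 gkG cx py sC sy.
  rewrite sE in sq; have dK := sqp _ _ (le_lt_trans xr r_s) sq.
  (* The quadratic estimate is the premise of the descent condition, so the acceptance test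
     succeeds. *)
  have desc := maratos K K0 k (le_lt_trans xr r_rho) dK.
  have xE : x k.+1 = x k + d k by rewrite xS; move: desc => /= ->.
  split=> //; first by rewrite xE.
  rewrite xE ghalf; set D := enorm (x k - xstar) in xk xr dK *.
  have D0 : 0 <= D by exact: enorm_ge0.
  have h1 : K * D <= 2^-1 by apply: le_trans rK; rewrite ler_pM2l.
  have h2 : K * D * D <= 2^-1 * D by rewrite ler_wpM2r.
  have h3 : L * (K * D ^+ 2) <= L * (2^-1 * D) by rewrite ler_pM2l// expr2 mulrA.
  have h4 := ler_wpM2l (ltW L0) dK.
  by move: h3 h4 xk; clear; lra.
(* At [k0] the bound comes from confinement and [gamma k0 >= G / 2], later from the preceding
   step. *)
have inv k : (k0 <= k)%N -> [/\ 0 < gamma k, gamma k <= G & L * enorm (x k - xstar) <= epsp * gamma k].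
  move=> /subnKC <-; elim: (k - k0)%N => [|j [gj0 gjG xj]].
    rewrite addn0; split=> //; first by apply: lt_le_trans k0G; rewrite divr_gt0.
    apply: le_trans (ler_wpM2l (ltW L0) (ball k0)) _; apply: le_trans rL _.
    by rewrite ler_pM2l.
  have [_ _ H] := step _ gj0 gjG xj; have [gE _ _ _ _] := run (k0 + j)%N.
  rewrite addnS; split=> //; rewrite gE; first by rewrite divr_gt0.
  by move: gj0 gjG; clear; lra.
exists K => //; exists k0 => // k /= /inv[gk0 gkG xk].
by have [-> ? _] := step k gk0 gkG xk.
Qed.
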